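(* Let $0<\alpha<1$ and let $\{B(t): t\in[0,1]\}$ be a fractional Brownian motion of Hurst index $\alpha$. For a set $D\subset[0,1]$ the following are equivalent: (i) $\mathbb{P}\big(\dim_P B(A)\ge(1/\alpha)\dim_H A \text{ for all } A\subset D\big)=1$; (ii) $\dim_H D\le\alpha$.
   Context: Fractional Brownian motion of Hurst index $\alpha\in(0,1)$: a Gaussian process $B$ with stationary increments such that $B(0)=0$, $t^{-\alpha}B(t)$ is standard normal for every $t>0$, and almost surely $t\mapsto B(t)$ is continuous; it is real-valued, with covariance $\mathbb{E}(B(t)B(s))=\frac12(|t|^{2\alpha}+|s|^{2\alpha}-|t-s|^{2\alpha})$. $B(A)=\{B(t):t\in A\}$. A statement $\mathbb{P}(\cdots)=1$ means that the property in parentheses holds almost surely (with an exceptional null event not depending on $A$). $\dim_H$ is Hausdorff dimension and $\dim_P$ is packing dimension, $\dim_P X=\inf\{\sup_i\overline{\dim}_M X_i: X=\bigcup_{i=1}^\infty X_i\}$, where $\overline{\dim}_M$ is the upper Minkowski dimension. The empty set has dimension $0$ in both senses. *)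

(* Defs.v *)
From HB Require Import structures.
From mathcomp Require Import all_boot all_order all_algebra.
From mathcomp Require Import all_classical all_reals all_analysis.

Set Implicit Arguments.
Unset Strict Implicit.
Unset Printing Implicit Defensive.

Import Order.TTheory GRing.Theory Num.Theory.
Import numFieldNormedType.Exports.

Local Open Scope classical_set_scope.
Local Open Scope ring_scope.
Local Open Scope ereal_scope.

Section dimensions.
Context {R : realType}.
Implicit Types X : set R.

(* Adjoining 0 gives the empty set diameter 0 instead of -oo. *)
Definition diam X : \bar R :=
  ereal_sup (0 |` [set `|x - y|%:E | x in X & y in X]).

(* Empty pieces are left out of the sum: diam set0 `^ 0 would be 1. *)
Definition hausdorff_premeasure (s : R) (delta : R) X : \bar R :=
  ereal_inf [set \sum_(0 <= i <oo | F i != set0) (diam (F i) `^ s)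
            | F in [set F : nat -> set R |
                X `<=` \bigcup_i F i /\ forall i, diam (F i) <= delta%:E]].

Definition hausdorff_measure (s : R) X : \bar R :=
  ereal_sup [set hausdorff_premeasure s delta X
            | delta in [set delta : R | (0 < delta)%R]].

Definition hausdorff_dim X : \bar R :=
  ereal_inf [set s%:E | s in [set s : R |
    (0 <= s)%R /\ hausdorff_measure s X = 0]].

(* The value is +oo when X is not bounded. *)
Definition covering_number (e : R) X : \bar R :=
  ereal_inf [set (n%:R : R)%:E | n in [set n : nat |
    exists F : 'I_n -> set R,
      X `<=` \bigcup_i F i /\ forall i, diam (F i) <= e%:E]].

(* The empty set has to be treated apart, since lne 0 = -oo. *)
Definition upper_minkowski_dim X : \bar R :=
  if X == set0 then 0 else
  limf_esup (fun e : R => lne (covering_number e X) * ((- ln e)^-1)%:E)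
    (0%R : R)^'+.

Definition packing_dim X : \bar R :=
  ereal_inf [set ereal_sup (range (fun i => upper_minkowski_dim (F i)))
            | F in [set F : nat -> set R | X = \bigcup_i F i]].

End dimensions.

Section processes.
Context {R : realType} {d : measure_display} {T : measurableType d}.
Variable P : probability T R.

(* normal_prob m 0 is not the Dirac mass at m, so degenerate Gaussian laws are
   given separately. *)
Definition gaussian_law (mu : set R -> \bar R) : Prop :=
  (exists m : R, forall U, measurable U -> mu U = \d_m U) \/
  (exists m s : R, (0 < s)%R /\
     forall U, measurable U -> mu U = normal_prob m s U).

Definition gaussian_process (I : set R) (B : R -> {RV P >-> R}) : Prop :=
  forall (n : nat) (t : 'I_n -> R) (c : 'I_n -> R), (forall i, I (t i)) ->
    gaussian_law (pushforward P (fun w => (\sum_(i < n) c i * B (t i) w)%R)).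

Definition stationary_increments (I : set R) (B : R -> {RV P >-> R}) : Prop :=
  forall s t h : R, I s -> I t -> I (s + h)%R -> I (t + h)%R ->
  forall U : set R, measurable U ->
    pushforward P (fun w => (B (t + h) w - B (s + h) w)%R) U =
    pushforward P (fun w => (B t w - B s w)%R) U.

(* Only the variables B t with t in I matter. *)
Record fractional_brownian_motion (alpha : R) (I : set R)
    (B : R -> {RV P >-> R}) : Prop := FractionalBrownianMotion {
  fbm_gaussian : gaussian_process I B ;
  fbm_stationary : stationary_increments I B ;
  fbm_0 : forall w, B 0%R w = 0%R ;
  fbm_normal : forall t, I t -> (0 < t)%R -> forall U : set R, measurable U ->
    pushforward P (fun w => (t `^ (- alpha) * B t w)%R) U = normal_prob 0 1 U ;
  fbm_continuous : {ae P, forall w, {within I, continuous (fun t => B t w)}}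
}.

End processes.

(* Main.v *)
Require Import Defs.
From HB Require Import structures.
From mathcomp Require Import all_boot all_order all_algebra.
From mathcomp Require Import all_classical all_reals all_analysis.
From mathcomp Require Import measurable_realfun ring lra zify.
Set Implicit Arguments.
Unset Strict Implicit.
Unset Printing Implicit Defensive.
Import Order.TTheory GRing.Theory Num.Theory.
Import numFieldNormedType.Exports.
Local Open Scope classical_set_scope.
Local Open Scope ring_scope.

(** Since the packing dimension of a subset of the line is at most 1
    ([packing_dim_le1]), the first property applied to [A = D] forces
    [dim_H D <= alpha].

    Conversely, let [dim_H D <= alpha] and [e > 0]. As [dim_H D < alpha + e], there
    are sets [G n] of codes [k] of dyadic intervals [[k / 2^n, (k + 1) / 2^n]] such
    that every point of [D] lies in intervals of [G n] for infinitely many [n], and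
    such that at most about [n 2 ^ ((alpha + e) l)] codes of [G n] lie at distance
    at most [2 ^ l] from a given one ([regular_cover], [hausdorff_dim_codes]). They
    are obtained from covers of small mass, by passing to the largest dyadic
    intervals that are not more expensive than what the cover has inside them.

    The probabilistic core is [ae_small_clusters]: almost surely, for all large [n]
    and all [k0] in [G n], at most [2 ^ (4 e n)] codes [k] of [G n] satisfy
    [|B (k / 2^n) - B (k0 / 2^n)| <= K 2 ^ (- (alpha - e) n)]. With the modulus of
    continuity [ae_modulus], this bounds the number of intervals of [G n] whose
    images meet a given set of diameter [2 ^ (- (alpha - e) n)]. Let [A] be a subset
    of [D] and [g > dim_P B(A)]. Then [B(A)] is a countable union of pieces, each of
    which is covered by at most [2 ^ ((alpha - e) g n)] such sets when [n] is large.
    Hence [A] lies in the limsup of families of about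
    [2 ^ (((alpha - e) g + 4 e) n)] dyadic intervals of level [n], which bounds
    [dim_H A] ([hausdorff_dim_preimage_le]). The exceptional event depends only on
    [D] and [e]; letting [e] tend to 0 along a sequence, and then [g] to
    [dim_P B(A)], gives [dim_H A <= alpha dim_P B(A)].

    The bound on clusters comes from moments of high order. A cluster of [x] codes
    contains about [x ^ m] tuples of [m] distinct codes, and the probability that
    the images of such a tuple are within [r] of the image of [k0] is at most
    [(C r) ^ m] times the product over [i] of [\sum_(j < i) |t i - t j| ^ (- alpha)]
    ([fbm_small_ball]); the regularity of [G n] bounds the sum of these products
    over all tuples ([regular_energy_le], [sum_tuple_weight_le]).

    The small ball estimate rests on local nondeterminism ([fbm_form_ge]): a
    combination of values of [B] with zero sum, in which [B (t i)] has the
    coefficient 1, has variance at least [c delta ^ (2 alpha)] when the other times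
    are at distance at least [delta] from [t i]. It follows from the spectral formula
    [integral_osc], tested against a triangle that vanishes at the other times. The
    conditional variances are turned into a bound on probabilities by means of
    characteristic functions only: [exp (- X^2 / 2)] is an average of the functions
    [cos (u X)], and the averages are evaluated one variable at a time
    ([gauss_weight_char_le]). *)

(** * A spectral formula for powers of the increment length *)

Section spectral.
Context {R : realType}.
Implicit Types a b u x y : R.
Local Notation mu := (@lebesgue_measure R).

Lemma abs_sin_le x : `|sin x| <= `|x|.
Proof.
have H (z : R) : 0 <= z -> `|sin z| <= z.
  move=> z0; have [c _] := @MVT_segment R sin cos 0 z z0
    (fun x _ => is_derive_sin x) (continuous_subspaceT (@continuous_sin R)).
  rewrite sin0 !subr0 => ->; rewrite normrM (ger0_norm z0).
  by rewrite ler_piMl// cos_max.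
have [x0|/ltW x0] := leP 0 x; first by rewrite (ger0_norm x0) H.
by rewrite (ler0_norm x0) -normrN -sinN H// oppr_ge0.
Qed.

Lemma onem_cos_le x : 1 - cos x <= x ^+ 2.
Proof.
have -> : cos x = cos ((x / 2) *+ 2) by rewrite -mulr_natr divfK.
rewrite cos_mulr2n cos2sin2.
have : `|sin (x / 2)| ^+ 2 <= `|x / 2| ^+ 2 by rewrite lerXn2r ?nnegrE ?abs_sin_le.
rewrite !real_normK ?num_real// exprMn => h.
have := sqr_ge0 x; lra.
Qed.

Lemma integrable_expR_abs a : 0 < a ->
  mu.-integrable setT (fun x => (expR (- (a * `|x|)))%:E).
Proof.
move=> a0.
have cf : continuous (fun x => expR (- (a * `|x|))).
  move=> x; apply: continuous_comp; last exact: continuous_expR.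
  apply: continuousN; apply: continuousM; first exact: cst_continuous.
  exact: norm_continuous.
apply/integrableP; split.
  by apply/measurable_EFinP; exact: continuous_measurable_fun.
under eq_integral do rewrite /= ger0_norm ?expR_ge0//.
have e0 x : 0 <= expR (- (a * `|x|)) by exact: expR_ge0.
rewrite (ge0_symfun_integralT e0 cf); last by move=> x /=; rewrite normrN.
have -> : [set x | 0 <= x] = `[0, +oo[%classic :> set R.
  by apply/seteqP; split=> x /=; rewrite in_itv/= andbT.
have h : (\int[mu]_(x in `[0%R, +oo[) (expR (- (a * `|x|)))%:E <= (a^-1)%:E)%E.
  rewrite (@le_trans _ _ (\int[mu]_(x in `[0%R, +oo[) ((a^-1)%:E * (exponential_pdf a x)%:E))%E)//.
    apply: ge0_le_integral => //=.
    - apply/measurable_EFinP; apply: measurable_funTS; exact: continuous_measurable_fun.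
    - apply/measurable_EFinP/measurable_funTS/measurable_funM => //.
      exact: measurable_exponential_pdf.
    - move=> x; rewrite /= in_itv/= andbT => x0; rewrite exponential_pdfE//.
      by rewrite -EFinM lee_fin mulrA mulVf ?gt_eqF// mul1r mulNr ger0_norm.
  rewrite ge0_integralZl//.
  - rewrite -[leRHS]mule1 lee_wpmul2l// ?lee_fin ?invr_ge0 ?(ltW a0)//.
    rewrite -(integral_exponential_pdf a0) ge0_subset_integral//=.
      by apply/measurable_EFinP; exact: measurable_exponential_pdf.
    by move=> x _; rewrite lee_fin exponential_pdf_ge0 // ltW.
  - by apply/measurable_EFinP/measurable_funTS; exact: measurable_exponential_pdf.
  - by move=> x _; rewrite lee_fin exponential_pdf_ge0 // ltW.
  - by rewrite lee_fin invr_ge0 ltW.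
by rewrite (le_lt_trans (lee_wpmul2l _ h))// -EFinM ltry.
Qed.

(** The Levy-Khintchine kernel of [|u| ^ (2 b)], in the variable [y = ln x]. *)
Definition osc b u y : R := (1 - cos (u * expR y)) * expR (- (2 * b * y)).

Lemma osc_ge0 b u y : 0 <= osc b u y.
Proof. by rewrite mulr_ge0 ?expR_ge0// subr_ge0 cos_le1. Qed.

Lemma continuous_osc b u : continuous (osc b u).
Proof.
rewrite /osc => y; apply: (@continuousM _ _ (fun y => 1 - cos (u * expR y))
  (fun y => expR (- (2 * b * y)))).
  apply: continuousB; first exact: cst_continuous.
  apply: continuous_comp; last exact: continuous_cos.
  by apply: continuousM; [exact: cst_continuous|exact: continuous_expR].
apply: continuous_comp; last exact: continuous_expR.
apply: continuousN; apply: continuousM; [exact: cst_continuous|exact: cvg_id].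
Qed.

Lemma measurable_osc b u : measurable_fun setT (fun y => (osc b u y)%:E).
Proof.
apply/measurable_EFinP; apply: continuous_measurable_fun.
exact: continuous_osc.
Qed.

Lemma osc_le b u y : 0 < b < 1 ->
  osc b u y <= 2 * expR (- (2 * b * `|y|)) + u ^+ 2 * expR (- ((2 - 2 * b) * `|y|)).
Proof.
move=> /andP[b0 b1]; rewrite /osc.
have [y0|y0] := leP 0 y.
  rewrite (ger0_norm y0) -[leLHS]addr0 lerD// ?(mulr_ge0 (sqr_ge0 _)) ?expR_ge0//.
  rewrite ler_wpM2r ?expR_ge0//; have := cos_geN1 (u * expR y); lra.
rewrite (ltr0_norm y0) -[leLHS]add0r lerD ?mulr_ge0 ?expR_ge0//.
apply: (@le_trans _ _ ((u * expR y) ^+ 2 * expR (- (2 * b * y)))).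
  by rewrite ler_wpM2r ?expR_ge0// onem_cos_le.
rewrite exprMn -[leLHS]mulrA ler_wpM2l ?sqr_ge0// -expRM_natl -expRD ler_expR; lra.
Qed.

Lemma integrable_osc b u : 0 < b < 1 ->
  mu.-integrable setT (fun y => (osc b u y)%:E).
Proof.
move=> b01; have /andP[b0 b1] := b01.
apply: (@le_integrable _ _ _ mu setT measurableT _ (fun y =>
  (2 * expR (- (2 * b * `|y|)))%:E + (u ^+ 2 * expR (- ((2 - 2 * b) * `|y|)))%:E)%E).
- exact: measurable_osc.
- move=> y _; rewrite -EFinD !abse_EFin lee_fin ger0_norm ?osc_ge0//.
  by rewrite ger0_norm ?osc_le// addr_ge0// mulr_ge0 ?sqr_ge0 ?expR_ge0.
- have hz k a : 0 < a -> mu.-integrable setT (fun x => (k * expR (- (a * `|x|)))%:E).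
    move=> a0; have := integrableZl measurableT k (integrable_expR_abs a0).
    by apply: eq_integrable => // x _; rewrite EFinM.
  by apply: (integrableD measurableT (hz _ _ _) (hz _ _ _)); lra.
Qed.

Definition osc_const b := (\int[mu]_y osc b 1 y)%R.

Lemma integral_translate (f : R -> R) a : continuous f -> (forall x, 0 <= f x) ->
  (\int[mu]_x (f (x + a))%:E = \int[mu]_x (f x)%:E)%E.
Proof.
move=> cf f0.
have dF x : is_derive x 1 (fun x => x + a) 1.
  by apply: is_derive_eq; rewrite addr0.
have F' : (fun x => x + a)^`()%classic = cst 1.
  by apply/funext => x; rewrite derive1E; apply: derive_val.
rewrite [RHS](@increasing_ge0_integration_by_substitutionT R (fun x => x + a))//.
- by apply: eq_integral => x _; rewrite F' /= fctE mulr1.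
- by move=> x y xy; rewrite ltrD2r.
- by rewrite F'; exact: cst_continuous.
- by rewrite F'; exact: is_cvg_cst.
- by rewrite F'; exact: is_cvg_cst.
- exact: cvg_addrr_Ny.
- exact: cvg_addrr.
Qed.

(** In the variable [y = ln x] the scaling [x -> |u| x] is a translation, and
    the translation invariance of the Lebesgue measure gives the power of [|u|]. *)
Lemma integral_osc b u : 0 < b < 1 ->
  \int[mu]_y osc b u y = `|u| `^ (2 * b) * osc_const b.
Proof.
move=> /andP[b0 b1].
wlog u0 : u / 0 < u => [H|].
  have [/H//|u0|<-] := ltgtP 0 u.
    rewrite -(normrN u) -H ?oppr_gt0//; apply: eq_Rintegral => y _.
    by rewrite /osc mulNr cosN.
  rewrite normr0 powR0 ?mul0r ?gt_eqF ?mulr_gt0//.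
  rewrite (@eq_Rintegral _ _ _ _ _ (cst 0)) ?Rintegral_cst ?mul0r// => y _.
  by rewrite /osc mul0r cos0 subrr mul0r.
rewrite gtr0_norm // /osc_const /Rintegral.
have -> : (\int[mu]_x (osc b u x)%:E =
           \int[mu]_x ((u `^ (2 * b))%:E * (osc b 1 (x + ln u))%:E))%E.
  apply: eq_integral => x _; rewrite -EFinM; congr EFin.
  rewrite /osc mul1r expRD lnK ?posrE// (mulrC u) mulrCA; congr (_ * _).
  rewrite /powR gt_eqF// -expRD; congr expR; ring.
rewrite ge0_integralZl//.
- rewrite (integral_translate (ln u) (@continuous_osc b 1)); last exact: osc_ge0.
  rewrite fineM//; apply: integrable_fin_num => //.
  by apply: integrable_osc; rewrite b0.
- apply/measurable_EFinP; apply: continuous_measurable_fun => x.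
  apply: (@continuous_comp _ _ _ (fun x => x + ln u)); last exact: continuous_osc.
  by apply: continuousD; [exact: cvg_id|exact: cst_continuous].
- by move=> x _; rewrite lee_fin osc_ge0.
- by rewrite lee_fin powR_ge0.
Qed.

Lemma osc_const_gt0 b : 0 < b < 1 -> 0 < osc_const b.
Proof.
move=> b01; have /andP[b0 b1] := b01.
pose k : R := 1 - cos (expR (-1)).
have k0 : 0 < k.
  rewrite subr_gt0 -[ltRHS]cos0 ltr_cos ?expR_gt0// in_itv/=.
    by rewrite lexx pi_ge0.
  by rewrite expR_ge0 (@le_trans _ _ 1)// ?expR_le1 ?oppr_le0// (le_trans _ (pi_ge2 R))// ler1n.
have fin : (\int[mu]_y (osc b 1 y)%:E)%E \is a fin_num.
  by apply: integrable_fin_num => //; exact: integrable_osc.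
rewrite /osc_const /Rintegral fine_gt0//.
have -> : (\int[mu]_y (osc b 1 y)%:E < +oo)%E by rewrite ltey_eq fin.
rewrite andbT (@lt_le_trans _ _ (\int[mu]_(y in `[(-1)%R, 0%R]) k%:E)%E)//.
  by rewrite integral_cst//= lebesgue_measure_itv/= lte_fin ltrN10 -EFinB -EFinM lte_fin mulr_gt0// opprK add0r.
apply: (@le_trans _ _ (\int[mu]_(y in `[(-1)%R, 0%R]) (osc b 1 y)%:E)%E).
  apply: ge0_le_integral => //=.
  - by move=> y _; rewrite lee_fin ltW.
  - by apply: measurable_funTS; exact: measurable_osc.
  - move=> y; rewrite /= in_itv/= => /andP[y1 y0]; rewrite lee_fin /osc mul1r.
    have e1 : 1 <= expR (- (2 * b * y)).
      by rewrite -expR0 ler_expR oppr_ge0 mulr_ge0_le0// mulr_ge0// ltW.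
    have e2 : expR y <= 1 by rewrite expR_le1.
    have pi1 : (1 : R) <= pi by apply: le_trans (pi_ge2 R); rewrite ler1n.
    rewrite -[leLHS]mulr1 ler_pM//; first exact: ltW.
    rewrite lerB// leNgt ltr_cos ?in_itv/= ?expR_ge0/=.
    + by rewrite ltr_expR -leNgt.
    + by rewrite (le_trans e2).
    + by rewrite (le_trans _ pi1)// expR_le1.
apply: ge0_subset_integral => //=.
- exact: measurable_osc.
- by move=> y _; rewrite lee_fin osc_ge0.
Qed.

End spectral.

(** * Local nondeterminism *)

Section lin_comb_integral.
Context d (T : measurableType d) (R : realType) (mu : {measure set T -> \bar R}).

Lemma integrable_lin_comb (I : finType) (c : I -> R) (f : I -> T -> R) :
  (forall i, mu.-integrable setT (EFin \o f i)) ->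
  mu.-integrable setT (EFin \o (fun x => \sum_i c i * f i x)%R).
Proof.
move=> intf.
have : mu.-integrable setT (fun x => \sum_i (c i)%:E * (f i x)%:E)%E.
  by apply: integrable_sum => // i _; exact: (integrableZl measurableT _ (intf i)).
by apply: eq_integrable => // x _ /=; rewrite -sumEFin.
Qed.

Lemma Rintegral_lin_comb (I : finType) (c : I -> R) (f : I -> T -> R) :
  (forall i, mu.-integrable setT (EFin \o f i)) ->
  \int[mu]_x (\sum_i c i * f i x) = \sum_i c i * \int[mu]_x f i x.
Proof.
move=> intf; rewrite /Rintegral.
under eq_integral do rewrite -sumEFin.
rewrite integral_sum//; last first.
  by move=> i; exact: (integrableZl measurableT _ (intf i)).
under eq_bigr => i _ do rewrite (integralZl measurableT (intf i)).
have H (i : I) : (\int[mu]_x (f i x)%:E)%E = (fine (\int[mu]_x (f i x)%:E))%:E.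
  by rewrite fineK//; exact: (integrable_fin_num _ (intf i)).
under eq_bigr => i _ do rewrite H -EFinM.
by rewrite sumEFin.
Qed.

End lin_comb_integral.

Section local_nondeterminism.
Context {R : realType}.
Local Notation mu := (@lebesgue_measure R).

(** For weights with zero sum, the covariance of [\sum_i a_i B (t_i)] and
    [\sum_i b_i B (t_i)]: only the terms [|t - s| ^ (2 alpha)] of the covariance
    of fractional Brownian motion survive. *)
Definition fbm_form (alpha : R) n (t a b : 'I_n -> R) : R :=
  - 2^-1 * \sum_i \sum_j a i * b j * `|t i - t j| `^ (2 * alpha).

(** For weights with zero sum, the variance is an integral of squared moduli
    [|\sum_i a_i exp (i t_i x)|^2]; this is the integrand. *)
Lemma osc_form n (t a : 'I_n -> R) (s x : R) : \sum_i a i = 0 ->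
  - (\sum_i \sum_j a i * a j * (1 - cos ((t i - t j) * x))) =
  (\sum_i a i * cos ((t i - s) * x)) ^+ 2 +
  (\sum_i a i * sin ((t i - s) * x)) ^+ 2.
Proof.
move=> a0.
rewrite !expr2 !big_distrlr/= -big_split/=.
transitivity (- (\sum_i \sum_j a i * a j) +
  \sum_i \sum_j a i * a j * cos ((t i - t j) * x)).
  rewrite -!sumrN -big_split/=; apply: eq_bigr => i _.
  rewrite -!sumrN -big_split/=; apply: eq_bigr => j _; ring.
rewrite -big_distrlr/= a0 mul0r oppr0 add0r.
apply: eq_bigr => i _; rewrite -big_split/=; apply: eq_bigr => j _.
have -> : (t i - t j) * x = (t i - s) * x - (t j - s) * x by ring.
rewrite cosB; ring.
Qed.

(** The second difference of [|u|] is a triangle, and [2 (1 - cos (e x))] is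
    its multiplier on the Fourier side. *)
Lemma osc_hat n (u a : 'I_n -> R) (e x : R) :
  \sum_i a i * (1 - cos ((u i + e) * x) + (1 - cos ((u i - e) * x)) -
    2 * (1 - cos (u i * x))) =
  2 * (\sum_i a i * cos (u i * x)) * (1 - cos (e * x)).
Proof.
rewrite -mulrA [X in _ = 2 * X]mulr_suml mulr_sumr; apply: eq_bigr => i _.
rewrite mulrDl mulrBl cosD cosB; ring.
Qed.

Lemma young_le (lam p q c k : R) : 0 < lam ->
  2 * c * k * (p * q) <= lam * (c ^+ 2 * p ^+ 2) + lam^-1 * (k ^+ 2 * q ^+ 2).
Proof.
move=> l0; rewrite -subr_ge0.
have -> : lam * (c ^+ 2 * p ^+ 2) + lam^-1 * (k ^+ 2 * q ^+ 2) - 2 * c * k * (p * q)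
  = lam^-1 * (lam * (c * p) - k * q) ^+ 2 by field; rewrite gt_eqF.
by rewrite mulr_ge0 ?sqr_ge0// invr_ge0 ltW.
Qed.

(** The pairing of the weights with a triangle, compared pointwise in frequency
    with the variance and with the energy of the triangle. *)
Lemma osc_young n (t a : 'I_n -> R) (s e lam alpha y : R) : \sum_i a i = 0 -> 0 < lam ->
  \sum_i a i * (osc 2^-1 (t i - s + e) y + osc 2^-1 (t i - s - e) y
     - 2 * osc 2^-1 (t i - s) y) <=
  lam * (- \sum_i \sum_j a i * a j * osc alpha (t i - t j) y)
  + (2 / lam) * osc (1 - alpha) e y.
Proof.
move=> a0 l0; set x := expR y.
set p := expR (- (alpha * y)); set q := expR (- ((1 - alpha) * y)).
(* The spectral weight of [|u|] is the geometric mean of the spectral weights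
   of [|u| ^ (2 alpha)] and [|u| ^ (2 (1 - alpha))]. *)
have E1 : expR (- (2 * 2^-1 * y)) = p * q.
  by rewrite -expRD; congr expR; field.
have E2 : expR (- (2 * alpha * y)) = p ^+ 2.
  by rewrite -expRM_natl; congr expR; ring.
have E3 : expR (- (2 * (1 - alpha) * y)) = q ^+ 2.
  by rewrite -expRM_natl; congr expR; ring.
rewrite /osc E1 E2 E3 -/x.
have -> : \sum_i a i * ((1 - cos ((t i - s + e) * x)) * (p * q) +
   (1 - cos ((t i - s - e) * x)) * (p * q) -
   2 * ((1 - cos ((t i - s) * x)) * (p * q))) =
   2 * (\sum_i a i * cos ((t i - s) * x)) * (1 - cos (e * x)) * (p * q).
  by rewrite -osc_hat mulr_suml; apply: eq_bigr => i _; ring.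
have -> : - (\sum_i \sum_j a i * a j * ((1 - cos ((t i - t j) * x)) * p ^+ 2)) =
   - (\sum_i \sum_j a i * a j * (1 - cos ((t i - t j) * x))) * p ^+ 2.
  rewrite mulNr mulr_suml; congr (- _); apply: eq_bigr => i _.
  by rewrite mulr_suml; apply: eq_bigr => j _; rewrite mulrA.
rewrite (osc_form _ s)//.
set C := \sum_i a i * cos _; set S := \sum_i a i * sin _; set k := 1 - _.
apply: (le_trans (young_le _ _ _ _ l0)); apply: lerD.
  rewrite ler_wpM2l ?(ltW l0)// ler_wpM2r ?sqr_ge0// lerDl sqr_ge0.
  by [].
rewrite (mulrC 2) -[leRHS]mulrA ler_wpM2l ?invr_ge0 ?(ltW l0)// [leRHS]mulrA.
rewrite ler_wpM2r ?sqr_ge0// expr2 ler_wpM2r// /k.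
  by rewrite subr_ge0 cos_le1.
by have := cos_geN1 (e * x); lra.
Qed.

Lemma hat_integral (u e : R) : 0 < e ->
  \int[mu]_y (osc 2^-1 (u + e) y + osc 2^-1 (u - e) y - 2 * osc 2^-1 u y) =
  osc_const 2^-1 * (`|u + e| + `|u - e| - 2 * `|u|).
Proof.
move=> e0.
have h : 0 < (2^-1 : R) < 1 by rewrite invr_gt0 ltr0n/= invf_lt1// ltr1n.
pose c (i : 'I_3) : R := tnth [tuple 1; 1; -2] i.
pose v (i : 'I_3) : R := tnth [tuple u + e; u - e; u] i.
transitivity (\int[mu]_y (\sum_i c i * osc 2^-1 (v i) y)).
  apply: eq_Rintegral => y _; rewrite !big_ord_recl big_ord0/= /c /v !(tnth_nth 0)/=; ring.
rewrite Rintegral_lin_comb; last by move=> i; exact: integrable_osc.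
under eq_bigr => i _ do rewrite integral_osc// mulfV ?pnatr_eq0// powRr1//.
rewrite !big_ord_recl big_ord0/= /c /v !(tnth_nth 0)/=; ring.
Qed.

(** Local nondeterminism of fractional Brownian motion (Pitt). The triangle of
    half-width [delta] around [t i0] vanishes at the other times, so that
    pairing it with the weights gives its height [2 delta]; in frequency, this
    is bounded by the variance and by the energy of the triangle, which is finite
    and of order [delta ^ (2 - 2 alpha)]. *)
Lemma fbm_form_ge alpha : 0 < alpha < 1 ->
  {c : R | 0 < c & forall n (t a : 'I_n -> R) (i0 : 'I_n) (delta : R),
    0 < delta -> \sum_i a i = 0 -> a i0 = 1 ->
    (forall j, j != i0 -> a j != 0 -> delta <= `|t j - t i0|) ->
    c * delta `^ (2 * alpha) <= fbm_form alpha t a a}.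
Proof.
move=> al01; have /andP[al0 al1] := al01.
have al01' : 0 < 1 - alpha < 1 by lra.
have h01 : 0 < (2^-1 : R) < 1 by lra.
set c1 := @osc_const R 2^-1; set ca := @osc_const R alpha.
set cb := @osc_const R (1 - alpha).
have c10 : 0 < c1 by exact: osc_const_gt0.
have ca0 : 0 < ca by exact: osc_const_gt0.
have cb0 : 0 < cb by exact: osc_const_gt0.
exists (c1 ^+ 2 / (4 * ca * cb)); first by rewrite divr_gt0 ?exprn_gt0// !mulr_gt0.
move=> n t a i0 delta d0 sa ai0 sep.
(* The value of [lam] that makes the energy of the triangle equal to half of
   the pairing. *)
pose lam := 2 * cb / c1 * delta `^ (1 - 2 * alpha).
have dp0 : 0 < delta `^ (1 - 2 * alpha) by rewrite powR_gt0.
have lam0 : 0 < lam by rewrite !mulr_gt0// ?invr_gt0.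
have intg (i : 'I_n) : mu.-integrable setT (EFin \o (fun y =>
    osc 2^-1 (t i - t i0 + delta) y + osc 2^-1 (t i - t i0 - delta) y
     - 2 * osc 2^-1 (t i - t i0) y)).
  have i1 := integrableD measurableT
    (integrable_osc (t i - t i0 + delta) h01) (integrable_osc (t i - t i0 - delta) h01).
  have i2 := integrableZl measurableT 2 (integrable_osc (t i - t i0) h01).
  have := integrableB measurableT i1 i2.
  by apply: eq_integrable => // y _ /=; rewrite -EFinM -EFinD -EFinB.
have inta (i : 'I_n) : mu.-integrable setT
    (EFin \o (fun y => \sum_j a i * a j * osc alpha (t i - t j) y)).
  by apply: integrable_lin_comb => j; exact: integrable_osc.
have intb : mu.-integrable setT
    (EFin \o (fun y => \sum_i (-1) * \sum_j a i * a j * osc alpha (t i - t j) y)).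
  by apply: integrable_lin_comb.
have intL : mu.-integrable setT
    (EFin \o (fun y => lam * (\sum_i (-1) * \sum_j a i * a j * osc alpha (t i - t j) y))).
  have := integrableZl measurableT lam intb.
  by apply: eq_integrable => // y _ /=; rewrite EFinM.
have intR : mu.-integrable setT (EFin \o (fun y => (2 / lam) * osc (1 - alpha) delta y)).
  have := integrableZl measurableT (2 / lam) (integrable_osc delta al01').
  by apply: eq_integrable => // y _ /=; rewrite EFinM.
have intT : mu.-integrable setT (EFin \o (fun y =>
    lam * (\sum_i (-1) * \sum_j a i * a j * osc alpha (t i - t j) y) +
    (2 / lam) * osc (1 - alpha) delta y)).
  by have := integrableD measurableT intL intR; apply: eq_integrable.
have : \int[mu]_y (\sum_i a i * (osc 2^-1 (t i - t i0 + delta) y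
      + osc 2^-1 (t i - t i0 - delta) y - 2 * osc 2^-1 (t i - t i0) y)) <=
    \int[mu]_y (lam * (\sum_i (-1) * \sum_j a i * a j * osc alpha (t i - t j) y) +
    (2 / lam) * osc (1 - alpha) delta y).
  apply: le_Rintegral => //; first exact: integrable_lin_comb.
  move=> y _; rewrite -mulr_sumr mulN1r; exact: osc_young.
rewrite RintegralD// RintegralZl// RintegralZl//; last exact: integrable_osc.
rewrite Rintegral_lin_comb// Rintegral_lin_comb//.
under [X in X <= _ -> _]eq_bigr => i _ do rewrite hat_integral//.
rewrite (bigD1 i0)//= big1 ?addr0; last first.
  move=> i ii0; have [->|ai] := eqVneq (a i) 0; first by rewrite mul0r.
  have := sep _ ii0 ai; set u := t i - t i0 => du.
  have -> : `|u + delta| + `|u - delta| - 2 * `|u| = 0; last by rewrite !mulr0.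
  have [u0|u0] := leP 0 u.
    move: du; rewrite (ger0_norm u0) => du; rewrite !ger0_norm; lra.
  move: du; rewrite (ltr0_norm u0) => du; rewrite !ler0_norm; lra.
rewrite ai0 mul1r subrr add0r sub0r normrN normr0 mulr0 subr0 gtr0_norm//.
under eq_bigr => i _.
  rewrite Rintegral_lin_comb; last by move=> j; exact: integrable_osc.
  under eq_bigr => j _ do rewrite integral_osc// -/ca mulrA.
  rewrite -mulr_suml; over.
rewrite /= -mulr_sumr -mulr_suml integral_osc// -/cb -/c1 (gtr0_norm d0).
set Q := \sum_i \sum_j _.
have -> : fbm_form alpha t a a = - 2^-1 * Q by [].
have -> : delta `^ (2 * (1 - alpha)) = delta * delta `^ (1 - 2 * alpha).
  rewrite -{2}(powRr1 (ltW d0)) -powRD; last by rewrite (gt_eqF d0) implybT.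
  by congr (_ `^ _); ring.
have -> : delta `^ (2 * alpha) = delta / delta `^ (1 - 2 * alpha).
  rewrite -{2}(powRr1 (ltW d0)) -powRB; last by rewrite (gt_eqF d0) implybT.
  by congr (_ `^ _); ring.
rewrite /lam; move: (delta `^ _) dp0 => r r0 H.
have : c1 * delta <= 2 * cb / c1 * r * (-1 * (Q * ca)).
  apply: le_trans (_ : c1 * (delta + delta) - c1 * delta <= _); first by rewrite mulrDr addrK.
  rewrite lerBlDr; apply: le_trans H _; rewrite lerD2l le_eqVlt; apply/orP; left; apply/eqP.
  by field; rewrite !gt_eqF.
rewrite -(ler_pM2l (_ : 0 < c1 / (4 * ca * cb * r))); last first.
  by rewrite divr_gt0// !mulr_gt0.
congr (_ <= _); field; rewrite ?gt_eqF//.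
Qed.

End local_nondeterminism.

(** * Moments and Fourier transforms of normal densities *)

Section gaussian_integrals.
Context {R : realType}.
Implicit Types m s u x : R.
Local Notation mu := (@lebesgue_measure R).

(** The boundary terms at [m - n] and [m + n] are at most [K / n]. *)
Lemma Rintegral_derive_eq0 (F f : R -> R) (m K : R) :
  (forall x, is_derive x 1 F (f x)) -> continuous f ->
  mu.-integrable setT (EFin \o f) ->
  (forall x, `|F x| * `|x - m| <= K) -> \int[mu]_x f x = 0.
Proof.
move=> dF cf intf FK.
pose A (n : nat) : set R := `[(m - n.+1%:R)%R, (m + n.+1%:R)%R]%classic.
have mA n : measurable (A n) by exact: measurable_itv.
have mf : measurable_fun setT f by exact: continuous_measurable_fun.
have mfn n : measurable_fun setT ((EFin \o f) \_ (A n)).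
  apply/(measurable_restrictT _ _).1 => //.
  by apply: measurable_funTS; apply/measurable_EFinP.
have mf' : measurable_fun setT (EFin \o f) by apply/measurable_EFinP.
have cv x : setT x -> (fun n => ((EFin \o f) \_ (A n)) x) @ \oo --> (EFin \o f) x.
  move=> _; apply: cvg_near_cst; near=> n.
  rewrite patchE mem_set//.
  have : `|x - m| <= n.+1%:R.
    rewrite (@le_trans _ _ n%:R) ?ler_nat//; near: n; exact: nbhs_infty_ger.
  by rewrite /A /= in_itv/= ler_distl.
have dom x n : setT x -> (`|((EFin \o f) \_ (A n)) x| <= (abse \o (EFin \o f)) x)%E.
  move=> _; rewrite patchE; case: ifP => //= _.
  by rewrite normr0 lee_fin.
have [|||_ _] := @dominated_convergence _ _ R mu setT measurableT
  (fun n => (EFin \o f) \_ (A n)) (EFin \o f) (abse \o (EFin \o f)) mfn mf'.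
- exact: aeW.
- exact: integrable_abse.
- exact: aeW.
have FA n : (\int[mu]_x ((EFin \o f) \_ (A n)) x)%E
    = (F (m + n.+1%:R) - F (m - n.+1%:R))%:E.
  rewrite -integral_mkcond EFinB.
  have cF : continuous F.
    by move=> x; apply: differentiable_continuous; apply/derivable1_diffP.
  apply: continuous_FTC2.
  - by rewrite ltrD2l gtrN.
  - exact: continuous_subspaceT.
  - split=> [x _//||]; [apply: cvg_at_right_filter|apply: cvg_at_left_filter]; exact: cF.
  - by move=> x _; rewrite derive1E; apply: derive_val.
under eq_fun do rewrite FA.
move=> lim1.
have lim2 : (fun n : nat => F (m + n.+1%:R) - F (m - n.+1%:R)) @ \oo --> (0 : R).
  apply: norm_cvg0.
  apply: (@squeeze_cvgr _ _ _ _ (cst 0) (fun n => 2 * K * harmonic n)).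
  - near=> n; rewrite normr_ge0/=.
    have n0 : (0 : R) < n.+1%:R by [].
    rewrite /harmonic/= ler_pdivlMr// (le_trans (ler_wpM2r (ltW n0) (ler_normB _ _)))//.
    rewrite mulrDl (_ : 2 * K = K + K) ?lerD//; last by ring.
      by have := FK (m + n.+1%:R); rewrite (addrAC m) subrr add0r (gtr0_norm n0).
    by have := FK (m - n.+1%:R); rewrite (addrAC m) subrr add0r normrN (gtr0_norm n0).
  - exact: cvg_cst.
  - rewrite -[X in _ --> X](mulr0 (2 * K)); apply: cvgMr; exact: cvg_harmonic.
have fin := integrable_fin_num measurableT intf.
move: lim1; rewrite -(fineK fin) => /fine_cvg lim1.
by rewrite /Rintegral -(cvg_lim _ lim1)// -[RHS](cvg_lim _ lim2).
Unshelve. all: end_near.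
Qed.

Lemma is_derive_normal_pdf m s x : 0 < s ->
  is_derive x 1 (normal_pdf m s) (- ((x - m) / s ^+ 2) * normal_pdf m s x).
Proof.
move=> s0; rewrite normal_pdfE ?gt_eqF//.
have dg : is_derive x 1 (fun x => - (x - m) ^+ 2 / (s ^+ 2 *+ 2)) (- ((x - m) / s ^+ 2)).
  apply: is_derive_eq; rewrite /GRing.scale/=; field; rewrite gt_eqF//.
have df := is_derive1_comp (is_derive_expR _) dg.
apply: is_derive_eq; rewrite /GRing.scale/= /normal_fun; ring.
Qed.

(** Moments up to order two are absorbed by a doubling of the standard
    deviation. *)
Lemma normal_pdf_decay m s : 0 < s -> exists2 K, 0 < K & forall x,
  (1 + `|x - m| + (x - m) ^+ 2) * normal_pdf m s x <= K * normal_pdf m (2 * s) x.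
Proof.
move=> s0; have s20 : 0 < 2 * s by rewrite mulr_gt0.
have p0 := normal_peak_gt0 (lt0r_neq0 s0).
have p20 := normal_peak_gt0 (lt0r_neq0 s20).
exists (2 * (1 + 8 * s ^+ 2 / 3) * normal_peak s / normal_peak (2 * s)).
  rewrite divr_gt0// !mulr_gt0// addr_gt0// divr_gt0// mulr_gt0// exprn_gt0//.
move=> x; rewrite !normal_pdfE ?gt_eqF// /normal_fun.
set y := x - m; set a := 8 * s ^+ 2 / 3.
have a0 : 0 <= a by rewrite divr_ge0 // mulr_ge0// sqr_ge0.
set z := y ^+ 2 * 3 / (8 * s ^+ 2).
have z0 : 0 <= z by rewrite divr_ge0// mulr_ge0// sqr_ge0.
have -> : - y ^+ 2 / (s ^+ 2 *+ 2) = - z + - y ^+ 2 / ((2 * s) ^+ 2 *+ 2).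
  by rewrite /z; field; rewrite gt_eqF.
rewrite expRD [leRHS]mulrA divfK ?gt_eqF//.
rewrite [leLHS]mulrCA -[leRHS]mulrA [leRHS]mulrCA ler_wpM2l ?(ltW p0)//.
rewrite mulrA ler_wpM2r ?expR_ge0// expRN ler_pdivrMr ?expR_gt0//.
have h1 : 1 + z <= expR z by exact: expR_ge1Dx.
have ya : y ^+ 2 = a * z by rewrite /a /z; field; rewrite gt_eqF.
apply: (@le_trans _ _ (2 * (1 + y ^+ 2))).
  have : `|y| ^+ 2 = y ^+ 2 by rewrite real_normK ?num_real.
  have := sqr_ge0 (`|y| - 2^-1); nra.
rewrite ya; nra.
Qed.

Lemma integrable_normal_moment m s (f : R -> R) (k : R) : 0 < s ->
  measurable_fun setT f ->
  (forall x, `|f x| <= k * (1 + `|x - m| + (x - m) ^+ 2)) ->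
  mu.-integrable setT (EFin \o (fun x => f x * normal_pdf m s x)).
Proof.
move=> s0 mf fk; have [K K0 HK] := normal_pdf_decay m s0.
have k0 : 0 <= k.
  have := fk m; rewrite subrr normr0 expr0n/= !addr0 mulr1; apply: le_trans.
  exact: normr_ge0.
have := integrableZl measurableT (k * K) (integrable_normal_pdf m (2 * s)).
apply: le_integrable => //.
  apply/measurable_EFinP; apply: measurable_funM => //.
  exact: measurable_normal_pdf.
move=> x _ /=; rewrite lee_fin !normrM (ger0_norm (normal_pdf_ge0 _ _ _)).
rewrite (ger0_norm (normal_pdf_ge0 _ _ _)) (ger0_norm k0) (gtr0_norm K0).
apply: (le_trans (ler_wpM2r (normal_pdf_ge0 _ _ _) (fk x))).
by rewrite -!mulrA ler_wpM2l.
Qed.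

Lemma normal_pdf_vanish m s (F : R -> R) (k : R) : 0 < s ->
  (forall x, `|F x| * `|x - m| <= k * (1 + `|x - m| + (x - m) ^+ 2) * normal_pdf m s x) ->
  exists K, forall x, `|F x| * `|x - m| <= K.
Proof.
move=> s0 HF; have [K K0 HK] := normal_pdf_decay m s0.
exists (`|k| * K * normal_peak (2 * s)) => x.
apply: (le_trans (HF x)); apply: (@le_trans _ _
  (`|k| * ((1 + `|x - m| + (x - m) ^+ 2) * normal_pdf m s x))).
  rewrite mulrA ler_wpM2r ?normal_pdf_ge0// ler_wpM2r ?ler_norm//.
  by rewrite !addr_ge0 ?sqr_ge0.
rewrite -mulrA ler_wpM2l// (le_trans (HK x))// ler_wpM2l ?(ltW K0)//.
by apply: normal_pdf_ub; rewrite gt_eqF ?mulr_gt0.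
Qed.

Lemma Rintegral_normal_center m s : 0 < s ->
  \int[mu]_x ((x - m) * normal_pdf m s x) = 0.
Proof.
move=> s0; have cp := @continuous_normal_pdf R m s (lt0r_neq0 s0).
have cl : continuous (fun x => x - m).
  by move=> x; apply: continuousB; [exact: cvg_id|exact: cst_continuous].
have ilin : mu.-integrable setT (EFin \o (fun x => (x - m) * normal_pdf m s x)).
  apply: (@integrable_normal_moment _ _ _ 1) => //.
    exact: continuous_measurable_fun.
  by move=> x; rewrite mul1r (addrC 1) -addrA lerDl addr_ge0 ?sqr_ge0.
have [K HK] : exists K, forall x, `|normal_pdf m s x| * `|x - m| <= K.
  apply: (@normal_pdf_vanish m s _ 1) => // x.
  rewrite (ger0_norm (normal_pdf_ge0 _ _ _)) mulrC mul1r.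
  by rewrite ler_wpM2r ?normal_pdf_ge0// (addrC 1) -addrA lerDl addr_ge0 ?sqr_ge0.
have := @Rintegral_derive_eq0 (normal_pdf m s) _ m K
  (fun x => is_derive_normal_pdf m x s0) _ _ HK.
have E x : - ((x - m) / s ^+ 2) * normal_pdf m s x =
   - (s ^+ 2)^-1 * ((x - m) * normal_pdf m s x) by ring.
under [X in _ -> mu.-integrable _ (EFin \o X) -> _]eq_fun do rewrite E.
under eq_Rintegral do rewrite E.
rewrite RintegralZl// => H.
have s2 : - (s ^+ 2)^-1 != 0 by rewrite oppr_eq0 invr_eq0 expf_neq0// gt_eqF.
apply: (mulfI s2); rewrite mulr0; apply: H.
- move=> x; apply: cvgM; last exact: cp.
  by apply: cvgN; apply: cvgM; [exact: cl|exact: cvg_cst].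
- have := integrableZl measurableT (- (s ^+ 2)^-1) ilin.
  by apply: eq_integrable => // x _ /=; rewrite EFinM.
Qed.

Lemma Rintegral_normal_sqr m s : 0 < s ->
  \int[mu]_x ((x - m) ^+ 2 * normal_pdf m s x) = s ^+ 2.
Proof.
move=> s0; have cp := @continuous_normal_pdf R m s (lt0r_neq0 s0).
have cl : continuous (fun x => x - m).
  by move=> x; apply: continuousB; [exact: cvg_id|exact: cst_continuous].
have isqr : mu.-integrable setT (EFin \o (fun x => (x - m) ^+ 2 * normal_pdf m s x)).
  apply: (@integrable_normal_moment _ _ _ 1) => //.
    by apply: measurable_funX; exact: continuous_measurable_fun.
  by move=> x; rewrite mul1r normrX real_normK ?num_real// lerDr addr_ge0.
have [K HK] : exists K, forall x, `|(x - m) * normal_pdf m s x| * `|x - m| <= K.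
  apply: (@normal_pdf_vanish m s _ 1) => // x.
  rewrite normrM (ger0_norm (normal_pdf_ge0 _ _ _)) mulrAC mul1r.
  by rewrite ler_wpM2r ?normal_pdf_ge0// -expr2 real_normK ?num_real// lerDr addr_ge0.
have dF x : is_derive x 1 (fun x => (x - m) * normal_pdf m s x)
    (normal_pdf m s x - (s ^+ 2)^-1 * ((x - m) ^+ 2 * normal_pdf m s x)).
  have dp := is_derive_normal_pdf m x s0.
  apply: is_derive_eq; rewrite /GRing.scale/=; ring.
have ip : mu.-integrable setT (EFin \o normal_pdf m s) by exact: integrable_normal_pdf.
have is2 : mu.-integrable setT
    (EFin \o (fun x => (s ^+ 2)^-1 * ((x - m) ^+ 2 * normal_pdf m s x))).
  have := integrableZl measurableT (s ^+ 2)^-1 isqr.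
  by apply: eq_integrable => // x _ /=; rewrite EFinM.
have := @Rintegral_derive_eq0 _ _ m K dF _ _ HK.
rewrite RintegralB// RintegralZl// {1}/Rintegral integral_normal_pdf/= => H.
have s2 : s ^+ 2 != 0 by rewrite expf_neq0// gt_eqF.
apply: (mulfI (invr_neq0 s2)); rewrite mulVf//.
apply/esym/eqP; rewrite -subr_eq0; apply/eqP; apply: H.
- move=> x; apply: cvgB; first exact: cp.
  apply: cvgM; first exact: cvg_cst.
  apply: cvgM; last exact: cp.
  exact: (continuous_comp (cl x) (@exprn_continuous R 2 _)).
- have := integrableB measurableT ip is2.
  by apply: eq_integrable => // x _ /=; rewrite EFinB.
Qed.

Let integrable_normal_trig m s u (trig : R -> R) : 0 < s ->
  continuous trig -> (forall x, `|trig x| <= 1) ->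
  mu.-integrable setT (EFin \o (fun x => trig (u * (x - m)) * normal_pdf m s x)).
Proof.
move=> s0 ct t1; apply: (@integrable_normal_moment _ _ _ 1) => //.
  apply: continuous_measurable_fun => x; apply: continuous_comp; last exact: ct.
  by apply: cvgM; [exact: cvg_cst|apply: cvgB; [exact: cvg_id|exact: cvg_cst]].
by move=> x; rewrite mul1r (le_trans (t1 _))// -addrA lerDl addr_ge0 ?sqr_ge0.
Qed.

Let integrable_normal_trigX m s u (trig : R -> R) : 0 < s ->
  continuous trig -> (forall x, `|trig x| <= 1) ->
  mu.-integrable setT (EFin \o (fun x => ((x - m) * trig (u * (x - m))) * normal_pdf m s x)).
Proof.
move=> s0 ct t1; apply: (@integrable_normal_moment _ _ _ 1) => //.
  apply: continuous_measurable_fun => x; apply: cvgM.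
    by apply: cvgB; [exact: cvg_id|exact: cvg_cst].
  apply: continuous_comp; last exact: ct.
  by apply: cvgM; [exact: cvg_cst|apply: cvgB; [exact: cvg_id|exact: cvg_cst]].
move=> x; rewrite mul1r normrM (@le_trans _ _ `|x - m|)//.
  by rewrite ler_piMr.
by rewrite addrAC lerDr addr_ge0 ?sqr_ge0.
Qed.

(** Integration by parts: [(x - m) * normal_pdf] is [- s ^ 2] times the
    derivative of the density. *)
Lemma Rintegral_normal_sin_parts m s u : 0 < s ->
  \int[mu]_x (((x - m) * sin (u * (x - m))) * normal_pdf m s x) =
  s ^+ 2 * u * \int[mu]_x (cos (u * (x - m)) * normal_pdf m s x).
Proof.
move=> s0; have cp := @continuous_normal_pdf R m s (lt0r_neq0 s0).
have cl : continuous (fun x => x - m).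
  by move=> x; apply: cvgB; [exact: cvg_id|exact: cvg_cst].
have cul : continuous (fun x => u * (x - m)).
  by move=> x; apply: cvgM; [exact: cvg_cst|exact: cl].
have icos := integrable_normal_trig m u s0 (@continuous_cos R) (@cos_max R).
have isin := integrable_normal_trigX m u s0 (@continuous_sin R) (@sin_max R).
have iC : mu.-integrable setT
    (EFin \o (fun x => u * (cos (u * (x - m)) * normal_pdf m s x))).
  by have := integrableZl measurableT u icos; apply: eq_integrable => // x _ /=; rewrite EFinM.
have iS : mu.-integrable setT
    (EFin \o (fun x => (s ^+ 2)^-1 * (((x - m) * sin (u * (x - m))) * normal_pdf m s x))).
  have := integrableZl measurableT (s ^+ 2)^-1 isin.
  by apply: eq_integrable => // x _ /=; rewrite EFinM.
have [K HK] : exists K, forall x, `|sin (u * (x - m)) * normal_pdf m s x| * `|x - m| <= K.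
  apply: (@normal_pdf_vanish m s _ 1) => // x.
  rewrite normrM (ger0_norm (normal_pdf_ge0 _ _ _)) mulrAC ler_wpM2r ?normal_pdf_ge0//.
  rewrite (@le_trans _ _ `|x - m|)//; first by rewrite ler_piMl// sin_max.
  by rewrite mul1r addrAC lerDr addr_ge0 ?sqr_ge0.
have dF x : is_derive x 1 (fun x => sin (u * (x - m)) * normal_pdf m s x)
    (u * (cos (u * (x - m)) * normal_pdf m s x)
     - (s ^+ 2)^-1 * (((x - m) * sin (u * (x - m))) * normal_pdf m s x)).
  have dp := is_derive_normal_pdf m x s0.
  have dl : is_derive x 1 (fun x => u * (x - m)) u.
    by apply: is_derive_eq; rewrite /GRing.scale/=; ring.
  have ds := is_derive1_comp (is_derive_sin _) dl.
  apply: is_derive_eq; rewrite /GRing.scale/=; ring.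
have s2 : s ^+ 2 != 0 by rewrite expf_neq0// gt_eqF.
have := @Rintegral_derive_eq0 _ _ m K dF _ _ HK.
rewrite RintegralB// !RintegralZl// => H.
apply: (mulfI (invr_neq0 s2)); rewrite -mulrA mulKf//.
apply/esym/eqP; rewrite -subr_eq0; apply/eqP; apply: H.
- move=> x; apply: cvgB.
    apply: cvgM; first exact: cvg_cst.
    apply: cvgM; last exact: cp.
    exact: (continuous_comp (cul x) (@continuous_cos R _)).
  apply: cvgM; first exact: cvg_cst.
  apply: cvgM; last exact: cp.
  apply: cvgM; first exact: cl.
  exact: (continuous_comp (cul x) (@continuous_sin R _)).
- have := integrableB measurableT iC iS.
  by apply: eq_integrable => // x _ /=; rewrite EFinB.
Qed.

Lemma is_derive_normal_char m s u : 0 < s ->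
  is_derive u 1 (fun u => \int[mu]_x (cos (u * (x - m)) * normal_pdf m s x))
    (- (s ^+ 2 * u * \int[mu]_x (cos (u * (x - m)) * normal_pdf m s x))).
Proof.
move=> s0.
pose f u x := cos (u * (x - m)) * normal_pdf m s x.
have df (v x : R) : is_derive v 1 (f ^~ x) (- (((x - m) * sin (v * (x - m))) * normal_pdf m s x)).
  have dl : is_derive v 1 (fun v => v * (x - m)) (x - m).
    by apply: is_derive_eq; rewrite /GRing.scale/=; ring.
  have ds := is_derive1_comp (is_derive_cos _) dl.
  rewrite /f; apply: is_derive_eq; rewrite /GRing.scale/=; ring.
have d1 (v x : R) : (partial1of2 f) v x = - (((x - m) * sin (v * (x - m))) * normal_pdf m s x).
  by rewrite partial1of2E; apply: derive_val.
have iG : mu.-integrable setT (EFin \o (fun x => `|x - m| * normal_pdf m s x)).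
  apply: (@integrable_normal_moment _ _ _ 1) => //.
    by apply: measurableT_comp => //; exact: measurable_funB.
  by move=> x; rewrite normr_id mul1r addrAC lerDr addr_ge0 ?sqr_ge0.
have u1 : `]u - 1, u + 1[%classic u by rewrite /= in_itv/= ltrDl gtrBl ltr01.
have Gub (v x : R) : `]u - 1, u + 1[%classic v -> setT x ->
    `|(partial1of2 f) v x| <= `|x - m| * normal_pdf m s x.
  move=> _ _; rewrite d1 normrN normrM (ger0_norm (normal_pdf_ge0 _ _ _)).
  by rewrite ler_wpM2r ?normal_pdf_ge0// normrM ler_piMr// sin_max.
have G0 x : 0 <= `|x - m| * normal_pdf m s x by rewrite mulr_ge0// normal_pdf_ge0.
have H1 (v : R) : `]u - 1, u + 1[%classic v -> mu.-integrable setT (EFin \o f v).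
  by move=> _; apply: integrable_normal_trig => //; [exact: continuous_cos|exact: cos_max].
have H2 (v x : R) : `]u - 1, u + 1[%classic v -> setT x -> derivable (f ^~ x) v 1.
  by move=> _ _; have := df v x; case.
have der := derivable_under_integral measurableT u1 H1 H2 G0 iG Gub.
have val := differentiation_under_integral measurableT u1 H1 H2 G0 iG Gub.
apply: DeriveDef => //.
rewrite -derive1E val.
under eq_Rintegral do rewrite d1 -mulN1r.
rewrite RintegralZl//; last by apply: integrable_normal_trigX => //; [exact: continuous_sin|exact: sin_max].
by rewrite mulN1r Rintegral_normal_sin_parts.
Qed.

(** The characteristic function [f] solves [f' (u) = - s^2 u f (u)]. *)
Lemma Rintegral_normal_cos m s u : 0 < s ->
  \int[mu]_x (cos (u * (x - m)) * normal_pdf m s x) = expR (- (s ^+ 2 * u ^+ 2 / 2)).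
Proof.
move=> s0; set f := fun u => \int[mu]_x (cos (u * (x - m)) * normal_pdf m s x).
pose h := fun u => f u * expR (s ^+ 2 * u ^+ 2 / 2).
have dh (v : R) : is_derive v 1 h 0.
  have df := is_derive_normal_char m v s0; rewrite -/f in df.
  have dg : is_derive v 1 (fun u => s ^+ 2 * u ^+ 2 / 2) (s ^+ 2 * v).
    by apply: is_derive_eq; rewrite /GRing.scale/=; field.
  have de := is_derive1_comp (is_derive_expR _) dg.
  apply: is_derive_eq; rewrite /GRing.scale/= -/(f v); ring.
have := @is_derive_0_is_cst _ h u 0 dh.
rewrite /h expr0n/= mulr0 mul0r expR0 mulr1.
have -> : f 0 = 1.
  rewrite /f; under eq_Rintegral do rewrite mul0r cos0 mul1r.
  by rewrite /Rintegral integral_normal_pdf.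
move=> H; rewrite -/(f u) expRN.
have e0 := lt0r_neq0 (expR_gt0 (s ^+ 2 * u ^+ 2 / 2)).
by apply: (mulIf e0); rewrite H mulVf.
Qed.

End gaussian_integrals.

(** * Integrals of functions of a Gaussian variable *)

Section density.
Context d (T : measurableType d) (R : realType).
Variables (mu nu : {measure set T -> \bar R}) (g : T -> R).
Hypothesis mg : measurable_fun setT g.
Hypothesis g0 : forall x, 0 <= g x.
Hypothesis nuE : forall E, measurable E -> nu E = (\int[mu]_(x in E) (g x)%:E)%E.
Import HBNNSimple.
Local Open Scope ereal_scope.

Let density_indic E : measurable E ->
  \int[nu]_x (\1_E x)%:E = \int[mu]_x ((\1_E x)%:E * (g x)%:E).
Proof.
move=> mE; rewrite integral_indic// setIT nuE// integral_mkcond.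
apply: eq_integral => x _; rewrite patchE indicE.
by case: (x \in E); rewrite ?mul1e ?mul0e.
Qed.

Let density_nnsfun (f : {nnsfun T >-> R}) :
  \int[nu]_x (f x)%:E = \int[mu]_x ((f x)%:E * (g x)%:E).
Proof.
under [LHS]eq_integral do rewrite fimfunE -fsumEFin//.
rewrite [LHS]ge0_integral_fsum//; last 2 first.
  - by move=> r; exact/measurable_EFinP/measurableT_comp.
  - by move=> n x _; rewrite EFinM nnfun_muleindic_ge0.
under [RHS]eq_integral.
  move=> x xD; rewrite fimfunE -fsumEFin// muleC ge0_mule_fsumr; last first.
    by move=> r; rewrite EFinM nnfun_muleindic_ge0.
  over.
rewrite [RHS]ge0_integral_fsum//; last 2 first.
  - move=> r; apply: emeasurable_funM; first exact/measurable_EFinP.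
    by apply/measurable_EFinP; apply/measurableT_comp.
  - move=> n x _; apply: mule_ge0; first by rewrite lee_fin.
    by rewrite EFinM nnfun_muleindic_ge0.
apply: eq_fsbigr => r _.
rewrite integralZl_indic_nnsfun// density_indic//.
have [r0|r0] := leP 0%R r.
  rewrite -ge0_integralZl//.
  - by apply: eq_integral => x _; rewrite EFinM [RHS]muleCA (muleC (g x)%:E).
  - apply: emeasurable_funM; last exact/measurable_EFinP.
    by apply/measurable_EFinP; exact: measurable_indic.
  - by move=> x _; rewrite mule_ge0 ?lee_fin.
rewrite preimage_nnfun0// indic0 integral0_eq ?mule0; last by move=> x _; rewrite mul0e.
by rewrite integral0_eq// => x _; rewrite mulr0 mule0.
Qed.

Lemma ge0_integral_density (f : T -> \bar R) :
  measurable_fun setT f -> (forall x, 0 <= f x) ->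
  \int[nu]_x f x = \int[mu]_x (f x * (g x)%:E).
Proof.
move=> mf f0; pose f_ := nnsfun_approx measurableT mf.
transitivity (lim (\int[nu]_x (f_ n x)%:E @[n --> \oo])).
  rewrite -monotone_convergence//=.
  - apply: eq_integral => ? /[!inE] xD; apply/esym/cvg_lim => //=.
    exact: cvg_nnsfun_approx.
  - by move=> n; exact/measurable_EFinP/measurable_funTS.
  - by move=> n ? _; rewrite lee_fin.
  - by move=> ? _ ? ? mn; rewrite lee_fin; exact/lefP/nd_nnsfun_approx.
under eq_fun do rewrite density_nnsfun.
rewrite -monotone_convergence//=.
- apply: eq_integral => x _; apply/cvg_lim => //=.
  apply: cvgeZr; first by []. exact: cvg_nnsfun_approx.
- move=> n; apply: emeasurable_funM; last exact/measurable_EFinP.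
  exact/measurable_EFinP/measurable_funTS.
- by move=> n x _; rewrite mule_ge0 ?lee_fin.
- move=> x _ a b ab; rewrite lee_wpmul2r ?lee_fin//.
  exact/lefP/nd_nnsfun_approx.
Qed.

End density.

Section gaussian_law_integrals.
Context d (T : measurableType d) (R : realType) (P : probability T R).
Variables (X : T -> R) (m s : R).
Hypothesis mX : measurable_fun setT X.
Hypothesis lawX : forall U, measurable U -> pushforward P X U = normal_prob m s U.
Local Notation mu := (@lebesgue_measure R).

Let ge0_law (g : R -> \bar R) : measurable_fun setT g -> (forall x, (0 <= g x)%E) ->
  (\int[P]_w g (X w) = \int[mu]_x (g x * (normal_pdf m s x)%:E))%E.
Proof.
move=> mg g0.
rewrite -(@ge0_integral_density _ _ _ mu (normal_prob m s)) //; last 2 first.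
- exact: measurable_normal_pdf.
- by move=> x; exact: normal_pdf_ge0.
have mX' : measurable_fun setT (X : T -> measurableTypeR R) by exact: mX.
pose X' : {mfun T >-> measurableTypeR R} := HB.pack (X : T -> measurableTypeR R)
  (isMeasurableFun.Build _ _ _ _ _ mX').
transitivity (\int[pushforward P X']_y g y)%E.
  by rewrite ge0_integral_pushforward.
by apply: eq_measure_integral => U mU _; exact: lawX.
Qed.

Lemma integrable_law (g : R -> R) : measurable_fun setT g ->
  mu.-integrable setT (EFin \o (fun x => g x * normal_pdf m s x)) ->
  P.-integrable setT (EFin \o (g \o X)).
Proof.
move=> mg /integrableP[_ ig]; apply/integrableP; split.
  by apply/measurable_EFinP; exact: measurableT_comp.
under eq_integral do rewrite /=.
rewrite (ge0_law (g := fun x => `|g x|%:E))//; last first.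
  by apply/measurable_EFinP; exact: measurableT_comp.
under eq_integral do rewrite -EFinM -(ger0_norm (normal_pdf_ge0 m s _)) -normrM.
exact: ig.
Qed.

Lemma Rintegral_law (g : R -> R) : measurable_fun setT g ->
  mu.-integrable setT (EFin \o (fun x => g x * normal_pdf m s x)) ->
  \int[P]_w g (X w) = \int[mu]_x (g x * normal_pdf m s x).
Proof.
move=> mg ig.
have iP := integrable_law mg ig.
have mgp : measurable_fun setT (EFin \o g) by apply/measurable_EFinP.
have E (h : R -> R) : measurable_fun setT h -> (forall x, 0 <= h x) ->
    (\int[P]_w (h (X w))%:E = \int[mu]_x (h x * normal_pdf m s x)%:E)%E.
  move=> mh h0; rewrite (ge0_law (g := EFin \o h))//; last exact/measurable_EFinP.
have H : forall x : R, g x = Num.max (g x) 0 - Num.max (- g x) 0.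
  move=> x; have [gx|gx] := leP (g x) 0.
    by rewrite max_l ?oppr_ge0// sub0r opprK.
  by rewrite max_r ?oppr_le0 ?ltW// subr0.
pose gp x := Num.max (g x) 0; pose gn x := Num.max (- g x) 0.
have mgp' : measurable_fun setT gp by apply: measurable_maxr.
have mgn' : measurable_fun setT gn.
  by apply: measurable_maxr => //; exact: measurableT_comp.
have bp x : `|gp x| <= `|g x|.
  by rewrite /gp; case: (leP (g x) 0) => _; rewrite ?normr0.
have bn x : `|gn x| <= `|g x|.
  by rewrite /gn; case: (leP (- g x) 0) => _; rewrite ?normr0 ?normrN.
have ip (h : R -> R) : measurable_fun setT h -> (forall x, `|h x| <= `|g x|) ->
   mu.-integrable setT (EFin \o (fun x => h x * normal_pdf m s x)).
  move=> mh hg; apply: le_integrable ig => //.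
    apply/measurable_EFinP; apply: measurable_funM => //.
    exact: measurable_normal_pdf.
  by move=> x _; rewrite lee_fin !normrM ler_wpM2r.
have igp := ip _ mgp' bp; have ign := ip _ mgn' bn.
have -> : \int[P]_w g (X w) = \int[P]_w (gp (X w) - gn (X w)).
  by apply: eq_Rintegral => w _; exact: H.
rewrite RintegralB//; [|exact: integrable_law..].
have -> : \int[mu]_x (g x * normal_pdf m s x) =
   \int[mu]_x (gp x * normal_pdf m s x - gn x * normal_pdf m s x).
  by apply: eq_Rintegral => w _; rewrite -mulrBl -H.
rewrite RintegralB// /Rintegral !E// => x; rewrite /gn /gp le_max lexx orbT//.
Qed.

End gaussian_law_integrals.

(** * Small balls of Gaussian vectors *)

Section gaussian_smoothing.
Context d (T : measurableType d) (R : realType) (P : probability T R).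
Local Notation mu := (@lebesgue_measure R).

Lemma integrable_bounded (f : T -> R) (k : R) : measurable_fun setT f ->
  (forall w, `|f w| <= k) -> P.-integrable setT (EFin \o f).
Proof.
move=> mf fk; apply: measurable_bounded_integrable => //.
  exact: le_lt_trans (probability_le1 P measurableT) (ltry 1).
exists k; split; first exact: num_real.
by move=> x kx y _ /=; rewrite (le_trans (fk y))// ltW.
Qed.

(** Averaging [cos (u X)] over a standard normal [u] produces [exp (- X^2 / 2)];
    by Fubini the average may be taken last. *)
Lemma gaussian_smoothing_le (G Y X : T -> R) (g : R -> R) :
  measurable_fun setT G -> measurable_fun setT Y -> measurable_fun setT X ->
  (forall w, `|G w| <= 1) ->
  measurable_fun setT g ->
  (forall u, `|\int[P]_w (G w * cos (Y w) * cos (u * X w))| <= g u) ->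
  (`|\int[P]_w (G w * cos (Y w) * expR (- (X w ^+ 2 / 2)))|%:E <=
   \int[mu]_u (normal_pdf 0 1 u * g u)%:E)%E.
Proof.
move=> mG mY mX G1 mg Hg.
pose f (z : T * measurableTypeR R) : R :=
  G z.1 * cos (Y z.1) * cos (z.2 * X z.1) * normal_pdf 0 1 z.2.
have mcos : measurable_fun setT (@cos R).
  by apply: continuous_measurable_fun; exact: continuous_cos.
have mf : measurable_fun setT (EFin \o f).
  apply/measurable_EFinP; apply: measurable_funM; last first.
    apply: (measurableT_comp (measurable_normal_pdf 0 1)).
    exact: measurable_snd.
  apply: measurable_funM; last first.
    apply: measurableT_comp => //; apply: measurable_funM.
      exact: measurable_snd.
    by apply: measurableT_comp => //; exact: measurable_fst.
  apply: measurable_funM.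
    by apply: measurableT_comp => //; exact: measurable_fst.
  apply: measurableT_comp => //.
  by apply: measurableT_comp => //; exact: measurable_fst.
have GC w : `|G w * cos (Y w)| <= 1.
  by rewrite normrM mulr_ile1// cos_max.
have GCC w u : `|G w * cos (Y w) * cos (u * X w)| <= 1.
  by rewrite normrM mulr_ile1// cos_max.
have fp w u : `|f (w, u)| <= normal_pdf 0 1 u.
  by rewrite /f/= normrM (ger0_norm (normal_pdf_ge0 _ _ _)) ler_piMl// normal_pdf_ge0.
have fw w : measurable_fun setT (fun u : measurableTypeR R => `|(f (w, u))%:E|%E).
  apply: measurableT_comp => //.
  exact: (measurableT_comp mf (measurable_pair1 w)).
have intf : (P \x mu)%E.-integrable setT (EFin \o f).
  apply/integrable12ltyP => //=.
  apply: (@le_lt_trans _ _ (\int[P]_w 1)%E); last first.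
    by rewrite integral_cst// mul1e; exact: le_lt_trans (probability_le1 P measurableT) (ltry 1).
  apply: ge0_le_integral => //.
  - by move=> w _; exact: integral_ge0.
  - apply: (measurable_fun_fubini_tonelli_F (abse \o (EFin \o f))) => //.
      exact: measurableT_comp.
    by move=> z /=; rewrite lee_fin.
  - move=> w _; rewrite -(integral_normal_pdf 0 1).
    apply: ge0_le_integral => //.
    + exact: fw.
    + by apply/measurable_EFinP; exact: measurable_normal_pdf.
    + by move=> u _; rewrite lee_fin fp.
have mGCX u : measurable_fun setT (fun w => G w * cos (Y w) * cos (u * X w)).
  apply: measurable_funM; last by apply: measurableT_comp => //; exact: measurable_funM.
  by apply: measurable_funM => //; exact: measurableT_comp.
have E1 w : (\int[mu]_u (f (w, u))%:E =
    (G w * cos (Y w) * expR (- (X w ^+ 2 / 2)))%:E)%E.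
  have ic : mu.-integrable setT
      (EFin \o (fun u => cos (X w * (u - 0)) * normal_pdf 0 1 u)).
    apply: (@integrable_normal_moment _ _ _ _ 1) => //.
      by apply: measurableT_comp => //; apply: measurable_funM => //; exact: measurable_funB.
    by move=> u; rewrite mul1r (le_trans (cos_max _))// -addrA lerDl addr_ge0 ?sqr_ge0.
  have := Rintegral_normal_cos 0 (X w) (@ltr01 R).
  rewrite expr1n mul1r => <-.
  rewrite EFinM /Rintegral fineK; last exact: (integrable_fin_num _ ic).
  rewrite -integralZl//; apply: eq_integral => u _.
  by rewrite -EFinM /f /= subr0 (mulrC u) -!mulrA.
have E2 u : (\int[P]_w (f (w, u))%:E =
    (normal_pdf 0 1 u * \int[P]_w (G w * cos (Y w) * cos (u * X w)))%:E)%E.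
  have ic := integrable_bounded (mGCX u) (GCC^~ u).
  rewrite EFinM /Rintegral fineK; last exact: (integrable_fin_num _ ic).
  rewrite -integralZl//; apply: eq_integral => w _.
  by rewrite -EFinM /f /= mulrC.
have := Fubini intf.
under eq_integral do rewrite E1.
under [RHS]eq_integral do rewrite E2.
move=> FF.
have iE : P.-integrable setT
    (EFin \o (fun w => G w * cos (Y w) * expR (- (X w ^+ 2 / 2)))).
  apply: (@integrable_bounded _ 1).
    apply: measurable_funM; first by apply: measurable_funM => //; exact: measurableT_comp.
    apply: measurableT_comp => //; apply: measurableT_comp => //.
    by apply: measurable_funM => //; exact: measurable_funX.
  move=> w; rewrite normrM mulr_ile1// ger0_norm ?expR_ge0// expR_le1 oppr_le0.
  by rewrite divr_ge0// sqr_ge0.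
rewrite -abse_EFin /Rintegral fineK; last exact: (integrable_fin_num _ iE).
rewrite FF.
have mH : measurable_fun setT (fun u : measurableTypeR R =>
    (normal_pdf 0 1 u * \int[P]_w (G w * cos (Y w) * cos (u * X w)))%:E).
  under eq_fun do rewrite -E2.
  exact: (measurable_fubini_G intf).
apply: (le_trans (le_abse_integral mu measurableT mH)).
apply: ge0_le_integral => //.
- exact: measurableT_comp.
- apply/measurable_EFinP; apply: measurable_funM => //; exact: measurable_normal_pdf.
- move=> u _; rewrite lee_fin normrM (ger0_norm (normal_pdf_ge0 _ _ _)).
  by rewrite ler_wpM2l// normal_pdf_ge0.
Qed.

(** The first density is replaced by its maximum, and the second factor is a
    multiple of a normal density of variance [1 / v]. *)
Lemma gaussian_conv_le (v l : R) : 0 < v ->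
  (\int[mu]_u (normal_pdf 0 1 u * expR (- (v * (u + l) ^+ 2 / 2)))%:E <=
   ((Num.sqrt v)^-1)%:E)%E.
Proof.
move=> v0; pose s := (Num.sqrt v)^-1.
have s0 : 0 < s by rewrite invr_gt0 sqrtr_gt0.
have s2 : s ^+ 2 = v^-1 by rewrite exprVn sqr_sqrtr// ltW.
have p1 := normal_peak_gt0 (oner_neq0 R).
have ps := normal_peak_gt0 (lt0r_neq0 s0).
have pE : normal_peak 1 / normal_peak s = s.
  rewrite /normal_peak invrK expr1n mul1r -mulrnAr sqrtrM ?sqr_ge0//.
  by rewrite sqrtr_sqr (gtr0_norm s0) mulrCA mulVf ?mulr1// gt_eqF// sqrtr_gt0 mulrn_wgt0// pi_gt0.
apply: (@le_trans _ _ (\int[mu]_u (s%:E * (normal_pdf (- l) s u)%:E))%E).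
  apply: ge0_le_integral => //.
  - by move=> u _; rewrite lee_fin mulr_ge0 ?expR_ge0 ?normal_pdf_ge0.
  - apply/measurable_EFinP; apply: measurable_funM; first exact: measurable_normal_pdf.
    apply: measurableT_comp => //; apply: measurableT_comp => //; apply: measurable_funM => //.
    by apply: measurable_funM => //; apply: measurable_funX; exact: measurable_funD.
  - apply: emeasurable_funM => //; apply/measurable_EFinP; exact: measurable_normal_pdf.
  - move=> u _; rewrite -EFinM lee_fin.
    have -> : s * normal_pdf (- l) s u = normal_peak 1 * expR (- (v * (u + l) ^+ 2 / 2)).
      rewrite (normal_pdfE _ (lt0r_neq0 s0)) mulrA -{1}pE divfK ?gt_eqF//.
      rewrite /normal_fun opprK s2; congr (_ * expR _).
      by field; rewrite gt_eqF.
    by rewrite ler_wpM2r ?expR_ge0// normal_pdf_ub// oner_neq0.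
rewrite ge0_integralZl//.
- by rewrite integral_normal_pdf mule1.
- by apply/measurable_EFinP; exact: measurable_normal_pdf.
- by move=> u _; rewrite lee_fin normal_pdf_ge0.
- by rewrite lee_fin ltW.
Qed.

End gaussian_smoothing.
Section gaussian_small_ball.
Context d (T : measurableType d) (R : realType) (P : probability T R).
Context (V : lmodType R) (L : V -> T -> R) (b : V -> V -> R).
Hypothesis L_lin : forall c x y w, L (c *: x + y) w = c * L x w + L y w.
Hypothesis L_meas : forall x, measurable_fun setT (L x).
Hypothesis b_lin : forall c x y z, b (c *: x + y) z = c * b x z + b y z.
Hypothesis b_sym : forall x y, b x y = b y x.
Hypothesis L_char : forall x, \int[P]_w cos (L x w) = expR (- (b x x / 2)).
Local Notation mu := (@lebesgue_measure R).

(** The Gram-Schmidt residual of [y] after the vectors of [s], last first. *)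
Fixpoint resid (s : seq V) (y : V) : V :=
  if s is x :: s' then
    resid s' y - (b (resid s' y) (resid s' x) / b (resid s' x) (resid s' x)) *: resid s' x
  else y.

Definition resid_var s y := b (resid s y) (resid s y).

(** The pivots are the variances of the successive residuals, that is, the
    conditional variances of each variable given those after it in the list. *)
Fixpoint pivots_gt0 (s : seq V) : Prop :=
  if s is x :: s' then 0 < resid_var s' x /\ pivots_gt0 s' else True.

Fixpoint inv_pivots (s : seq V) : R :=
  if s is x :: s' then (Num.sqrt (resid_var s' x))^-1 * inv_pivots s' else 1.

Lemma resid_lin s c x y : resid s (c *: x + y) = c *: resid s x + resid s y.
Proof.
elim: s c x y => //= z s IH c x y; rewrite !IH b_lin mulrDl scalerDl scalerBr.
by rewrite scalerA -mulrA opprD addrACA.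
Qed.

Lemma inv_pivots_ge0 s : 0 <= inv_pivots s.
Proof. by elim: s => //= x s IH; rewrite mulr_ge0// invr_ge0 sqrtr_ge0. Qed.

Lemma resid_var_complete_square s x y u : resid_var s x != 0 ->
  resid_var s (u *: x + y) =
  resid_var s x * (u + b (resid s y) (resid s x) / resid_var s x) ^+ 2
  + resid_var (x :: s) y.
Proof.
move=> v0; rewrite /resid_var resid_lin /=.
move: v0; rewrite /resid_var; set X := resid s x; set Y := resid s y => v0.
have -> : Y - (b Y X / b X X) *: X = (- (b Y X / b X X)) *: X + Y.
  by rewrite scaleNr addrC.
rewrite !(b_lin, b_sym X (_ + _), b_sym Y (_ + _)) (b_sym X Y).
by field.
Qed.

Definition gauss_weight (s : seq V) (w : T) : R :=
  \prod_(x <- s) expR (- (L x w ^+ 2 / 2)).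

Lemma gauss_weight_le1 s w : `|gauss_weight s w| <= 1.
Proof.
rewrite /gauss_weight ger0_norm; last by apply: prodr_ge0 => x _; exact: expR_ge0.
apply: prodr_ile1 => x _; rewrite expR_ge0 expR_le1 oppr_le0.
by rewrite divr_ge0// sqr_ge0.
Qed.

Lemma measurable_gauss_weight s : measurable_fun setT (gauss_weight s).
Proof.
rewrite /gauss_weight; apply: measurable_prod => x _.
apply: measurableT_comp => //; apply: measurableT_comp => //.
by apply: measurable_funM => //; exact: measurable_funX.
Qed.

(** By induction, the Gaussian weight of one more variable [L x] is an average
    of the functions [cos (u L x)]. Completing the square in [u] splits off the
    factor [exp (- v (u + l)^2 / 2)], where [v] is the pivot of [x], and averaging
    it over [u] costs the factor [1 / sqrt v]. *)
Lemma gauss_weight_char_le s y : pivots_gt0 s ->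
  `|\int[P]_w (gauss_weight s w * cos (L y w))| <=
  inv_pivots s * expR (- (resid_var s y / 2)).
Proof.
have mcos : measurable_fun setT (@cos R).
  by apply: continuous_measurable_fun; exact: continuous_cos.
elim: s y => [|x s IH] y /=.
  move=> _; rewrite mul1r /resid_var/= -L_char ger0_norm.
    by under eq_Rintegral do rewrite /gauss_weight big_nil mul1r.
  under eq_Rintegral do rewrite /gauss_weight big_nil mul1r.
  by rewrite L_char expR_ge0.
move=> [v0 ps].
set v := resid_var s x in v0 *.
pose l := b (resid s y) (resid s x) / v.
have mG := measurable_gauss_weight s.
pose e (u t : R) := expR (- (v * (u + t) ^+ 2 / 2)).
pose K := inv_pivots s * expR (- (resid_var (x :: s) y / 2)).
have K0 : 0 <= K by rewrite mulr_ge0 ?inv_pivots_ge0 ?expR_ge0.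
have me t : measurable_fun setT (e ^~ t).
  apply: measurableT_comp => //; apply: measurableT_comp => //; apply: measurable_funM => //.
  by apply: measurable_funM => //; apply: measurable_funX; exact: measurable_funD.
have IHu u : `|\int[P]_w (gauss_weight s w * cos (L (u *: x + y) w))| <= K * e u l.
  apply: (le_trans (IH _ ps)); rewrite resid_var_complete_square ?gt_eqF//.
  by rewrite mulrDl opprD expRD -/v -/l mulrCA mulrC lexx.
have eN u : e (- u) l = e u (- l).
  by rewrite /e; congr (expR (- (v * _ / 2))); ring.
have bnd u : `|\int[P]_w (gauss_weight s w * cos (L y w) * cos (u * L x w))| <=
    2^-1 * K * (e u l + e u (- l)).
  have -> : \int[P]_w (gauss_weight s w * cos (L y w) * cos (u * L x w)) =
     2^-1 * (\int[P]_w (gauss_weight s w * cos (L (u *: x + y) w)) +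
             \int[P]_w (gauss_weight s w * cos (L ((- u) *: x + y) w))).
    have ii z : P.-integrable setT (EFin \o (fun w => gauss_weight s w * cos (L z w))).
      apply: (@integrable_bounded _ _ _ _ _ 1).
        by apply: measurable_funM => //; exact: measurableT_comp.
      by move=> w; rewrite normrM mulr_ile1 ?gauss_weight_le1 ?cos_max.
    rewrite -RintegralD// -RintegralZl//; last first.
      have := integrableD measurableT (ii (u *: x + y)) (ii ((- u) *: x + y)).
      by apply: eq_integrable => // w _ /=; rewrite EFinD.
    by apply: eq_Rintegral => w _; rewrite !L_lin mulNr !cosD cosN sinN; field.
  rewrite normrM ger0_norm// -mulrA ler_wpM2l// mulrDr.
  by rewrite (le_trans (ler_normD _ _))// lerD// -?eN.
have mg : measurable_fun setT (fun u => 2^-1 * K * (e u l + e u (- l))).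
  by apply: measurable_funM => //; exact: measurable_funD.
have := gaussian_smoothing_le mG (L_meas y) (L_meas x) (gauss_weight_le1 s) mg bnd.
have -> : \int[P]_w (gauss_weight s w * cos (L y w) * expR (- (L x w ^+ 2 / 2)))
  = \int[P]_w (gauss_weight (x :: s) w * cos (L y w)).
  by apply: eq_Rintegral => w _; rewrite /gauss_weight big_cons; ring.
have ipe t : measurable_fun setT (fun u => (normal_pdf 0 1 u * e u t)%:E).
  by apply/measurable_EFinP; apply: measurable_funM => //; exact: measurable_normal_pdf.
have pe0 t u : (0 <= (normal_pdf 0 1 u * e u t)%:E)%E.
  by rewrite lee_fin mulr_ge0 ?normal_pdf_ge0 ?expR_ge0.
move=> H; rewrite -lee_fin; apply: (le_trans H).
under eq_integral.
  move=> u _; rewrite mulrCA mulrDr EFinM EFinD; over.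
rewrite ge0_integralZl//; last 3 first.
- by apply: emeasurable_funD; exact: ipe.
- by move=> u _; exact: adde_ge0.
- by rewrite lee_fin mulr_ge0.
rewrite ge0_integralD//; [|exact: ipe..].
have H1 := gaussian_conv_le l v0; have H2 := gaussian_conv_le (- l) v0.
apply: (le_trans (lee_wpmul2l _ (leeD H1 H2))); first by rewrite lee_fin mulr_ge0.
rewrite -EFinD -EFinM lee_fin /K; set r := (Num.sqrt v)^-1.
by rewrite le_eqVlt; apply/orP; left; apply/eqP; field.
Qed.

(** A Chebyshev bound with the weight [exp (- sum (L x)^2 / 2)]. *)
Lemma gaussian_small_ball_le s : pivots_gt0 s ->
  (P [set w | all (fun x => `|L x w| <= 1)%R s] <=
   (expR ((size s)%:R / 2) * inv_pivots s)%:E)%E.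
Proof.
move=> ps; set A := [set w | _].
have mA : measurable A.
  rewrite /A; elim: s {ps A} => [|x s IH] /=.
    by rewrite (_ : [set _ | _] = setT)//; apply/seteqP.
  rewrite (_ : [set _ | _] = [set w | `|L x w| <= 1] `&` [set w | all (fun x => `|L x w| <= 1) s]).
    apply: measurableI => //.
    rewrite -[X in measurable X]setTI.
    have mn : measurable_fun setT (fun w => `|L x w|) by apply: measurableT_comp.
    have := mn measurableT `]-oo, 1%R]%classic (measurable_itv _).
    by congr (measurable (_ `&` _)); apply/seteqP; split=> w /=; rewrite in_itv.
  by apply/seteqP; split=> w /= => [/andP//|[-> ->]].
have mG := measurable_gauss_weight s.
have iG : P.-integrable setT (EFin \o gauss_weight s).
  by apply: (@integrable_bounded _ _ _ _ _ 1) => //; exact: gauss_weight_le1.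
have -> : P A = (\int[P]_w (\1_A w)%:E)%E by rewrite integral_indic// setIT.
apply: (@le_trans _ _ (\int[P]_w ((expR ((size s)%:R / 2))%:E * (gauss_weight s w)%:E))%E).
  apply: ge0_le_integral => //.
  - by apply/measurable_EFinP; exact: measurable_indic.
  - by apply: emeasurable_funM => //; apply/measurable_EFinP.
  - move=> w _; rewrite -EFinM lee_fin indicE.
    have g0 t : 0 <= gauss_weight t w by apply: prodr_ge0 => x _; exact: expR_ge0.
    case: (boolP (w \in A)) => /=; last by rewrite mulr_ge0 ?expR_ge0.
    rewrite inE /A /=; elim: s {ps A mA mG iG} => [|x s IH] /=.
      by rewrite mul0r expR0 mul1r /gauss_weight big_nil.
    move=> /andP[x1 /IH IHs]; rewrite /gauss_weight big_cons -/(gauss_weight s w).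
    have -> : (size s).+1%:R / 2 = 2^-1 + (size s)%:R / 2 :> R.
      by rewrite -natr1; field.
    rewrite expRD mulrACA mulr_ege1// -expRD -[leLHS]expR0 ler_expR.
    have : `|L x w| ^+ 2 <= 1 by rewrite exprn_ile1.
    rewrite real_normK ?num_real//; lra.
rewrite integralZl//.
have := gauss_weight_char_le 0 ps.
have L0 w : L 0 w = 0 by have := L_lin (-1) 0 0 w; rewrite scaler0 addr0; lra.
have r0 : resid_var s 0 = 0.
  have R0 : resid s 0 = 0.
    by have := resid_lin s (-1) 0 0; rewrite scaler0 addr0 scaleN1r => ->; rewrite addNr.
  by rewrite /resid_var R0; have := b_lin (-1) 0 0 0; rewrite scaler0 addr0; lra.
rewrite r0 mul0r oppr0 expR0 mulr1.
under eq_Rintegral do rewrite L0 cos0 mulr1.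
move=> /(le_trans (ler_norm _)) H.
rewrite EFinM lee_wpmul2l ?lee_fin ?expR_ge0//.
by rewrite -[leLHS]fineK ?lee_fin//; exact: (integrable_fin_num _ iG).
Qed.

End gaussian_small_ball.

(** * Increments of fractional Brownian motion *)

Section fbm_gaussian.
Context (R : realType) d (T : measurableType d) (P : probability T R).
Context (alpha : R) (B : R -> {RV P >-> R}).
Hypothesis alpha01 : 0 < alpha < 1.
Hypothesis hB : fractional_brownian_motion alpha `[0%R, 1%R] B.
Local Notation mu := (@lebesgue_measure R).

Let I01 (t : R) : `[0%R, 1%R]%classic t = (0 <= t <= 1).
Proof. by rewrite /= in_itv. Qed.

Lemma fbm_increment_law (s t : R) : 0 <= s -> s < t -> t <= 1 ->
  forall U : set R, measurable U ->
  pushforward P (fun w => (t - s) `^ (- alpha) * (B t w - B s w)) U =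
  normal_prob 0 1 U.
Proof.
move=> s0 st t1 U mU.
have ts0 : 0 < t - s by rewrite subr_gt0.
have Its : `[0%R, 1%R]%classic (t - s) by rewrite I01; lra.
have := fbm_stationary hB (s := 0) (t := t - s) (h := s).
rewrite !I01 add0r subrK => /(_ _ _ _ _) H.
have {}H : forall U : set R, measurable U ->
    pushforward P (fun w => B t w - B s w) U =
    pushforward P (fun w => B (t - s) w - B 0 w) U by apply: H; lra.
have mk : measurable_fun setT (fun x : R => (t - s) `^ (- alpha) * x).
  by apply: measurable_funM.
have mV : measurable ((fun x : R => (t - s) `^ (- alpha) * x) @^-1` U).
  by rewrite -[X in measurable X]setTI; exact: mk.
have := H _ mV; rewrite /pushforward => E.
rewrite -(fbm_normal hB Its ts0 mU) /pushforward.
transitivity (P ((fun w => B t w - B s w) @^-1`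
   ((fun x : R => (t - s) `^ (- alpha) * x) @^-1` U))); first by [].
by rewrite E; congr (P _); apply/funext => w; rewrite /= (fbm_0 hB) subr0.
Qed.

Let integrable_normal01 (g : R -> R) : measurable_fun setT g ->
  (forall x, `|g x| <= 1 + `|x| + x ^+ 2) ->
  mu.-integrable setT (EFin \o (fun x => g x * normal_pdf 0 1 x)).
Proof.
move=> mg H; apply: (@integrable_normal_moment _ _ _ _ 1) => //.
by move=> x; rewrite subr0 mul1r.
Qed.

Lemma fbm_increment_moments (s t : R) : 0 <= s <= 1 -> 0 <= t <= 1 ->
  [/\ P.-integrable setT (EFin \o (fun w => B t w - B s w)),
      \int[P]_w (B t w - B s w) = 0,
      P.-integrable setT (EFin \o (fun w => (B t w - B s w) ^+ 2)) &
      \int[P]_w (B t w - B s w) ^+ 2 = `|t - s| `^ (2 * alpha)].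
Proof.
have al0 : 0 < alpha by case/andP: alpha01.
wlog : s t / s <= t => [H s01 t01|].
  have [|/ltW ts] := leP s t; first by move=> st; exact: H.
  have [h1 h2 h3 h4] := H t s ts t01 s01.
  have E (w : T) : B t w - B s w = -1 * (B s w - B t w) by ring.
  split.
  - have := integrableZl measurableT (-1) h1.
    by apply: eq_integrable => // w _ /=; rewrite E EFinM.
  - by under eq_Rintegral do rewrite E; rewrite RintegralZl// h2 mulr0.
  - by apply: eq_integrable h3 => // w _ /=; rewrite -sqrrN opprB.
  - by under eq_Rintegral do rewrite -sqrrN opprB; rewrite h4 distrC.
rewrite le_eqVlt => /predU1P[->|st] /andP[s0 s1] /andP[t0 t1].
  have E (w : T) : B t w - B t w = 0 by rewrite subrr.
  have i0 : P.-integrable setT (EFin \o (fun w => B t w - B t w)).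
    apply: (@eq_integrable _ _ _ _ _ measurableT (cst 0%E)) => //.
      by move=> w _; rewrite /= E.
    exact: integrable0.
  split => //.
  - under eq_Rintegral do rewrite E.
    by rewrite Rintegral_cst// mul0r.
  - by apply: eq_integrable i0 => // w _; rewrite /= E expr0n.
  - under eq_Rintegral do rewrite E expr0n/=.
    by rewrite Rintegral_cst// mul0r subrr normr0 powR0// mulf_neq0// gt_eqF.
have law := fbm_increment_law s0 st t1.
have ts0 : 0 < t - s by rewrite subr_gt0.
set k := (t - s) `^ (- alpha) in law.
have k0 : 0 < k by exact: powR_gt0.
have mX : measurable_fun setT (fun w => k * (B t w - B s w)).
  by apply: measurable_funM => //; exact: measurable_funB.
have iid : mu.-integrable setT (EFin \o (fun x => id x * normal_pdf 0 1 x)).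
  apply: integrable_normal01 => // x; rewrite addrAC lerDr addr_ge0 ?sqr_ge0//.
have isq : mu.-integrable setT (EFin \o (fun x => (x ^+ 2) * normal_pdf 0 1 x)).
  apply: (@integrable_normal01 (fun x => x ^+ 2)); first exact: measurable_funX.
  by move=> x; rewrite normrX real_normK ?num_real// lerDr addr_ge0.
have i1 := integrable_law mX law (@measurable_id _ _ setT) iid.
have e1 := Rintegral_law mX law (@measurable_id _ _ setT) iid.
have msq : measurable_fun setT (fun x : R => x ^+ 2) by exact: measurable_funX.
have i2 := integrable_law mX law msq isq.
have e2 := Rintegral_law mX law msq isq.
have E (w : T) : B t w - B s w = k^-1 * (k * (B t w - B s w)) by rewrite mulKf ?gt_eqF.
have E2 (w : T) : (B t w - B s w) ^+ 2 = k ^- 2 * (k * (B t w - B s w)) ^+ 2.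
  by rewrite {1}E exprMn exprVn.
split.
- have := integrableZl measurableT k^-1 i1.
  by apply: eq_integrable => // w _ /=; rewrite -EFinM -E.
- under eq_Rintegral do rewrite E.
  rewrite RintegralZl// e1; have := Rintegral_normal_center 0 (@ltr01 R).
  by under eq_Rintegral do rewrite subr0; move=> ->; rewrite mulr0.
- have := integrableZl measurableT (k ^- 2) i2.
  by apply: eq_integrable => // w _ /=; rewrite E2 EFinM.
- under eq_Rintegral do rewrite E2.
  rewrite RintegralZl// e2; have := Rintegral_normal_sqr 0 (@ltr01 R).
  under eq_Rintegral do rewrite subr0.
  move=> ->; rewrite expr1n mulr1 gtr0_norm// /k -exprVn -powRN opprK.
  by rewrite -powR_mulrn ?powR_ge0// -powRrM mulrC.
Qed.

Lemma sum_sqr_centered n (a x : 'I_n -> R) : \sum_i a i = 0 ->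
  (\sum_i a i * x i) ^+ 2 = - 2^-1 * \sum_i \sum_j a i * a j * (x i - x j) ^+ 2.
Proof.
move=> a0; rewrite expr2 big_distrlr/=.
have -> : \sum_i \sum_j a i * a j * (x i - x j) ^+ 2 =
  \sum_i \sum_j ((a i * x i ^+ 2) * a j + a i * (a j * x j ^+ 2)
                 + -2 * (a i * x i * (a j * x j))).
  by apply: eq_bigr => i _; apply: eq_bigr => j _; ring.
under [in RHS]eq_bigr do rewrite !big_split/=.
rewrite !big_split/= -!big_distrlr/= a0 mulr0 mul0r !add0r.
under [in RHS]eq_bigr do rewrite -mulr_sumr.
rewrite [LHS]big_distrlr/= mulr_sumr; apply: eq_bigr => i _.
by rewrite mulrA (_ : - 2^-1 * -2 = 1 :> R) ?mul1r//; field.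
Qed.

(** A zero-sum combination is a Gaussian combination of increments. It is
    centered, and its variance is found by polarization from the variances of the
    increments. *)
Lemma fbm_char n (t a : 'I_n -> R) : (forall i, 0 <= t i <= 1) ->
  \sum_i a i = 0 ->
  \int[P]_w cos (\sum_i a i * B (t i) w) = expR (- (fbm_form alpha t a a / 2)).
Proof.
move=> t01 a0; set Y := fun w => \sum_i a i * B (t i) w.
have mY : measurable_fun setT Y.
  by apply: measurable_sum => i; exact: measurable_funM.
have mcos : measurable_fun setT (@cos R).
  by apply: continuous_measurable_fun; exact: continuous_cos.
have PT : P setT = 1%E by exact: probability_setT.
have z01 : 0 <= (0 : R) <= 1 by rewrite lexx ler01.
have EY (w : T) : Y w = \sum_i a i * (B (t i) w - B 0 w).
  by rewrite /Y; apply: eq_bigr => i _; rewrite (fbm_0 hB) subr0.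
have EY1 : \int[P]_w Y w = 0.
  under eq_Rintegral do rewrite EY.
  rewrite Rintegral_lin_comb.
    rewrite big1// => i _; have [_ -> _ _] := fbm_increment_moments z01 (t01 i).
    by rewrite mulr0.
  by move=> i; have [] := fbm_increment_moments z01 (t01 i).
have EY2 : \int[P]_w Y w ^+ 2 = fbm_form alpha t a a.
  rewrite /Y; under eq_Rintegral do rewrite (sum_sqr_centered _ a0) mulr_sumr.
  have ii (i j : 'I_n) : P.-integrable setT
     (EFin \o (fun w => (B (t i) w - B (t j) w) ^+ 2)).
    by have [] := fbm_increment_moments (t01 j) (t01 i).
  rewrite Rintegral_lin_comb; last by move=> i; apply: integrable_lin_comb.
  rewrite /fbm_form mulr_sumr; apply: eq_bigr => i _.
  rewrite Rintegral_lin_comb//; congr (_ * _); apply: eq_bigr => j _.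
  by have [_ _ _ ->] := fbm_increment_moments (t01 j) (t01 i).
have tI i : `[0%R, 1%R]%classic (t i) by rewrite I01.
(* The combination may be degenerate, for instance when the weights vanish. *)
have [[m lawY]|[m [s [s0 lawY]]]] := fbm_gaussian hB a tI.
- have aeY : {ae P, forall w, Y w = m}.
    exists (Y @^-1` (~` [set m])); split.
    + by rewrite -[X in measurable X]setTI; apply: mY => //; apply: measurableC.
    + have := lawY (~` [set m]) (measurableC (measurable_set1 m)).
      by rewrite /pushforward diracE memNset//= => h; exact: h.
    + by move=> w /= Yw.
  have ig (g : R -> R) : measurable_fun setT g -> \int[P]_w g (Y w) = g m.
    move=> mg; rewrite /Rintegral.
    rewrite (@ae_eq_integral _ _ _ P setT (cst (g m)%:E) (fun w => (g (Y w))%:E))//.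
    + by rewrite integral_cst//= [X in (_ * X)%E]PT mule1.
    + by apply/measurable_EFinP; exact: measurableT_comp.
    + by case: aeY => N [mN N0 HN]; exists N; split => // w /= h; apply: HN => /= Yw;
        apply: h => _; rewrite Yw.
  have := EY1; rewrite (ig id)// => m0.
  have := EY2; rewrite (ig (fun x => x ^+ 2)); last exact: measurable_funX.
  rewrite (ig cos)// m0 expr0n/= cos0 => <-.
  by rewrite mul0r oppr0 expR0.
- have mmt (g : R -> R) : measurable_fun setT g ->
      (forall x, `|g x| <= 1 * (1 + `|x - m| + (x - m) ^+ 2)) ->
      \int[P]_w g (Y w) = \int[mu]_x (g x * normal_pdf m s x).
    move=> mg gb; apply: (Rintegral_law mY lawY mg).
    exact: (integrable_normal_moment s0 mg gb).
  have icen : P.-integrable setT (EFin \o (fun w => Y w - m)).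
    have mcen : measurable_fun setT (fun x : R => x - m) by exact: measurable_funB.
    apply: (integrable_law mY lawY mcen).
    apply: (integrable_normal_moment (k := 1) s0 mcen) => x.
    by rewrite mul1r addrAC lerDr addr_ge0 ?sqr_ge0.
  have m0 : m = 0.
    have := Rintegral_normal_center m s0.
    rewrite -(mmt (fun x => x - m)); last 2 first.
    + exact: measurable_funB.
    + by move=> x; rewrite mul1r addrAC lerDr addr_ge0 ?sqr_ge0.
    have ic : P.-integrable setT (EFin \o (fun _ : T => m)).
      exact: finite_measure_integrable_cst.
    have E0 : \int[P]_w Y w = \int[P]_w ((Y w - m) + m).
      by apply: eq_Rintegral => w _; rewrite subrK.
    move=> h0; move: EY1; rewrite E0 RintegralD// h0 add0r Rintegral_cst//.
    by rewrite [X in fine X]PT mulr1.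
  rewrite m0 in mmt; have := Rintegral_normal_sqr 0 s0.
  under eq_Rintegral do rewrite subr0.
  rewrite -(mmt (fun x => x ^+ 2)); last 2 first.
  + exact: measurable_funX.
  + by move=> x; rewrite subr0 mul1r normrX real_normK ?num_real// lerDr addr_ge0.
  rewrite EY2 => ->.
  rewrite (mmt cos)//; last first.
    by move=> x; rewrite mul1r (le_trans (cos_max _))// -addrA lerDl addr_ge0 ?sqr_ge0.
  have := Rintegral_normal_cos 0 1 s0; rewrite expr1n mulr1 => <-.
  by apply: eq_Rintegral => x _; rewrite mul1r subr0.
Qed.

(** The standard normal density is at most [exp (- lam ^ 2 / 4)] times a
    constant multiple of a wider normal density outside [[- lam, lam]]. *)
Lemma fbm_increment_tail : {C : R | 0 < C & forall (s t lam : R),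
  0 <= s -> s < t -> t <= 1 -> 0 <= lam ->
  (P [set w | (lam * (t - s) `^ alpha < `|B t w - B s w|)%R] <=
   (C * expR (- (lam ^+ 2 / 4)))%:E)%E}.
Proof.
have p1 := normal_peak_gt0 (oner_neq0 R).
have n20 : (2 : R) != 0 by rewrite pnatr_eq0.
have p2 := normal_peak_gt0 n20.
exists (normal_peak (1 : R) / normal_peak 2); first exact: divr_gt0.
move=> s t lam s0 st t1 l0.
have law := fbm_increment_law s0 st t1.
have ts0 : 0 < t - s by rewrite subr_gt0.
have k0 : 0 < (t - s) `^ alpha by rewrite powR_gt0.
pose U : set R := [set x | lam < `|x|].
have mU : measurable U.
  have mn : measurable_fun setT (fun x : R => `|x|) by exact: measurableT_comp.
  have := mn measurableT `]lam, +oo[%classic (measurable_itv _).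
  rewrite setTI; congr (measurable _); apply/seteqP.
  by split => x /=; rewrite in_itv/= andbT.
have -> : [set w | lam * (t - s) `^ alpha < `|B t w - B s w|] =
    (fun w => (t - s) `^ (- alpha) * (B t w - B s w)) @^-1` U.
  have E (x : R) : (lam < `|(t - s) `^ (- alpha) * x|) = (lam * (t - s) `^ alpha < `|x|).
    by rewrite normrM (gtr0_norm (powR_gt0 _ ts0)) powRN ltr_pdivlMl// mulrC.
  by apply/seteqP; split => w; rewrite /U/= E.
have := law _ mU; rewrite /pushforward => ->; rewrite /normal_prob.
set C := normal_peak 1 / normal_peak 2.
have C0 : 0 < C by exact: divr_gt0.
apply: (@le_trans _ _
  (\int[mu]_(x in U) ((C * expR (- (lam ^+ 2 / 4)))%:E * (normal_pdf 0 2 x)%:E))%E).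
  apply: ge0_le_integral => //.
  - by move=> x _; rewrite lee_fin normal_pdf_ge0.
  - by apply/measurable_EFinP/measurable_funTS; exact: measurable_normal_pdf.
  - by apply: emeasurable_funM => //; apply/measurable_EFinP/measurable_funTS; exact: measurable_normal_pdf.
  - move=> x Ux; rewrite -EFinM lee_fin !normal_pdfE// ?oner_neq0//.
    have CE : C * normal_peak 2 = normal_peak 1 by rewrite /C divfK ?gt_eqF.
    rewrite /normal_fun !subr0 expr1n [leRHS]mulrACA CE -expRD.
    rewrite ler_wpM2l ?(ltW p1)// ler_expR.
    have : lam ^+ 2 <= x ^+ 2.
      by rewrite -(real_normK (num_real x)) lerXn2r ?nnegrE// ltW.
    have := sqr_ge0 x; lra.
rewrite ge0_integralZl//.
- rewrite -[leRHS]mule1 lee_wpmul2l//.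
    by rewrite lee_fin mulr_ge0 ?expR_ge0// ltW.
  exact: (probability_le1 (normal_prob 0 (2 : R)) mU).
- by apply/measurable_EFinP/measurable_funTS; exact: measurable_normal_pdf.
- by move=> x _; rewrite lee_fin normal_pdf_ge0.
- by rewrite lee_fin mulr_ge0 ?expR_ge0// ltW.
Qed.

(** Weights [v 1, v 2, ...] on the increments [B (t i) - B (t 0)], turned into
    zero-sum weights on the values [B (t i)]. *)
Definition zero_sum p (v : nat -> R^o) (i : 'I_p.+1) : R :=
  if i == 0%N :> nat then - \sum_(j < p) v j.+1 else v i.

Lemma zero_sum_lift p v (j : 'I_p) : zero_sum v (lift ord0 j) = v j.+1.
Proof. by rewrite /zero_sum lift0. Qed.

Lemma zero_sum_sum p v : \sum_i @zero_sum p v i = 0.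
Proof. by rewrite big_ord_recl /zero_sum/= addNr. Qed.

Lemma zero_sum_lin p (c : R) (x y : nat -> R^o) i :
  @zero_sum p (c *: x + y) i = c * zero_sum x i + zero_sum y i.
Proof.
rewrite /zero_sum; case: ifP => // _.
by rewrite big_split/= -mulr_sumr opprD mulrN.
Qed.

Definition unit_weight (k : nat) : nat -> R^o := fun i => (i == k)%:R.

(** The latest increment comes first, so that its residual is taken with respect
    to the earlier ones. *)
Fixpoint unit_weights (k : nat) : seq (nat -> R^o) :=
  if k is k'.+1 then unit_weight k :: unit_weights k' else [::].

Lemma resid_unit_weights (b : (nat -> R^o) -> (nat -> R^o) -> R) k y i :
  (k < i)%N -> resid b (unit_weights k) y i = y i.
Proof.
elim: k y i => //= k IH y i ki.
rewrite !fctE IH ?(ltnW ki)// (_ : resid b _ _ i = 0) ?scaler0 ?subr0//.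
by rewrite IH ?(ltnW ki)// /unit_weight gtn_eqF.
Qed.

Lemma fbm_formDl n (t a1 a2 c : 'I_n -> R) k :
  fbm_form alpha t (fun i => k * a1 i + a2 i) c =
  k * fbm_form alpha t a1 c + fbm_form alpha t a2 c.
Proof.
rewrite /fbm_form mulrCA -mulrDr; congr (_ * _).
rewrite mulr_sumr -big_split; apply: eq_bigr => i _.
rewrite mulr_sumr -big_split; apply: eq_bigr => j _ /=; ring.
Qed.

Lemma fbm_formC n (t a c : 'I_n -> R) : fbm_form alpha t a c = fbm_form alpha t c a.
Proof.
rewrite /fbm_form exchange_big/=; congr (_ * _).
apply: eq_bigr => i _; apply: eq_bigr => j _.
by rewrite distrC (mulrC (a j)).
Qed.

(** The increments [B (t i) - B (t 0)] are combinations with unit weights; a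
    residual of the [i]-th one keeps the weight 1 at [t i] and has no weight at
    later times. Local nondeterminism then bounds its variance from below by
    [c * delta ^ (2 alpha)], where [delta = (\sum_j |t i - t j| ^ (- alpha)) ^
    (- 1 / alpha)] is at most the distance of [t i] to every earlier time. *)
Lemma fbm_small_ball : {C : R | 0 < C & forall p (t : nat -> R) (r : R), 0 < r ->
  (forall i, (i <= p)%N -> 0 <= t i <= 1) ->
  (forall i j, (i < j <= p)%N -> t i != t j) ->
  (P [set w | forall i, (i < p)%N -> (`|B (t i.+1) w - B (t 0%N) w| <= r)%R] <=
   ((C * r) ^+ p *
    \prod_(i < p) \sum_(j < i.+1) `|t i.+1 - t j| `^ (- alpha))%:E)%E}.
Proof.
have al0 : 0 < alpha by case/andP: alpha01.
have [c c0 Hc] := fbm_form_ge alpha01.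
exists (expR (2^-1) / Num.sqrt c); first by rewrite divr_gt0 ?expR_gt0 ?sqrtr_gt0.
move=> p t r r0 t01 tne.
pose tt (i : 'I_p.+1) := t i.
pose L (v : nat -> R^o) (w : T) := r^-1 * \sum_i zero_sum v i * B (tt i) w.
pose b (u v : nat -> R^o) := (r ^+ 2)^-1 * fbm_form alpha tt (zero_sum (p := p) u) (zero_sum v).
have L_lin k x y w : L (k *: x + y) w = k * L x w + L y w.
  rewrite /L mulrCA -mulrDr; congr (_ * _); rewrite mulr_sumr -big_split.
  by apply: eq_bigr => i _; rewrite zero_sum_lin /= mulrDl mulrA.
have L_meas x : measurable_fun setT (L x).
  apply: measurable_funM => //.
  by apply: measurable_sum => i; exact: measurable_funM.
have b_lin k x y z : b (k *: x + y) z = k * b x z + b y z.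
  rewrite /b (_ : zero_sum (k *: x + y) = fun i => k * zero_sum x i + zero_sum y i).
    by rewrite fbm_formDl; ring.
  by apply/funext => i; exact: zero_sum_lin.
have b_sym x y : b x y = b y x by rewrite /b fbm_formC.
have tt01 i : 0 <= tt i <= 1 by apply: t01; rewrite -ltnS.
have L_char x : \int[P]_w cos (L x w) = expR (- (b x x / 2)).
  pose a i := r^-1 * @zero_sum p x i.
  have a0 : \sum_i a i = 0 by rewrite /a -mulr_sumr zero_sum_sum mulr0.
  have := fbm_char tt01 a0.
  have -> : fbm_form alpha tt a a = b x x.
    rewrite /b /fbm_form mulrCA; congr (_ * _); rewrite mulr_sumr; apply: eq_bigr => i _.
    rewrite mulr_sumr; apply: eq_bigr => j _; rewrite /a -exprVn; ring.
  move=> <-; apply: eq_Rintegral => w _; rewrite /L /a mulr_sumr.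
  by congr cos; apply: eq_bigr => i _; rewrite mulrA.
pose S k := \sum_(j < k.+1) `|t k.+1 - t j| `^ (- alpha).
have S0 k : (k < p)%N -> 0 < S k.
  move=> kp; rewrite /S big_ord_recl/= ltr_pwDl ?powR_gt0 ?normr_gt0 ?subr_eq0//.
    by rewrite eq_sym tne// kp.
  by apply: sumr_ge0 => j _; exact: powR_ge0.
have Hv k : (k < p)%N -> c * (S k) ^- 2 / r ^+ 2 <=
    resid_var b (unit_weights k) (unit_weight k.+1).
  move=> kp; rewrite /resid_var /b (mulrC (_ ^-1)) ler_wpM2r ?invr_ge0 ?sqr_ge0//.
  pose i0 : 'I_p.+1 := Ordinal (n := p.+1) (m := k.+1) kp.
  pose delta := (S k) `^ (- alpha^-1).
  have d0 : 0 < delta by rewrite powR_gt0 ?S0.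
  have -> : S k ^- 2 = delta `^ (2 * alpha).
    rewrite /delta -powRrM mulNr mulrCA mulVf ?gt_eqF// mulr1 powRN.
    by rewrite powR_mulrn// ltW ?S0.
  apply: (Hc _ tt _ i0) => //.
  - exact: zero_sum_sum.
  - by rewrite /zero_sum/= resid_unit_weights// /unit_weight eqxx.
  - move=> j ji0 aj.
    have jk : (j < k.+1)%N.
      rewrite ltnNge; apply: contra aj => kj.
      have {}kj : (k.+1 < j)%N by rewrite ltn_neqAle kj andbT eq_sym; exact: ji0.
      rewrite /zero_sum gtn_eqF ?(leq_ltn_trans _ kj)//.
      by rewrite resid_unit_weights ?(ltnW kj)// /unit_weight gtn_eqF.
    have tj : 0 < `|t k.+1 - t j|.
      by rewrite normr_gt0 subr_eq0 eq_sym tne// jk.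
    rewrite /tt /= distrC.
    have : `|t k.+1 - t j| `^ (- alpha) <= S k.
      rewrite /S (bigD1 (Ordinal jk))//= lerDl; apply: sumr_ge0 => l _; exact: powR_ge0.
    move=> h.
    have tE : `|t k.+1 - t j| = ((`|t k.+1 - t j| `^ (- alpha)) `^ alpha^-1)^-1.
      by rewrite -powRrM mulNr divff ?(lt0r_neq0 al0)// powRN powRr1 ?(ltW tj)// invrK.
    rewrite /delta powRN [leRHS]tE lef_pV2 ?posrE ?powR_gt0 ?S0//.
    by rewrite ge0_ler_powR ?nnegrE ?powR_ge0 ?invr_ge0 ?(ltW al0)// ltW ?S0.
have Hpos k : (k <= p)%N -> pivots_gt0 b (unit_weights k).
  elim: k => //= k IH kp; split; last exact: IH (ltnW kp).
  apply: lt_le_trans (Hv _ kp); rewrite divr_gt0 ?exprn_gt0//.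
  by rewrite divr_gt0 ?exprn_gt0 ?S0.
have Hpiv k : (k <= p)%N -> inv_pivots b (unit_weights k) <=
    (r / Num.sqrt c) ^+ k * \prod_(i < k) S i.
  elim: k => [|k IH] kp /=; first by rewrite big_ord0 expr0 mul1r.
  set Q := r / Num.sqrt c.
  have QS0 : 0 < Q * S k by rewrite !mulr_gt0 ?S0 ?invr_gt0 ?sqrtr_gt0.
  have v0 : 0 < resid_var b (unit_weights k) (unit_weight k.+1) by have [] := Hpos _ kp.
  have hu : (Num.sqrt (resid_var b (unit_weights k) (unit_weight k.+1)))^-1 <= Q * S k.
    rewrite -[leRHS]invrK lef_pV2 ?posrE ?sqrtr_gt0 ?invr_gt0//.
    rewrite -[leLHS]gtr0_norm ?invr_gt0// -sqrtr_sqr ler_wsqrtr//.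
    apply: le_trans (Hv _ kp); rewrite /Q exprVn !exprMn exprVn sqr_sqrtr ?(ltW c0)//.
    rewrite le_eqVlt; apply/orP; left; apply/eqP; field.
    by rewrite !gt_eqF ?S0.
  have -> : Q ^+ k.+1 * \prod_(i < k.+1) S i = Q * S k * (Q ^+ k * \prod_(i < k) S i).
    by rewrite big_ord_recr/= exprS; ring.
  rewrite ler_pM ?invr_ge0 ?sqrtr_ge0 ?inv_pivots_ge0//.
  exact: IH (ltnW kp).
have := gaussian_small_ball_le L_lin L_meas b_lin b_sym L_char (Hpos p (leqnn p)).
have -> : [set w | all (fun x => `|L x w| <= 1) (unit_weights p)] =
   [set w | forall i, (i < p)%N -> `|B (t i.+1) w - B (t 0%N) w| <= r].
  have LE i w : (i < p)%N -> L (unit_weight i.+1) w = r^-1 * (B (t i.+1) w - B (t 0%N) w).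
    move=> ip; rewrite /L big_ord_recl /=; congr (_ * _).
    have -> : zero_sum (p := p) (unit_weight i.+1) ord0 = -1 :> R.
      rewrite /zero_sum/= (bigD1 (Ordinal ip))//= big1 ?addr0 /unit_weight ?eqxx// => j ji.
      by rewrite eqSS; case: eqP => // E; move: ji; rewrite -val_eqE/= E eqxx.
    rewrite (bigD1 (Ordinal ip))//= big1 ?addr0; last first.
      move=> j ji; rewrite zero_sum_lift /unit_weight eqSS.
      by case: eqP => [E|]; [move: ji; rewrite -val_eqE/= E eqxx|rewrite mul0r].
    by rewrite zero_sum_lift /unit_weight eqxx mul1r mulN1r addrC /tt lift0.
  have aux k w : all (fun x => `|L x w| <= 1) (unit_weights k) <->
     forall i, (i < k)%N -> `|L (unit_weight i.+1) w| <= 1.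
    elim: k => [|k IH] /=; first by split.
    split=> [/andP[h1 /IH h2] i|H].
      by rewrite ltnS leq_eqVlt => /predU1P[->|/h2].
    by rewrite H//=; apply/IH => i ik; apply: H; rewrite ltnS ltnW.
  have nE i w : (i < p)%N -> (`|L (unit_weight i.+1) w| <= 1) =
      (`|B (t i.+1) w - B (t 0%N) w| <= r).
    by move=> ip; rewrite LE// normrM gtr0_norm ?invr_gt0// mulrC ler_pdivrMr// mul1r.
  apply/seteqP; split => w /=.
    by move=> /aux H i ip; rewrite -nE// H.
  by move=> H; apply/aux => i ip; rewrite nE// H.
move=> H; apply: (le_trans H); rewrite lee_fin.
have -> : size (unit_weights p) = p by elim: (p) => //= k ->.
apply: (le_trans (ler_wpM2l (expR_ge0 _) (Hpiv p (leqnn p)))).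
rewrite mulrA (_ : expR (p%:R / 2) = expR 2^-1 ^+ p); last by rewrite -expRM_natl.
rewrite -exprMn le_eqVlt; apply/orP; left; apply/eqP.
by congr (_ ^+ _ * _); ring.
Qed.

End fbm_gaussian.

(** * Tuples of codes *)

Section distinct_tuples.
Context (R : realType) (alpha : R) (G : seq nat).

(** Tuples grow at the right end, so that a product of interactions of each
    entry with the earlier ones can be summed one entry at a time. *)
Fixpoint distinct_tuples (m : nat) (k0 : nat) : seq (seq nat) :=
  if m is m'.+1 then
    [seq rcons h k | h <- distinct_tuples m' k0, k <- [seq k <- G | k \notin h]]
  else [:: [:: k0]].

Lemma distinct_tuplesP m k0 h : k0 \in G -> h \in distinct_tuples m k0 ->
  [/\ size h = m.+1, uniq h, {subset h <= G} & nth 0%N h 0 = k0].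
Proof.
move=> k0G; elim: m h => [|m IH] h /=.
  by rewrite inE => /eqP ->; split => // k; rewrite inE => /eqP ->.
move=> /allpairsPdep[h' [k [h'in]]]; rewrite mem_filter => /andP[kh' kG] ->.
have [sz un sub h0] := IH _ h'in; split.
- by rewrite size_rcons sz.
- by rewrite rcons_uniq kh' un.
- by move=> j; rewrite mem_rcons inE => /predU1P[->//|/sub].
- by rewrite nth_rcons sz.
Qed.

Definition tuple_weight (h : seq nat) : R :=
  \prod_(i < (size h).-1) \sum_(j < i.+1)
    `|(nth 0%N h i.+1)%:R - (nth 0%N h j)%:R| `^ (- alpha).

Lemma tuple_weight_ge0 h : 0 <= tuple_weight h.
Proof. by apply: prodr_ge0 => i _; apply: sumr_ge0 => j _; exact: powR_ge0. Qed.

Lemma tuple_weight_rcons h k : h != [::] ->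
  tuple_weight (rcons h k) =
  tuple_weight h * \sum_(j <- h) `|k%:R - j%:R| `^ (- alpha).
Proof.
case: h => // x h _; rewrite /tuple_weight size_rcons /= big_ord_recr /=; congr (_ * _).
  apply: eq_bigr => i _; apply: eq_bigr => j _.
  by rewrite !nth_rcons ltn_ord -rcons_cons !nth_rcons /= ltnS (leq_trans (ltnW (ltn_ord j)))// ltn_ord.
rewrite (big_nth 0%N) big_mkord; apply: eq_bigr => j _.
by rewrite /= nth_rcons ltnn eqxx -rcons_cons nth_rcons /= ltn_ord.
Qed.

(** The sum over the last entry is at most [m M], the energy bound [M] being
    applied to each of the earlier entries. *)
Lemma sum_tuple_weight_le (M : R) m k0 : k0 \in G -> 0 <= M ->
  (forall j, j \in G -> \sum_(k <- G | k != j) `|k%:R - j%:R| `^ (- alpha) <= M) ->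
  \sum_(h <- distinct_tuples m k0) tuple_weight h <= (m%:R * M) ^+ m.
Proof.
move=> k0G M0 HM.
have H : \sum_(h <- distinct_tuples m k0) tuple_weight h <= \prod_(i < m) (i.+1%:R * M).
  elim: m => [|m IH] /=.
    by rewrite big_seq1 /tuple_weight /= !big_ord0.
  rewrite big_allpairs_dep /= big_ord_recr /=.
  apply: (@le_trans _ _ (\sum_(h <- distinct_tuples m k0) tuple_weight h * (m.+1%:R * M))).
    rewrite big_seq [leRHS]big_seq; apply: ler_sum => h hin.
    have [sz un sub h0] := distinct_tuplesP k0G hin.
    have hn : h != [::] by rewrite -size_eq0 sz.
    under eq_bigr do rewrite tuple_weight_rcons//.
    rewrite -mulr_sumr ler_wpM2l ?tuple_weight_ge0//.
    rewrite exchange_big /=.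
    apply: (@le_trans _ _ (\sum_(j <- h) M)); last by rewrite big_const_seq count_predT sz iter_addr_0 mulr_natl.
    rewrite big_seq [leRHS]big_seq; apply: ler_sum => j jh.
    apply: le_trans (HM j (sub _ jh)); rewrite big_filter big_mkcond [leRHS]big_mkcond /=.
    apply: ler_sum => k _; case: ifPn => kh; case: ifPn => // kj.
    by move: kj; rewrite negbK => /eqP kj; move: kh; rewrite kj jh.
  by rewrite -mulr_suml ler_wpM2r// mulr_ge0.
apply: (le_trans H); rewrite -[X in _ ^+ X]card_ord -prodr_const.
apply: ler_prod => i _; rewrite mulr_ge0//= ler_wpM2r// ler_nat.
exact: ltn_ord.
Qed.

(** At each of the [m] steps at most [m] codes are already in use. *)
Lemma count_distinct_tuples_ge (Q : pred nat) m k0 : k0 \in G -> Q k0 -> uniq G ->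
  ((count Q G - m) ^ m <= count (all Q) (distinct_tuples m k0))%N.
Proof.
move=> k0G Qk0 uG.
have H m' : (m' <= m)%N ->
    ((count Q G - m) ^ m' <= count (all Q) (distinct_tuples m' k0))%N.
  elim: m' => [|m' IH] m'm /=; first by rewrite Qk0.
  rewrite expnSr (leq_trans (leq_mul (IH (ltnW m'm)) (leqnn _)))//.
  rewrite count_flatten sumnE !big_map.
  rewrite -sum1_count big_distrl/= big_mkcond/= big_seq [leqRHS]big_seq.
  apply: leq_sum => h hin; case: ifP => // Qh; rewrite mul1n.
  have [sz un sub h0] := distinct_tuplesP k0G hin.
  rewrite count_map count_filter leq_subLR.
  have E : count (predI (preim (rcons h) (all Q)) (fun k => k \notin h)) G =
           count (fun k => Q k && (k \notin h)) G.
    by apply: eq_count => k /=; rewrite all_rcons Qh andbT.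
  rewrite E.
  have -> : count Q G = (count (fun k => Q k && (k \in h)) G +
       count (fun k => Q k && (k \notin h)) G)%N.
    rewrite -[LHS]size_filter -(count_predC (mem h)) !count_filter.
    by congr (_ + _)%N; apply: eq_count => k /=; rewrite andbC.
  rewrite leq_add2r (leq_trans _ m'm)// -sz.
  rewrite (@leq_trans (count (mem h) G))//.
    by apply: sub_count => k /= /andP[].
  rewrite -size_filter uniq_leq_size ?filter_uniq// => k.
  by rewrite mem_filter => /andP[].
exact: H.
Qed.

End distinct_tuples.

(** * Almost surely, few codes have close images *)

Section borel_cantelli.
Context (R : realType) d (T : measurableType d) (P : probability T R).

Lemma union_bound (F : nat -> set T) (r : seq nat) : (forall k, measurable (F k)) ->
  (P (\big[setU/set0]_(k <- r) F k) <= \sum_(k <- r) P (F k))%E.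
Proof.
move=> mF; elim: r => [|k r IH]; first by rewrite !big_nil measure0.
rewrite !big_cons; apply: (le_trans (measureU2 _ _ _)) => //.
  exact: bigsetU_measurable.
by rewrite leeD2l.
Qed.

(** Borel-Cantelli for events of geometrically small probability. *)
Lemma eventually_not (E : nat -> set T) (C : R) (n0 : nat) :
  (forall n, measurable (E n)) ->
  (forall n, (n0 <= n)%N -> (P (E n) <= (C / 2 ^+ n)%:E)%E) ->
  {ae P, forall w, exists N, forall n, (N <= n)%N -> ~ E n w}.
Proof.
move=> mE HE; pose F n := E (n + n0)%N.
have C0 : 0 <= C.
  have := le_trans (measure_ge0 P (E n0)) (HE n0 (leqnn _)).
  by rewrite lee_fin pmulr_lge0// invr_gt0 exprn_gt0.
have S : (\sum_(n <oo) P (F n) < +oo)%E.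
  have C20 : 0 <= 2 * C by rewrite mulr_ge0.
  apply: (@le_lt_trans _ _ (2 * C)%:E); last by rewrite ltry.
  apply: le_trans (epsilon_trick0 xpredT C20).
  apply: lee_nneseries => // n _; apply: (le_trans (HE _ (leq_addl _ _))).
  rewrite lee_fin natrX exprS invfM mulrACA divff ?pnatr_eq0// mul1r.
  rewrite ler_wpM2l// lef_pV2 ?posrE ?exprn_gt0//.
  by rewrite ler_weXn2l// ?ler1n// leq_addr.
have mF n : measurable (F n) by exact: mE.
have L0 := lim_sup_set_cvg0 mF S.
exists (lim_sup_set F); split => //.
  by rewrite /lim_sup_set; apply: bigcapT_measurable => n; apply: bigcup_measurable.
move=> w /= H n _; apply: contrapT => Hn; apply: H.
exists (n + n0)%N => k nk Ek; apply: Hn.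
exists (k - n0)%N => /=; first by rewrite leq_subRL ?(leq_trans (leq_addl _ _) nk)// addnC.
by rewrite /F subnK// (leq_trans (leq_addl _ _) nk).
Qed.

End borel_cantelli.

Section powers_of_two.
Context (R : realType).

Lemma powR2N_lt1 (a : R) : 0 < a -> 0 < (2 `^ (- a) : R) < 1.
Proof.
move=> a0; rewrite powR_gt0//= /powR pnatr_eq0/= expR_lt1 mulNr oppr_lt0.
by rewrite mulr_gt0// ln_gt0// ltr1n.
Qed.

Lemma sqr_le_pow2 (e : R) : 0 < e -> {C : R | 0 < C & forall n : nat,
  n.+1%:R ^+ 2 <= C * 2 `^ (e * n%:R)}.
Proof.
move=> e0; have l2 : 0 < ln (2 : R) by rewrite ln_gt0// ltr1n.
pose c := e * ln (2 : R); have c0 : 0 < c by rewrite mulr_gt0.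
exists (2 + 4 / c ^+ 2); first by rewrite addr_gt0// divr_gt0// exprn_gt0.
move=> n; rewrite /powR pnatr_eq0/=.
have -> : e * n%:R * ln 2 = c * n%:R by rewrite /c; ring.
have x0 : 0 <= c * n%:R by rewrite mulr_ge0 ?(ltW c0).
have := expR_ge1Dxn 1 x0; rewrite (_ : 2`! = 2%N)// => h1.
have h0 : 1 <= expR (c * n%:R) by rewrite -[leLHS]expR0 ler_expR.
have -> : n.+1%:R ^+ 2 = 1 + 2 * n%:R + n%:R ^+ 2 :> R by rewrite -natr1; ring.
have h2 : n%:R ^+ 2 <= 2 / c ^+ 2 * expR (c * n%:R).
  rewrite mulrAC ler_pdivlMr ?exprn_gt0//.
  rewrite -exprMn (mulrC n%:R); move: h1; lra.
have -> : (2 + 4 / c ^+ 2) * expR (c * n%:R) =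
  2 * expR (c * n%:R) + 2 * (2 / c ^+ 2 * expR (c * n%:R)) by ring.
have := sqr_ge0 (n%:R - 1 : R); move: h2 h0; move: (expR _) (_ / _ * _) => E D; nra.
Qed.

End powers_of_two.

Definition dyad {R : realType} (n k : nat) : R := k%:R / 2 ^+ n.

Section clusters.
Context (R : realType) d (T : measurableType d) (P : probability T R).
Context (alpha : R) (B : R -> {RV P >-> R}).
Hypothesis alpha01 : 0 < alpha < 1.
Hypothesis hB : fractional_brownian_motion alpha `[0%R, 1%R] B.

Lemma dyad01 n k : (k <= 2 ^ n)%N -> 0 <= (dyad n k : R) <= 1.
Proof.
move=> k2; rewrite /dyad divr_ge0 ?exprn_ge0//= ler_pdivrMr ?exprn_gt0//.
by rewrite mul1r -natrX ler_nat.
Qed.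

Lemma dyad_eq n k l : (dyad n k == dyad n l :> R) = (k == l).
Proof.
rewrite /dyad; apply/eqP/eqP => [|->//] /(mulIf _) H.
by apply/eqP; rewrite -(eqr_nat R); apply/eqP; apply: H; rewrite invr_neq0// expf_neq0.
Qed.

Definition close_codes n (r : R) (k0 : nat) (w : T) : pred nat :=
  fun k => `|B (dyad n k) w - B (dyad n k0) w| <= r.

Lemma measurable_close n r k0 k : measurable [set w | close_codes n r k0 w k].
Proof.
have mn : measurable_fun setT (fun w => `|B (dyad n k) w - B (dyad n k0) w|).
  by apply: measurableT_comp => //; exact: measurable_funB.
have := mn measurableT `]-oo, r]%classic (measurable_itv _).
by rewrite setTI; congr (measurable _).
Qed.

Lemma measurable_cluster n r k0 G (x : R) :
  measurable [set w | x < (count (close_codes n r k0 w) G)%:R].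
Proof.
have mc : measurable_fun setT
    (fun w => \sum_(k <- G) \1_[set w | close_codes n r k0 w k] w : R).
  by apply: measurable_sum => k; apply: measurable_indic; exact: measurable_close.
have := mc measurableT `]x, +oo[%classic (measurable_itv _).
rewrite setTI; congr (measurable _); apply/seteqP.
have E w : (count (close_codes n r k0 w) G)%:R =
    \sum_(k <- G) \1_[set w | close_codes n r k0 w k] w :> R.
  rewrite -sum1_count natr_sum big_mkcond/=; apply: eq_bigr => k _.
  rewrite indicE; case: ifPn => h; first by rewrite mem_set.
  by rewrite memNset//= ; apply/negP.
by split => w /=; rewrite in_itv/= andbT E.
Qed.

(** Moment method: a code with more than [x] close codes produces at least
    [(x / 2) ^ m] tuples, and the expected number of these is controlled by
    the small ball estimate. *)
Lemma cluster_prob_le : {C : R | 0 < C & forall n (G : seq nat) k0 m (r M x : R),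
  uniq G -> (forall k, k \in G -> (k <= 2 ^ n)%N) -> k0 \in G ->
  0 < r -> 0 <= M -> 0 < x ->
  (forall j, j \in G -> \sum_(k <- G | k != j) `|k%:R - j%:R| `^ (- alpha) <= M) ->
  m%:R * 2 <= x ->
  (P [set w | (x < (count (close_codes n r k0 w) G)%:R)%R] <=
   ((C * (r * 2 `^ (alpha * n%:R)) * m%:R * M / x) ^+ m)%:E)%E}.
Proof.
have [C C0 HC] := fbm_small_ball alpha01 hB.
exists (2 * C); first by rewrite mulr_gt0.
move=> n G k0 m r M x uG G2 k0G r0 M0 x0 HM mx.
set E := [set w | _].
have mE : measurable E by exact: measurable_cluster.
set s := r * 2 `^ (alpha * n%:R).
pose tp := distinct_tuples G m k0.
pose A h := [set w | forall i, (i < m)%N ->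
  `|B (dyad n (nth 0%N h i.+1)) w - B (dyad n (nth 0%N h 0)) w| <= r].
have mA h : measurable (A h).
  have -> : A h = \bigcap_i (if (i < m)%N then
      [set w | close_codes n r (nth 0%N h 0) w (nth 0%N h i.+1)] else setT).
    apply/seteqP; split=> [w Aw i _|w Aw i im]; first by case: ifPn => // /Aw.
    by have := Aw i I; rewrite im.
  apply: bigcapT_measurable => i; case: ifP => // _; exact: measurable_close.
have PA h : h \in tp -> (P (A h) <= ((C * s) ^+ m * tuple_weight alpha h)%:E)%E.
  move=> hin; have [sz un sub h0] := distinct_tuplesP k0G hin.
  have := HC m (fun i => dyad n (nth 0%N h i)) r r0.
  move=> /(_ _ _)/le_trans -> //.
  - move=> i im; apply: dyad01; apply: G2; apply: sub.
    by rewrite mem_nth// sz ltnS.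
  - move=> i j /andP[ij jm]; rewrite dyad_eq nth_uniq ?sz//.
      by rewrite ltn_eqF.
    by rewrite ltnS (leq_trans (ltnW ij)).
  - rewrite lee_fin /tuple_weight sz /= /s !exprMn -!mulrA.
    rewrite ler_wpM2l ?exprn_ge0 ?(ltW C0)// ler_wpM2l ?exprn_ge0 ?(ltW r0)//.
    rewrite -[X in _ ^+ X](card_ord m) -prodr_const -big_split/=.
    rewrite le_eqVlt; apply/orP; left; apply/eqP; apply: eq_bigr => i _.
    rewrite mulr_sumr; apply: eq_bigr => j _.
    rewrite /dyad -mulrBl normrM normfV (gtr0_norm (exprn_gt0 _ _))//.
    rewrite powRM ?invr_ge0 ?exprn_ge0// mulrC; congr (_ * _).
    rewrite -powR_inv1 ?exprn_ge0// -powR_mulrn// -!powRrM; congr (_ `^ _); ring.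
have key w : E w -> (x / 2) ^+ m <= \sum_(h <- tp) \1_(A h) w.
  move=> Ew; set Q := close_codes n r k0 w.
  have Qk0 : Q k0 by rewrite /Q /close_codes subrr normr0 ltW.
  have := count_distinct_tuples_ge m k0G Qk0 uG.
  rewrite -(ler_nat R) natrX => H.
  apply: (@le_trans _ _ ((count Q G - m)%N%:R ^+ m)).
    rewrite lerXn2r ?nnegrE//; first by rewrite divr_ge0 ?(ltW x0).
    have xN : x < (count Q G)%:R by exact: Ew.
    rewrite natrB; first by move: mx xN; lra.
    by rewrite -(ler_nat R); move: mx xN; have : 0 <= (m%:R : R) by []; lra.
  apply: (le_trans H); rewrite -sum1_count natr_sum big_mkcond/=.
  rewrite big_seq [leRHS]big_seq; apply: ler_sum => h hin.
  case: ifPn => // Qh; rewrite indicE mem_set//= => i im.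
  have [sz un sub h0] := distinct_tuplesP k0G hin.
  rewrite h0; have /allP := Qh; apply.
  by rewrite mem_nth// sz ltnS.
have x2 : 0 < (x / 2) ^+ m by rewrite exprn_gt0// divr_gt0.
have H : (((x / 2) ^+ m)%:E * P E <= \sum_(h <- tp) P (A h))%E.
  have -> : P E = (\int[P]_w (\1_E w)%:E)%E by rewrite integral_indic// setIT.
  rewrite -ge0_integralZl//; last 2 first.
  - by apply/measurable_EFinP; exact: measurable_indic.
  - by rewrite lee_fin ltW.
  have -> : (\sum_(h <- tp) P (A h) = \int[P]_w (\sum_(h <- tp) (\1_(A h) w)%:E))%E.
    rewrite ge0_integral_sum//.
      by apply: eq_bigr => h _; rewrite integral_indic// setIT.
    by move=> h; apply/measurable_EFinP; exact: measurable_indic.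
  apply: ge0_le_integral => //.
  - by move=> w _; rewrite mule_ge0// lee_fin// ltW.
  - apply: emeasurable_funM => //; apply/measurable_EFinP; exact: measurable_indic.
  - by apply: emeasurable_sum => h; apply/measurable_EFinP; exact: measurable_indic.
  - move=> w _; rewrite -EFinM sumEFin lee_fin indicE.
    have [/set_mem Ew|] := boolP (w \in E); first by rewrite mulr1 key.
    by move=> _; rewrite mulr0; apply: sumr_ge0.
have s0 : 0 < s by rewrite mulr_gt0 ?powR_gt0.
have H2 : (\sum_(h <- tp) P (A h) <= ((C * s) ^+ m * (m%:R * M) ^+ m)%:E)%E.
  apply: (@le_trans _ _ (\sum_(h <- tp) ((C * s) ^+ m * tuple_weight alpha h)%:E)%E).
    by rewrite big_seq [leRHS]big_seq; apply: lee_sum => h /PA.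
  have Cs0 : 0 <= C * s by rewrite mulr_ge0 ?ltW.
  rewrite sumEFin lee_fin -mulr_sumr ler_wpM2l ?exprn_ge0//.
  exact: sum_tuple_weight_le.
have := le_trans H H2; rewrite -lee_pdivlMl// -EFinM => /le_trans; apply.
rewrite lee_fin -exprVn -!exprMn le_eqVlt; apply/orP; left; apply/eqP; congr (_ ^+ _).
by field; rewrite gt_eqF.
Qed.

(** Ahlfors-type upper regularity, up to the factor [n.+1]. *)
Definition regular_codes (s C : R) (G : nat -> seq nat) := forall n l j, (l <= n)%N ->
  (count (fun k => `|k%:R - j%:R| <= 2 ^+ l :> R) (G n))%:R
    <= C * n.+1%:R * 2 `^ (s * l%:R).

(** Decomposition into the shells [2 ^ l < |k - j| <= 2 ^ l.+1], each of which
    contributes at most about [C n 2 ^ ((s - alpha) l)]. *)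
Lemma regular_energy_le s C (G : nat -> seq nat) n j : alpha <= s -> 0 < C ->
  regular_codes s C G -> (forall k, k \in G n -> (k <= 2 ^ n)%N) -> j \in G n ->
  \sum_(k <- G n | k != j) `|k%:R - j%:R| `^ (- alpha) <=
  2 * C * n.+1%:R ^+ 2 * 2 `^ ((s - alpha) * n%:R).
Proof.
have /andP[al0 al1] := alpha01.
move=> als C0 rG G2 jG.
pose I l k : R := (`|k%:R - j%:R| <= 2 ^+ l :> R)%:R.
have H k : k \in G n -> k != j -> `|k%:R - j%:R| `^ (- alpha) <=
    \sum_(l < n.+1) 2 * 2 `^ (- alpha * l%:R) * I l k.
  move=> kG kj.
  have d1 : 1 <= `|k%:R - j%:R| :> R.
    rewrite ler_normr; apply/orP; have [kj'|kj'|E] := ltngtP k j; last by rewrite E eqxx in kj.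
      by right; move: kj'; rewrite -(ler_nat R) -natr1; lra.
    by left; move: kj'; rewrite -(ler_nat R) -natr1; lra.
  have d2 : exists l, `|k%:R - j%:R| <= 2 ^+ l :> R.
    exists n; rewrite ler_norml; have := G2 _ kG; have := G2 _ jG.
    rewrite -!(ler_nat R) !natrX => h1 h2; have := ler0n R k; have := ler0n R j; lra.
  have dn : `|k%:R - j%:R| <= 2 ^+ n :> R.
    rewrite ler_norml; have := G2 _ kG; have := G2 _ jG.
    rewrite -!(ler_nat R) !natrX => h1 h2; have := ler0n R k; have := ler0n R j; lra.
  have [l hl lmin] := ex_minnP d2.
  have ln1 : (l < n.+1)%N by rewrite ltnS lmin.
  apply: (@le_trans _ _ (2 * 2 `^ (- alpha * l%:R) * I l k)); last first.
    rewrite (bigD1 (Ordinal ln1))//= lerDl; apply: sumr_ge0 => i _.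
    by rewrite !mulr_ge0 ?powR_ge0// /I.
  rewrite /I hl mulr1.
  have d0 : 0 < `|k%:R - j%:R| :> R by rewrite (lt_le_trans ltr01).
  case: l hl lmin ln1 => [|l] hl lmin ln1.
    rewrite mulr0 powRr0 mulr1 powRN (@le_trans _ _ 1)// ?ler1n//.
    by rewrite invf_le1 ?powR_gt0// -[leLHS](powRr0 `|k%:R - j%:R|) ler_powR// ltW.
  have dl : 2 ^+ l < `|k%:R - j%:R| :> R.
    by rewrite ltNge; apply/negP => /lmin; rewrite ltnn.
  apply: (@le_trans _ _ ((2 ^+ l) `^ (- alpha))).
    by rewrite !powRN lef_pV2 ?posrE ?powR_gt0 ?exprn_gt0// ge0_ler_powR ?nnegrE ?exprn_ge0 ?ltW.
  have lE : - alpha * l.+1%:R = l%:R * - alpha + - alpha by rewrite -(natr1 l); ring.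
  rewrite lE powRD ?pnatr_eq0 ?implybT// -powR_mulrn// -powRrM.
  rewrite mulrCA ler_peMr ?powR_ge0// powRN.
  by rewrite ler_pdivlMr ?powR_gt0// mul1r -[leRHS]powRr1// ler_powR// ?ler1n// ltW.
apply: (@le_trans _ _ (\sum_(k <- G n) \sum_(l < n.+1) 2 * 2 `^ (- alpha * l%:R) * I l k)).
  rewrite big_mkcond big_seq [leRHS]big_seq; apply: ler_sum => k kG.
  case: ifP => kj; first exact: H.
  by apply: sumr_ge0 => l _; rewrite !mulr_ge0 ?powR_ge0// /I.
rewrite exchange_big /=.
apply: (@le_trans _ _ (\sum_(l < n.+1) 2 * C * n.+1%:R * 2 `^ ((s - alpha) * n%:R))).
  apply: ler_sum => l _; rewrite -mulr_sumr.
  have -> : \sum_(k <- G n) I l k = (count (fun k => `|k%:R - j%:R| <= 2 ^+ l :> R) (G n))%:R.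
    rewrite -sum1_count natr_sum [RHS]big_mkcond/=.
    by apply: eq_bigr => k _; rewrite /I; case: ifP.
  have ln1 : (l <= n)%N by rewrite -ltnS.
  apply: (le_trans (ler_wpM2l _ (rG n l j ln1))); first by rewrite mulr_ge0 ?powR_ge0.
  have -> : 2 * 2 `^ (- alpha * l%:R) * (C * n.+1%:R * 2 `^ (s * l%:R)) =
     2 * C * n.+1%:R * 2 `^ ((s - alpha) * l%:R).
    rewrite mulrBl powRD ?pnatr_eq0 ?implybT// -mulNr; ring.
  rewrite ler_wpM2l ?mulr_ge0 ?(ltW C0)// ler_powR ?ler1n//.
  by rewrite ler_wpM2l ?subr_ge0// ler_nat.
rewrite sumr_const card_ord -[leLHS]mulr_natr le_eqVlt; apply/orP; left; apply/eqP; ring.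
Qed.

(** A moment of order [m >= 2 / e] makes the probability of a large cluster around
    a given code of order [4 ^ (- n)], which beats the number of codes. *)
Lemma ae_small_clusters (e K Cg : R) (G : nat -> seq nat) :
  0 < e -> 0 < K -> 0 < Cg ->
  (forall n, uniq (G n)) -> (forall n k, k \in G n -> (k <= 2 ^ n)%N) ->
  regular_codes (alpha + e) Cg G ->
  {ae P, forall w, exists N, forall n, (N <= n)%N -> forall k0, k0 \in G n ->
    (count (close_codes n (K * 2 `^ (- (alpha - e) * n%:R)) k0 w) (G n))%:R
      <= 2 `^ (4 * e * n%:R) :> R}.
Proof.
move=> e0 K0 Cg0 uG G2 rG.
have [C C0 HC] := cluster_prob_le.
have [D D0 HD] := sqr_le_pow2 e0.
pose m := (Num.truncn (2 / e)).+1.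
have em : 2 <= e * m%:R.
  have := truncnS_gt (2 / e); rewrite -/m ltr_pdivrMr// mulrC => /ltW; exact.
pose C1 := C * K * m%:R * (2 * Cg) * D.
have C10 : 0 < C1 by rewrite !mulr_gt0// ltr0n.
pose r n := K * 2 `^ (- (alpha - e) * n%:R).
have r0 n : 0 < r n by rewrite mulr_gt0 ?powR_gt0.
pose E n := \big[setU/set0]_(k0 <- G n)
  [set w | 2 `^ (4 * e * n%:R) < (count (close_codes n (r n) k0 w) (G n))%:R].
have mE n : measurable (E n).
  by apply: bigsetU_measurable => k0 _; exact: measurable_cluster.
have n0P : exists n0, forall n, (n0 <= n)%N -> m%:R * 2 <= 2 `^ (4 * e * n%:R) :> R.
  exists (Num.truncn (m%:R * 2 / (4 * e * ln 2))).+1 => n nn.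
  have l2 : 0 < ln (2 : R) by rewrite ln_gt0// ltr1n.
  have p0 : 0 < 4 * e * ln 2 by rewrite !mulr_gt0.
  have := truncnS_gt (m%:R * 2 / (4 * e * ln 2)); rewrite ltr_pdivrMr// => h1.
  rewrite /powR pnatr_eq0/=; apply: le_trans (expR_ge1Dx _).
  have h2 : (Num.truncn (m%:R * 2 / (4 * e * ln 2))).+1%:R * (4 * e * ln 2) <=
      n%:R * (4 * e * ln 2) by rewrite ler_wpM2r ?(ltW p0)// ler_nat.
  have -> : 4 * e * n%:R * ln 2 = n%:R * (4 * e * ln 2) by ring.
  move: (ltW h1) h2; lra.
have [n0 Hn0] := n0P.
have HE n : (n0 <= n)%N -> (P (E n) <= ((2 * C1 ^+ m) / 2 ^+ n)%:E)%E.
  move=> nn0.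
  apply: (@le_trans _ _ (\sum_(k0 <- G n) (C1 ^+ m / 4 ^+ n)%:E)%E).
    apply: (@le_trans _ _ (\sum_(k0 <- G n) P [set w |
      (2 `^ (4 * e * n%:R) < (count (close_codes n (r n) k0 w) (G n))%:R)%R])%E).
      by apply: union_bound => k0; exact: measurable_cluster.
    rewrite big_seq [leRHS]big_seq; apply: lee_sum => k0 k0G.
    pose M := 2 * Cg * n.+1%:R ^+ 2 * 2 `^ (e * n%:R).
    have M0 : 0 <= M by rewrite !mulr_ge0 ?powR_ge0 ?ltW.
    have HM j : j \in G n -> \sum_(k <- G n | k != j) `|k%:R - j%:R| `^ (- alpha) <= M.
      move=> jG; have := @regular_energy_le (alpha + e) Cg G n j.
      rewrite addrAC subrr add0r; apply => //; first by rewrite lerDl ltW.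
      exact: G2.
    apply: (le_trans (HC n (G n) k0 m (r n) M (2 `^ (4 * e * n%:R)) (uG n) (G2 n) k0G
       (r0 n) M0 (powR_gt0 _ (ltr0n _ 2)) HM (Hn0 n nn0))).
    have x0 : 0 < 2 `^ (4 * e * n%:R) :> R by rewrite powR_gt0.
    rewrite lee_fin; set y := _ / 2 `^ (4 * e * n%:R).
    have y0 : 0 <= y.
      by rewrite divr_ge0 ?(ltW x0)// !mulr_ge0 ?powR_ge0 ?(ltW C0) ?(ltW K0)// ltW.
    have yle : y <= C1 * 2 `^ (- e * n%:R).
      pose p : R := 2 `^ (e * n%:R); have p0 : 0 < p by rewrite powR_gt0.
      have p4 : 2 `^ (4 * e * n%:R) = p ^+ 4 :> R.
        by rewrite -powR_mulrn ?powR_ge0// -powRrM; congr (_ `^ _); ring.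
      have rE : r n * 2 `^ (alpha * n%:R) = K * p.
        rewrite /r -mulrA -powRD ?pnatr_eq0 ?implybT//; congr (_ * _ `^ _); ring.
      rewrite mulNr powRN -/p /y rE p4 /M -/p /C1.
      pose q := C * K * m%:R * (2 * Cg) / p ^+ 2.
      have q0 : 0 <= q by rewrite divr_ge0 ?exprn_ge0 ?(ltW p0)// !mulr_ge0 ?ltW.
      have -> : C * (K * p) * m%:R * (2 * Cg * n.+1%:R ^+ 2 * p) / p ^+ 4
        = q * n.+1%:R ^+ 2 by rewrite /q; field; rewrite gt_eqF.
      have -> : C * K * m%:R * (2 * Cg) * D / p = q * (D * p).
        by rewrite /q; field; rewrite gt_eqF.
      by rewrite ler_wpM2l// HD.
    apply: (@le_trans _ _ ((C1 * 2 `^ (- e * n%:R)) ^+ m)).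
      by rewrite lerXn2r ?nnegrE// mulr_ge0 ?powR_ge0// ltW.
    rewrite exprMn ler_wpM2l ?exprn_ge0 ?(ltW C10)//.
    rewrite -powR_mulrn ?powR_ge0// -powRrM.
    have -> : (4 : R) = 2 ^+ 2 by rewrite -natrX.
    rewrite -exprM -powR_mulrn// -powRN ler_powR ?ler1n//.
    rewrite !mulNr lerN2 natrM mulrAC ler_wpM2r//.
  rewrite sumEFin lee_fin big_const_seq count_predT iter_addr_0 -[leLHS]mulr_natr.
  have sG : (size (G n) <= 2 ^ n + 1)%N.
    rewrite -(size_iota 0 (2 ^ n + 1)) uniq_leq_size// => k /G2.
    by rewrite mem_iota add0n addn1 ltnS.
  have sG' : (size (G n))%:R <= 2 * 2 ^+ n :> R.
    rewrite -natrX -natrM ler_nat (leq_trans sG)// mul2n -addnn leq_add2l.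
    by rewrite expn_gt0.
  have n20 : 0 < 2 ^+ n :> R by rewrite exprn_gt0.
  have -> : (4 : R) ^+ n = 2 ^+ n * 2 ^+ n by rewrite -exprMn -natrM.
  apply: (le_trans (ler_wpM2l _ sG')).
    by rewrite divr_ge0 ?mulr_ge0 ?exprn_ge0 ?(ltW C10).
  by rewrite le_eqVlt; apply/orP; left; apply/eqP; field; rewrite gt_eqF.
apply: filterS (eventually_not mE HE) => w [N HN].
exists N => n Nn k0 k0G; rewrite leNgt; apply/negP => H.
by apply: (HN n Nn); rewrite /E (big_rem k0)//=; left.
Qed.

End clusters.

(** * Modulus of continuity along dyadic points *)

Section dyadic_chaining.
Context (R : realType).

Definition dyad_code (n : nat) (t : R) : nat := Num.truncn (2 ^+ n * t).

Lemma dyad_code_bounds n t : 0 <= t ->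
  dyad n (dyad_code n t) <= t < dyad n (dyad_code n t).+1.
Proof.
move=> t0; have p0 : 0 < 2 ^+ n :> R by rewrite exprn_gt0.
have x0 : 0 <= 2 ^+ n * t by rewrite mulr_ge0// ltW.
rewrite /dyad ler_pdivrMr// ltr_pdivlMr// (mulrC t).
by rewrite truncn_le x0 truncnS_gt.
Qed.

Lemma dyad_code_le n t : 0 <= t <= 1 -> (dyad_code n t <= 2 ^ n)%N.
Proof.
move=> /andP[t0 t1]; have /andP[h _] := dyad_code_bounds n t0.
have := le_trans h t1; rewrite /dyad ler_pdivrMr ?exprn_gt0// mul1r.
by rewrite -natrX ler_nat.
Qed.

Lemma dyad_codeS n t : 0 <= t ->
  dyad_code n.+1 t = (dyad_code n t).*2 \/ dyad_code n.+1 t = (dyad_code n t).*2.+1.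
Proof.
move=> t0; have p0 : 0 < 2 ^+ n :> R by rewrite exprn_gt0.
have x0 : 0 <= 2 ^+ n * t by rewrite mulr_ge0// ltW.
have x1 : 0 <= 2 ^+ n.+1 * t by rewrite mulr_ge0// exprn_ge0.
rewrite /dyad_code; set a := Num.truncn _; set b := Num.truncn _.
have a1 : a%:R <= 2 ^+ n.+1 * t by rewrite truncn_le.
have a2 : 2 ^+ n.+1 * t < a.+1%:R by exact: truncnS_gt.
have b1 : b%:R <= 2 ^+ n * t by rewrite truncn_le.
have b2 : 2 ^+ n * t < b.+1%:R by exact: truncnS_gt.
have h1 : (b.*2 < a.+1)%N.
  rewrite -(ltr_nat R) (le_lt_trans _ a2)// -mul2n natrM exprS -mulrA ler_wpM2l//.
have h2 : (a < b.+1.*2)%N.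
  rewrite -(ltr_nat R) (le_lt_trans a1)// -mul2n natrM exprS -mulrA ltr_pM2l//.
lia.
Qed.

Lemma dyad_double n k : dyad n.+1 k.*2 = dyad n k :> R.
Proof.
rewrite /dyad exprS -mul2n natrM invfM mulrACA divff ?mul1r// pnatr_eq0//.
Qed.

(** The point [t] is the limit of its dyadic approximations, and consecutive
    approximations are equal or adjacent; the increments form a geometric series. *)
Lemma chaining_bound (f : R -> R) (b : R) (N : nat) : 0 < b ->
  {within `[0%R, 1%R], continuous f} ->
  (forall n k, (N <= n)%N -> (k < 2 ^ n)%N ->
     `|f (dyad n k.+1) - f (dyad n k)| <= 2 `^ (- b * n%:R)) ->
  forall n t, (N <= n)%N -> 0 <= t <= 1 ->
  `|f t - f (dyad n (dyad_code n t))| <= (1 - 2 `^ (- b))^-1 * 2 `^ (- b * n%:R).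
Proof.
move=> b0 cf Hf n t Nn t01; have /andP[t0 t1] := t01.
pose q : R := 2 `^ (- b).
have /andP[q0 q1] : 0 < q < 1 by exact: powR2N_lt1.
have qE m : 2 `^ (- b * m%:R) = q ^+ m by rewrite powRrM powR_mulrn// ltW.
pose fl m : R := dyad m (dyad_code m t).
have fl01 m : 0 <= fl m <= 1 by apply: dyad01; exact: dyad_code_le.
have step m : (N <= m.+1)%N -> `|f (fl m.+1) - f (fl m)| <= q ^+ m.+1.
  move=> Nm; rewrite /fl; have [->|E] := dyad_codeS m t0.
    by rewrite dyad_double subrr normr0 exprn_ge0// ltW.
  have := dyad_code_le m.+1 t01; rewrite E => kb.
  by rewrite -(dyad_double m) -qE; exact: Hf.
pose K := (1 - q)^-1.
have K0 : 0 < K by rewrite invr_gt0 subr_gt0.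
have Kq : K * (1 - q) = 1 by rewrite mulVf// gt_eqF// subr_gt0.
have chain j : `|f (fl (n + j)%N) - f (fl n)| <= K * (1 - q ^+ j) * q ^+ n.
  elim: j => [|j IH]; first by rewrite addn0 expr0 !subrr mulr0 mul0r normr0.
  have st := step (n + j)%N (leq_trans Nn (leqW (leq_addr _ _))).
  rewrite -addnS in st.
  have -> : f (fl (n + j.+1)%N) - f (fl n) =
    (f (fl (n + j.+1)%N) - f (fl (n + j)%N)) + (f (fl (n + j)%N) - f (fl n)) by ring.
  apply: (le_trans (ler_normD _ _)); apply: (le_trans (lerD st IH)).
  have -> : K * (1 - q ^+ j.+1) * q ^+ n = K * (1 - q) * q ^+ j * q ^+ n + K * (1 - q ^+ j) * q ^+ n.
    by rewrite exprS; ring.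
  rewrite lerD2r Kq mul1r -exprD addnS exprS addnC ler_piMl ?exprn_ge0 ?ltW//.
rewrite qE -/q -/K; apply/ler_addgt0Pr => eta eta0.
have := (subspace_continuousP _ _).1 cf t; rewrite /= in_itv/= t01 => /(_ isT).
move=> /cvgrPdist_lt/(_ _ eta0); rewrite near_withinE => /nbhs_ballP[de/= de0 Hde].
have [j jde] : exists j, (2 ^+ (n + j))^-1 < de.
  exists (Num.truncn de^-1).+1; rewrite invf_plt ?posrE ?exprn_gt0//.
  apply: (lt_le_trans (truncnS_gt _)); rewrite -natrX ler_nat.
  by rewrite (leq_trans _ (ltnW (ltn_expl _ (ltnSn 1))))// leq_addl.
have flt : `|t - fl (n + j)%N| < de.
  apply: le_lt_trans jde; have /andP[h1 h2] := dyad_code_bounds (n + j) t0.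
  rewrite ger0_norm ?subr_ge0// lerBlDl; apply: (le_trans (ltW h2)).
  by rewrite /fl /dyad -natr1 mulrDl mul1r.
have fj : `|f t - f (fl (n + j)%N)| < eta.
  by apply: Hde => //=; rewrite in_itv/=; exact: fl01.
have -> : f t - f (fl n) = (f (fl (n + j)%N) - f (fl n)) + (f t - f (fl (n + j)%N)) by ring.
apply: (le_trans (ler_normD _ _)); apply: lerD; last exact: ltW.
apply: (le_trans (chain j)); rewrite ler_wpM2r ?exprn_ge0 ?(ltW q0)//.
by rewrite ler_piMr ?(ltW K0)// lerBlDr lerDl exprn_ge0// ltW.
Qed.

End dyadic_chaining.

Section fbm_modulus.
Context (R : realType) d (T : measurableType d) (P : probability T R).
Context (alpha : R) (B : R -> {RV P >-> R}).
Hypothesis hB : fractional_brownian_motion alpha `[0%R, 1%R] B.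

Lemma expRN_le_fact (y : R) m : 0 < y -> expR (- y) <= m.+1`!%:R / y ^+ m.+1.
Proof.
move=> y0; have := expR_ge1Dxn m (ltW y0); rewrite expRN => h.
have f0 : 0 < m.+1`!%:R :> R by rewrite ltr0n fact_gt0.
rewrite -[leRHS]invf_div lef_pV2 ?posrE ?expR_gt0 ?divr_gt0 ?exprn_gt0//.
by apply: le_trans h; rewrite lerDr.
Qed.

(** The tail [exp (- 4 ^ (e n) / 4)] is bounded by a power [4 ^ (- n)], which is
    enough for the union of the [2 ^ n] dyadic increments of level [n]. *)
Lemma ae_modulus (e : R) : 0 < e < alpha ->
  {ae P, forall w, exists N, forall n t, (N <= n)%N -> 0 <= t <= 1 ->
    `|B t w - B (dyad n (dyad_code n t)) w| <=
    (1 - 2 `^ (- (alpha - e)))^-1 * 2 `^ (- (alpha - e) * n%:R)}.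
Proof.
move=> /andP[e0 ea].
have [C C0 HC] := fbm_increment_tail hB.
pose m := Num.truncn e^-1.
have em : 1 <= e * m.+1%:R.
  have := truncnS_gt e^-1; rewrite -/m -[X in X < _]mul1r ltr_pdivrMr// mulrC => /ltW; exact.
pose F n k := [set w | 2 `^ (- (alpha - e) * n%:R) < `|B (dyad n k.+1) w - B (dyad n k) w|].
have mF n k : measurable (F n k).
  have mn : measurable_fun setT (fun w => `|B (dyad n k.+1) w - B (dyad n k) w|).
    by apply: measurableT_comp => //; exact: measurable_funB.
  have := mn measurableT `]2 `^ (- (alpha - e) * n%:R), +oo[%classic (measurable_itv _).
  rewrite setTI; congr (measurable _); apply/seteqP.
  by split => w /=; rewrite in_itv/= andbT.
pose E n := \big[setU/set0]_(k <- iota 0 (2 ^ n)) F n k.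
have mE n : measurable (E n) by apply: bigsetU_measurable.
pose C1 := C * (m.+1`!%:R * 4 ^+ m.+1).
have HE n : (0 <= n)%N -> (P (E n) <= (C1 / 2 ^+ n)%:E)%E.
  move=> _; apply: (le_trans (union_bound _ _ (mF n))).
  have p0 : 0 < 2 ^+ n :> R by rewrite exprn_gt0.
  apply: (@le_trans _ _ (\sum_(k <- iota 0 (2 ^ n)) (C1 / 4 ^+ n)%:E)%E).
    rewrite big_seq [leRHS]big_seq; apply: lee_sum => k.
    rewrite mem_iota add0n => /andP[_ k2].
    have d1 : 0 <= (dyad n k : R) by case/andP: (@dyad01 R n k (ltnW k2)).
    have d2 : dyad n k.+1 <= 1 :> R by case/andP: (@dyad01 R n k.+1 k2).
    have dd : dyad n k.+1 - dyad n k = (2 ^+ n)^-1 :> R.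
      by rewrite /dyad -mulrBl -natr1 addrAC subrr add0r mul1r.
    have d12 : dyad n k < dyad n k.+1 :> R by rewrite -subr_gt0 dd invr_gt0.
    have l0 : 0 <= 2 `^ (e * n%:R) :> R by exact: powR_ge0.
    have := HC _ _ _ d1 d12 d2 l0; rewrite dd.
    have -> : 2 `^ (e * n%:R) * ((2 ^+ n)^-1) `^ alpha = 2 `^ (- (alpha - e) * n%:R) :> R.
      rewrite -powR_mulrn// -powRN -powRrM -powRD ?pnatr_eq0 ?implybT//.
      by congr (_ `^ _); ring.
    move=> /le_trans; apply; rewrite lee_fin /C1 -[leRHS]mulrA ler_wpM2l ?(ltW C0)//.
    apply: (le_trans (expRN_le_fact m _)).
      by rewrite divr_gt0// exprn_gt0// powR_gt0.
    rewrite -[leRHS]mulrA ler_wpM2l// expr_div_n invf_div ler_wpM2l ?exprn_ge0//.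
    rewrite lef_pV2 ?posrE ?exprn_gt0 ?powR_gt0//.
    have -> : (2 `^ (e * n%:R) ^+ 2) ^+ m.+1 = 2 `^ (e * m.+1%:R * (2 * n%:R)) :> R.
      rewrite -exprM -[LHS]powR_mulrn ?powR_ge0// -powRrM natrM.
      by congr (_ `^ _); ring.
    have -> : (4 : R) = 2 ^+ 2 by rewrite -natrX.
    rewrite -exprM -powR_mulrn// ler_powR ?ler1n// natrM.
    by rewrite ler_peMl// mulr_ge0.
  rewrite sumEFin lee_fin big_const_seq count_predT iter_addr_0 size_iota -[leLHS]mulr_natr.
  have -> : (4 : R) ^+ n = 2 ^+ n * 2 ^+ n by rewrite -exprMn -natrM.
  by rewrite natrX le_eqVlt; apply/orP; left; apply/eqP; field; rewrite gt_eqF.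
have H1 := eventually_not mE HE.
have H2 := fbm_continuous hB.
apply: filterS2 H1 H2 => w [N HN] cw; exists N.
apply: (chaining_bound _ cw); first by rewrite subr_gt0.
move=> n k Nn k2; rewrite leNgt; apply/negP => H.
apply: (HN n Nn); rewrite /E (big_rem k)//=; last by rewrite mem_iota add0n.
by left.
Qed.

End fbm_modulus.

(** * Regular dyadic covers *)

Section optimal_cover.
Context (R : realType) (s : R).
Hypothesis s0 : 0 < s.

(** The [s]-th power of the length of a dyadic interval of level [n]. *)
Definition dyad_mass (n : nat) : R := 2 `^ (- s * n%:R).

Lemma dyad_mass_gt0 n : 0 < dyad_mass n.
Proof. exact: powR_gt0. Qed.

Lemma dyad_massE n : dyad_mass n = (2 ^- n) `^ s.
Proof.
rewrite /dyad_mass -powR_inv1 ?exprn_ge0// -powR_mulrn// -!powRrM.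
by congr (_ `^ _); ring.
Qed.

Lemma dyad_massB n l : (l <= n)%N -> dyad_mass (n - l) = dyad_mass n * 2 `^ (s * l%:R).
Proof.
move=> ln; rewrite /dyad_mass -powRD ?pnatr_eq0 ?implybT//.
by congr (_ `^ _); rewrite natrB//; ring.
Qed.

Lemma dyad_mass_lt n m : dyad_mass n < dyad_mass m -> (m < n)%N.
Proof.
rewrite ltnNge; apply: contraTN => nm; rewrite -leNgt /dyad_mass ler_powR ?ler1n//.
by rewrite !mulNr lerN2 ler_wpM2l ?(ltW s0)// ler_nat.
Qed.

Lemma dyad_code_anc n l (t : R) : (l <= n)%N -> 0 <= t ->
  dyad_code (n - l) t = (dyad_code n t %/ 2 ^ l)%N.
Proof.
move=> ln t0; elim: l ln => [|l IH] ln; first by rewrite subn0 expn0 divn1.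
rewrite expnSr divnMA -IH ?(ltnW ln)//.
have -> : (n - l)%N = (n - l.+1).+1 by lia.
by have [->|->] := dyad_codeS (n - l.+1) t0; lia.
Qed.

Section minimal_heavy.
Variables (nn kk : nat -> nat).

(** Inclusion of dyadic intervals: the ancestor of the code [k], [l] levels
    up, is [k %/ 2 ^ l]. *)
Definition below (i n k : nat) := (n <= nn i)%N && (kk i %/ 2 ^ (nn i - n) == k)%N.

(** Replacing the given intervals inside [(n, k)] by [(n, k)] itself does not
    increase the total mass. *)
Definition heavy (n k : nat) := exists M : nat,
  dyad_mass n <= \sum_(i < M | below i n k) dyad_mass (nn i).

Definition minimal_heavy (n k : nat) :=
  heavy n k /\ forall l, (0 < l <= n)%N -> ~ heavy (n - l) (k %/ 2 ^ l)%N.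

Definition minimal_codes (n : nat) : seq nat :=
  [seq k <- iota 0 (2 ^ n).+1 | `[< minimal_heavy n k >]].

Lemma heavy_self i : heavy (nn i) (kk i).
Proof.
exists i.+1; rewrite (bigD1 ord_max)/=; last first.
  by rewrite /below leqnn subnn expn0 divn1 eqxx.
by rewrite lerDl; apply: sumr_ge0 => j _; exact: ltW (dyad_mass_gt0 _).
Qed.

Lemma minimal_codes_cover i (t : R) : 0 <= t <= 1 -> dyad_code (nn i) t = kk i ->
  exists n, dyad_code n t \in minimal_codes n.
Proof.
move=> t01 E; have /andP[t0 t1] := t01.
have ex : exists m, `[< heavy m (dyad_code m t) >].
  by exists (nn i); apply/asboolP; rewrite E; exact: heavy_self.
have [m /asboolP hm mmin] := ex_minnP ex.
exists m; rewrite mem_filter mem_iota add0n ltnS dyad_code_le//= andbT.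
apply/asboolP; split => // l /andP[l0 lm] hv.
have := mmin (m - l)%N; rewrite dyad_code_anc//.
by move/asboolP: hv => -> /(_ isT); lia.
Qed.

(** The masses of disjoint heavy intervals inside an interval that is not heavy
    add up to less than the mass of that interval, since they are paid for by
    disjoint families of the given intervals. *)
Lemma count_minimal_codes n l a : (l <= n)%N ->
  (count (fun k => k %/ 2 ^ l == a)%N (minimal_codes n))%:R <= 2 `^ (s * l%:R) :> R.
Proof.
move=> ln; set S := [seq k <- minimal_codes n | (k %/ 2 ^ l == a)%N].
have -> : count (fun k => k %/ 2 ^ l == a)%N (minimal_codes n) = size S.
  by rewrite size_filter.
have uS : uniq S by rewrite filter_uniq// filter_uniq// iota_uniq.
have Sm k : k \in S -> minimal_heavy n k /\ (k %/ 2 ^ l = a)%N.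
  by rewrite mem_filter => /andP[/eqP E]; rewrite mem_filter => /andP[/asboolP].
case: (posnP l) => [l0|l0].
  rewrite l0 mulr0 powRr0 (_ : 1 = 1%:R)// ler_nat.
  rewrite -(size_nseq 1 a) uniq_leq_size// => k /Sm [_].
  by rewrite l0 expn0 divn1 => ->; rewrite inE.
have [->|[k1 k1S]] : S = [::] \/ exists k, k \in S.
- by case: (S) => [|k S']; [left|right; exists k; rewrite mem_head].
- by rewrite powR_ge0.
have nh : ~ heavy (n - l) a.
  by have [[_ H] <-] := Sm _ k1S; apply: H; rewrite l0 ln.
have [Mf HMf] : exists Mf : nat -> nat, forall k, k \in S ->
    dyad_mass n <= \sum_(i < Mf k | below i n k) dyad_mass (nn i).
  have H k : exists M : nat, k \in S ->
      dyad_mass n <= \sum_(i < M | below i n k) dyad_mass (nn i).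
    have [kS|] := boolP (k \in S); last by exists 0%N.
    by have [[[M HM] _] _] := Sm _ kS; exists M.
  by have [Mf HMf] := choice H; exists Mf.
pose M := \max_(k <- S) Mf k.
have HM k : k \in S -> dyad_mass n <= \sum_(i < M) (below i n k)%:R * dyad_mass (nn i).
  move=> kS; apply: (le_trans (HMf _ kS)).
  have MM : (Mf k <= M)%N by rewrite /M (big_rem k)//= leq_maxl.
  rewrite -(big_mkord (fun i => below i n k) (fun i => dyad_mass (nn i))).
  rewrite -(big_mkord xpredT (fun i => (below i n k)%:R * dyad_mass (nn i))).
  rewrite (big_cat_nat (leq0n _) MM)/= big_mkcond/= -[leLHS]addr0 lerD//.
    by apply: ler_sum => i _; case: ifP => _; rewrite ?mul1r ?mul0r.
  by apply: sumr_ge0 => i _; rewrite mulr_ge0// ltW// dyad_mass_gt0.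
have lt : \sum_(i < M | below i (n - l) a) dyad_mass (nn i) < dyad_mass (n - l).
  by rewrite ltNge; apply/negP => h; apply: nh; exists M.
have key : \sum_(k <- S) dyad_mass n <= \sum_(i < M | below i (n - l) a) dyad_mass (nn i).
  apply: (@le_trans _ _ (\sum_(k <- S) \sum_(i < M) (below i n k)%:R * dyad_mass (nn i))).
    by rewrite big_seq [leRHS]big_seq; apply: ler_sum => k /HM.
  rewrite exchange_big /= [leRHS]big_mkcond /=; apply: ler_sum => i _.
  rewrite -mulr_suml.
  have anc k : k \in S -> below i n k -> below i (n - l) a.
    move=> /Sm[_ <-] /andP[ni /eqP <-]; apply/andP; split.
      by rewrite (leq_trans (leq_subr _ _)).
    rewrite -divnMA -expnD; apply/eqP; congr (_ %/ 2 ^ _)%N; lia.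
    (* Intervals of the same level are disjoint. *)
have one : \sum_(k <- S) (below i n k)%:R <= 1 :> R.
    rewrite -natr_sum (_ : 1 = 1%:R)// ler_nat.
    under eq_bigr => k _ do rewrite -[X in nat_of_bool X]andbT.
    rewrite -big_mkcond/= sum1_count.
    apply: (@leq_trans (count_mem (kk i %/ 2 ^ (nn i - n))%N S)).
      by apply: sub_count => k /= /andP[/andP[_ /eqP ->]] _.
    by rewrite count_uniq_mem// leq_b1.
  case: ifP => h.
    by rewrite -[leRHS]mul1r ler_wpM2r// ltW// dyad_mass_gt0.
  rewrite big_seq big1 ?mul0r// => k kS.
  by case: (boolP (below i n k)) => // /(anc _ kS); rewrite h.
have := le_lt_trans key lt; rewrite dyad_massB// big_const_seq count_predT iter_addr_0.
rewrite -[X in X < _]mulr_natl mulrC ltr_pM2l ?dyad_mass_gt0//; exact: ltW.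
Qed.

(** A cover of small total mass has no heavy interval of low level. *)
Lemma minimal_codes_level (j : nat) n k :
  (forall M, \sum_(i < M) dyad_mass (nn i) < dyad_mass j) ->
  k \in minimal_codes n -> (j < n)%N.
Proof.
move=> H; rewrite mem_filter => /andP[/asboolP[[M HM] _] _].
apply: dyad_mass_lt; apply: (le_lt_trans HM); apply: le_lt_trans (H M).
rewrite big_mkcond/=; apply: ler_sum => i _; case: ifP => // _.
exact: ltW (dyad_mass_gt0 _).
Qed.

End minimal_heavy.

(** For each [j], the minimal heavy intervals of a cover of total mass less than
    [2 ^ (- s j)] have levels larger than [j] and still cover [D]. The union over
    all [j] meets level [n] only for [j < n], whence the factor [n.+1]; the factor
    3 accounts for the dyadic intervals of length [2 ^ l] that meet an interval of
    length [2 * 2 ^ l]. *)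
Lemma regular_cover (D : set R) : D `<=` `[0%R, 1%R] ->
  (forall eta, 0 < eta -> exists nn kk : nat -> nat,
     (forall t, D t -> exists i, dyad_code (nn i) t = kk i) /\
     (forall M, \sum_(i < M) dyad_mass (nn i) < eta)) ->
  exists G : nat -> seq nat, [/\ forall n, uniq (G n),
    forall n k, k \in G n -> (k <= 2 ^ n)%N,
    regular_codes s 3 G &
    forall t, D t -> forall N, exists2 n, (N <= n)%N & dyad_code n t \in G n].
Proof.
move=> D01 H.
have [nk Hnk] : exists nk : nat -> (nat -> nat) * (nat -> nat), forall j,
    (forall t, D t -> exists i, dyad_code ((nk j).1 i) t = (nk j).2 i) /\
    (forall M, \sum_(i < M) dyad_mass ((nk j).1 i) < dyad_mass j).
  have H' j : exists p : (nat -> nat) * (nat -> nat),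
     (forall t, D t -> exists i, dyad_code (p.1 i) t = p.2 i) /\
     (forall M, \sum_(i < M) dyad_mass (p.1 i) < dyad_mass j).
    by have [nn [kk Hk]] := H _ (dyad_mass_gt0 j); exists (nn, kk).
  by have [f Hf] := choice H'; exists f.
pose Gj j := minimal_codes (nk j).1 (nk j).2.
exists (fun n => [seq k <- iota 0 (2 ^ n).+1 | has (fun j => k \in Gj j n) (iota 0 n)]).
split.
- by move=> n; rewrite filter_uniq// iota_uniq.
- by move=> n k; rewrite mem_filter mem_iota => /andP[_ /andP[_]]; rewrite add0n ltnS.
- move=> n l j0 ln; rewrite count_filter.
  set S := iota 0 (2 ^ n).+1.
  pose a := (j0 %/ 2 ^ l)%N.
  pose Q k := `|k%:R - j0%:R| <= 2 ^+ l :> R.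
  have Qa k : Q k -> [|| (k %/ 2 ^ l == a)%N, (k %/ 2 ^ l == a.-1)%N | (k %/ 2 ^ l == a.+1)%N].
    rewrite /Q ler_distl => /andP[h1 h2].
    have {}h1 : (j0 <= k + 2 ^ l)%N.
      by rewrite -(ler_nat R) natrD natrX -lerBlDr.
    have {}h2 : (k <= j0 + 2 ^ l)%N by rewrite -(ler_nat R) natrD natrX.
    have p0 : (0 < 2 ^ l)%N by rewrite expn_gt0.
    have g1 : (a <= k %/ 2 ^ l + 1)%N.
      by rewrite addnC -divnMDl// mul1n addnC; exact: leq_div2r.
    have g2 : (k %/ 2 ^ l <= a + 1)%N.
      by rewrite addnC -divnMDl// mul1n addnC; exact: leq_div2r.
    move: g1 g2; move: (k %/ _)%N a => b c; lia.
  have cnt j a' : count (fun k => (k %/ 2 ^ l == a')%N && (k \in Gj j n)) S =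
      count (fun k => k %/ 2 ^ l == a')%N (Gj j n).
    rewrite /Gj /minimal_codes -/S !count_filter; apply: eq_in_count => k kS.
    by rewrite [k \in _]mem_filter kS andbT.
  have bnd j : (count (fun k => Q k && (k \in Gj j n)) S)%:R <= 3 * 2 `^ (s * l%:R) :> R.
    have c1 a' : (count (fun k => (k %/ 2 ^ l == a')%N && (k \in Gj j n)) S)%:R
        <= 2 `^ (s * l%:R) :> R by rewrite cnt count_minimal_codes.
    apply: (@le_trans _ _ (
      (count (fun k => (k %/ 2 ^ l == a)%N && (k \in Gj j n)) S)%:R +
      (count (fun k => (k %/ 2 ^ l == a.-1)%N && (k \in Gj j n)) S)%:R +
      (count (fun k => (k %/ 2 ^ l == a.+1)%N && (k \in Gj j n)) S)%:R)).
      rewrite -!natrD ler_nat.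
      rewrite -!sum1_count big_mkcond [X in (_ <= X + _ + _)%N]big_mkcond.
      rewrite [X in (_ <= _ + X + _)%N]big_mkcond [X in (_ <= _ + X)%N]big_mkcond.
      rewrite -!big_split/=; apply: leq_sum => k _.
      case: (boolP (Q k)) => //= /Qa; case: (k \in Gj j n); rewrite ?andbT ?andbF//.
      by case/or3P => ->; rewrite ?addn1 ?add1n ?addnS.
    have := c1 a; have := c1 a.-1; have := c1 a.+1; lra.
  apply: (@le_trans _ _ (\sum_(j <- iota 0 n) (count (fun k => Q k && (k \in Gj j n)) S)%:R)).
    rewrite -natr_sum ler_nat.
    under eq_bigr do rewrite -sum1_count big_mkcond.
    rewrite exchange_big -[leqLHS]sum1_count [leqLHS]big_mkcond; apply: leq_sum => k _ /=.
    case: ifP => // /andP[Qk /hasP[j jin kj]].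
    by rewrite (big_rem j)//= /Q Qk kj.
  apply: (@le_trans _ _ (\sum_(j <- iota 0 n) 3 * 2 `^ (s * l%:R))).
    by apply: ler_sum => j _; exact: bnd.
  rewrite big_const_seq count_predT size_iota iter_addr_0 -[leLHS]mulr_natr mulrAC.
  rewrite ler_wpM2r ?powR_ge0// ler_wpM2l// ler_nat//.
- move=> t Dt N; have t01 : 0 <= t <= 1 by have := D01 t Dt; rewrite /= in_itv.
  have [H1 H2] := Hnk N; have [i Ei] := H1 t Dt.
  have [n nin] := minimal_codes_cover t01 Ei.
  have Nn := minimal_codes_level H2 nin.
  exists n; first exact: ltnW.
  rewrite mem_filter mem_iota add0n ltnS dyad_code_le//= andbT.
  by apply/hasP; exists N => //; rewrite mem_iota.
Qed.

End optimal_cover.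

(** * Dyadic covers from the Hausdorff dimension *)

Section hausdorff_codes.
Context (R : realType).
Implicit Types X D : set R.

Lemma diam_ge0 X : (0 <= diam X)%E.
Proof. by apply: ereal_sup_ubound; left. Qed.

Lemma dist_le_diam X x y : X x -> X y -> (`|x - y|%:E <= diam X)%E.
Proof.
by move=> Xx Xy; apply: ereal_sup_ubound; right; exists x => //; exists y.
Qed.

Lemma diam_le X (r : R) : 0 <= r -> (forall x y, X x -> X y -> `|x - y| <= r) ->
  (diam X <= r%:E)%E.
Proof.
move=> r0 H; apply: ge_ereal_sup => _ [->|[x Xx [y Xy <-]]]; rewrite lee_fin//.
exact: H.
Qed.

Lemma diam_set0 : diam (@set0 R) = 0%E.
Proof. by apply/eqP; rewrite eq_le diam_ge0 andbT; apply: diam_le. Qed.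

Lemma powR_le_powR (r a b : R) : 0 <= r <= 1 -> 0 < b -> a <= b -> r `^ b <= r `^ a.
Proof.
move=> /andP[r0 r1] b0 ab; move: r0; rewrite le_eqVlt => /predU1P[<-|r0].
  by rewrite powR0 ?gt_eqF// powR_ge0.
rewrite /powR gt_eqF// ler_expR -subr_ge0 -mulrBl mulr_le0//.
  by rewrite subr_le0.
by rewrite ln_le0.
Qed.

Lemma hausdorff_dim_lt_cover D s : (hausdorff_dim D < s%:E)%E -> 0 < s ->
  forall eta, 0 < eta -> exists (F : nat -> set R) (r : nat -> R),
  [/\ D `<=` \bigcup_i F i, forall i, 0 <= r i <= 1,
      forall i x y, F i x -> F i y -> `|x - y| <= r i &
      forall M, \sum_(i < M) r i `^ s < eta].
Proof.
move=> /ereal_inf_lt[_ [s1 [s10 H0] <-]]; rewrite lte_fin => s1s s0 eta eta0.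
have : (hausdorff_premeasure s1 1%R D < eta%:E)%E.
  rewrite (@le_lt_trans _ _ 0%E) ?lte_fin// -H0.
  by apply: ereal_sup_ubound; exists 1 => //=; exact: ltr01.
move=> /ereal_inf_lt[_ [F [DF dF] <-]] HF.
have fF i : diam (F i) \is a fin_num.
  by rewrite ge0_fin_numE ?diam_ge0// (le_lt_trans (dF i)) ?ltry.
have r01 i : 0 <= fine (diam (F i)) <= 1.
  by rewrite -!lee_fin fineK// diam_ge0/=.
exists F, (fun i => fine (diam (F i))); split => //.
- by move=> i x y Fx Fy; rewrite -lee_fin fineK//; exact: dist_le_diam.
- move=> M; rewrite -lte_fin; apply: le_lt_trans HF.
  apply: le_trans (nneseries_lim_ge M _); last by move=> *; exact: poweR_ge0.
  rewrite -(big_mkord xpredT (fun i => fine (diam (F i)) `^ s)) -sumEFin.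
  rewrite [leRHS]big_mkcond/=; apply: lee_sum => i _.
  case: ifPn => [_|/negPn/eqP ->].
    by rewrite -[in leRHS](fineK (fF i)) poweR_EFin lee_fin powR_le_powR// ltW.
  by rewrite diam_set0/= powR0// gt_eqF.
Qed.

Lemma dyadic_scale (b : R) : 0 < b <= 1 ->
  exists n : nat, b <= 2 ^- n /\ 2 ^- n <= 2 * b.
Proof.
move=> /andP[b0 b1].
have ex : exists n : nat, 2 ^- n <= 2 * b.
  exists (Num.truncn b^-1); rewrite -[leRHS]invrK lef_pV2 ?posrE ?exprn_gt0 ?invr_gt0 ?mulr_gt0//.
  rewrite invfM (@le_trans _ _ b^-1)//.
    by rewrite ler_piMl ?invr_ge0 ?ltW// invf_lt1// ltr1n.
  apply: ltW; apply: (lt_le_trans (truncnS_gt _)); rewrite -natrX ler_nat.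
  exact: ltn_expl.
have [n hn nmin] := ex_minnP ex; exists n; split => //.
case: n hn nmin => [|n] hn nmin; first by rewrite expr0 invr1.
rewrite leNgt; apply/negP => h.
suff : 2 ^- n <= 2 * b by move=> /nmin; rewrite ltnn.
have -> : 2 ^- n = 2 * 2 ^- n.+1 :> R.
  by rewrite exprS invfM mulrA divff ?mul1r// pnatr_eq0.
by rewrite ler_pM2l// ltW.
Qed.

Lemma dyad_code_near n (t u : R) : 0 <= t -> 0 <= u -> `|t - u| <= 2 ^- n ->
  (dyad_code n t <= (dyad_code n u).+1)%N.
Proof.
move=> t0 u0 tu; have p0 : 0 < 2 ^+ n :> R by rewrite exprn_gt0.
have x0 : 0 <= 2 ^+ n * t by rewrite mulr_ge0// ltW.
rewrite -ltnS -(ltr_nat R); apply: (@le_lt_trans _ _ (2 ^+ n * t)).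
  by rewrite /dyad_code truncn_le.
apply: (@le_lt_trans _ _ (2 ^+ n * u + 1)).
  rewrite -lerBlDl -mulrBr -ler_pdivlMl// mulr1.
  exact: le_trans (ler_norm _) tu.
by rewrite -[in ltRHS]natr1 ltrD2r; exact: truncnS_gt.
Qed.

(** A set of diameter at most [2 ^ - n] meets at most three adjacent dyadic
    intervals of level [n]. The lengths [rho i] stand in for diameters that are
    too small, such as those of singletons, at a small total cost. *)
Lemma hausdorff_dim_codes D s : D `<=` `[0%R, 1%R] ->
  (hausdorff_dim D < s%:E)%E -> 0 < s ->
  forall eta, 0 < eta -> exists nn kk : nat -> nat,
    (forall t, D t -> exists i, dyad_code (nn i) t = kk i) /\
    (forall M, \sum_(i < M) dyad_mass s (nn i) < eta).
Proof.
move=> D01 HD s0 eta eta0.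
pose c : R := Num.min 1 (eta / (6 * 2 `^ s)).
have S0 : 0 < 2 `^ s :> R by rewrite powR_gt0.
have c0 : 0 < c by rewrite lt_min ltr01 divr_gt0// mulr_gt0.
have c1 : c <= 1 by rewrite ge_min lexx.
have cE : 6 * 2 `^ s * c <= eta.
  by rewrite mulrC -ler_pdivlMr ?mulr_gt0// ge_min lexx orbT.
have [F [r [DF r01 Fr Hr]]] := hausdorff_dim_lt_cover HD s0 c0.
pose rho i : R := (c / 2 ^+ i.+1) `^ s^-1.
have rhob i : 0 < c / 2 ^+ i.+1 <= 1.
  rewrite divr_gt0 ?exprn_gt0//= ler_pdivrMr ?exprn_gt0// mul1r (le_trans c1)//.
  by rewrite exprn_ege1// ler1n.
have rhoE i : rho i `^ s = c / 2 ^+ i.+1.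
  have /andP[h _] := rhob i.
  by rewrite -powRrM mulVf ?gt_eqF// powRr1// ltW.
have rho1 i : 0 < rho i <= 1.
  have /andP[h1 h2] := rhob i; rewrite powR_gt0//=.
  have -> : 1 = 1 `^ s^-1 :> R by rewrite powR1.
  by apply: ge0_ler_powR => //; rewrite ?nnegrE ?invr_ge0 ?ler01 ?(ltW s0) ?(ltW h1).
pose b i := Num.max (r i) (rho i).
have b01 i : 0 < b i <= 1.
  have /andP[_ h1] := r01 i; have /andP[h2 h3] := rho1 i.
  by rewrite lt_max h2 orbT/= ge_max h1 h3.
have [N HN] := choice (fun i => dyadic_scale (b01 i)).
have [x Hx] : exists x : nat -> R, forall i t, (F i `&` D) t -> (F i `&` D) (x i).
  have H i : exists x, forall t, (F i `&` D) t -> (F i `&` D) x.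
    have [[x Fx]|h] := pselect (exists x, (F i `&` D) x); first by exists x.
    by exists 0 => t Ft; exfalso; apply: h; exists t.
  by have [x Hx] := choice H; exists x.
(* The index [3 i + e] stands for the code of [x i] shifted by [e - 1]. *)
exists (fun i => N (i %/ 3)%N),
  (fun i => (dyad_code (N (i %/ 3)%N) (x (i %/ 3)%N) + i %% 3).-1)%N.
split.
- move=> t Dt; have [i _ Fit] := DF _ Dt.
  have [Fix Dx] : (F i `&` D) (x i) by exact: Hx (conj Fit Dt).
  have t0 : 0 <= t by have := D01 _ Dt; rewrite /= in_itv/= => /andP[].
  have x0 : 0 <= x i by have := D01 _ Dx; rewrite /= in_itv/= => /andP[].
  have [bN _] := HN i.
  have d1 : `|t - x i| <= 2 ^- N i.
    by apply: le_trans bN; rewrite le_max (Fr i t (x i)).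
  have d2 : `|x i - t| <= 2 ^- N i by rewrite distrC.
  have h1 := dyad_code_near t0 x0 d1; have h2 := dyad_code_near x0 t0 d2.
  set C := dyad_code _ (x i) in h1 h2; set E := dyad_code _ t in h1 h2.
  have key e : (e < 3)%N -> (C + e).-1 = E ->
      exists i0 : nat, dyad_code (N (i0 %/ 3)%N) t =
        (dyad_code (N (i0 %/ 3)%N) (x (i0 %/ 3)%N) + i0 %% 3).-1.
    move=> e3 h; exists (i * 3 + e)%N.
    by rewrite divnMDl// modnMDl (divn_small e3) (modn_small e3) addn0 -/C -/E h.
  have : [\/ (C + 0).-1 = E, (C + 1).-1 = E | (C + 2).-1 = E].
    have [h|[h|h]] : (C = E.+1 \/ (C = E \/ C.+1 = E))%N by lia.
    - by apply: Or31; lia.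
    - by apply: Or32; lia.
    - by apply: Or33; lia.
  by case; exact: key.
- move=> M.
  have mass i : dyad_mass s (N i) <= 2 `^ s * (r i `^ s + c / 2 ^+ i.+1).
    have [_ h] := HN i; have /andP[bi _] := b01 i.
    rewrite dyad_massE; apply: (@le_trans _ _ ((2 * b i) `^ s)).
      by apply: ge0_ler_powR => //; rewrite ?nnegrE ?invr_ge0 ?exprn_ge0 ?mulr_ge0 ?(ltW s0) ?(ltW bi).
    rewrite powRM ?(ltW bi)// ler_wpM2l ?powR_ge0// -rhoE.
    by rewrite /b; case: (leP (r i) (rho i)) => _; rewrite ?lerDl ?lerDr powR_ge0.
  have sub : \sum_(i < M) dyad_mass s (N (i %/ 3)%N) <= 3 * \sum_(i < M) dyad_mass s (N i).
    have -> : 3 * \sum_(i < M) dyad_mass s (N i) = \sum_(i < 3 * M) dyad_mass s (N (i %/ 3)%N).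
      elim: (M) => [|m IH]; first by rewrite muln0 !big_ord0 mulr0.
      rewrite mulnS addnC !addnS addn0 !big_ord_recr/= -IH.
      have -> : ((3 * m) %/ 3 = m)%N by rewrite mulKn.
      have -> : ((3 * m).+1 %/ 3 = m)%N by lia.
      have -> : ((3 * m).+2 %/ 3 = m)%N by lia.
      by ring.
    have MM : (M <= 3 * M)%N by lia.
    rewrite -(big_mkord xpredT (fun i => dyad_mass s (N (i %/ 3)%N))).
    rewrite -(big_mkord xpredT (fun i => dyad_mass s (N (i %/ 3)%N))).
    rewrite [leRHS](big_cat_nat (leq0n _) MM)/= lerDl.
    by apply: sumr_ge0 => i _; exact: ltW (dyad_mass_gt0 _ _).
  apply: (le_lt_trans sub); apply: lt_le_trans cE.
  have geo : \sum_(i < M) c / 2 ^+ i.+1 <= c.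
    suff -> : \sum_(i < M) c / 2 ^+ i.+1 = c * (1 - 2 ^- M).
      by rewrite ler_piMr// ?ltW// gerBl invr_ge0 exprn_ge0.
    elim: (M) => [|m IH]; first by rewrite big_ord0 expr0 invr1 subrr mulr0.
    rewrite big_ord_recr/= IH exprS invfM.
    by field; rewrite expf_neq0// pnatr_eq0.
  apply: (@le_lt_trans _ _ (3 * (2 `^ s * (\sum_(i < M) r i `^ s + \sum_(i < M) c / 2 ^+ i.+1)))).
    rewrite ler_wpM2l// -big_split/= mulr_sumr; apply: ler_sum => i _; exact: mass.
  have := Hr M; move: geo; move: (\sum_(i < M) _ / _) => u; move: (\sum_(i < M) _) => v.
  move=> uc vc; have -> : 6 * 2 `^ s * c = 3 * (2 `^ s * (c + c)) by ring.
  by rewrite ltr_pM2l// ltr_pM2l// ltr_leD.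
Qed.

End hausdorff_codes.

(** * Hausdorff dimension of limsup sets *)

Section limsup_dimension.
Context (R : realType).
Implicit Types A : set R.

Lemma expr_lt_near (q c eta : R) : 0 < q < 1 -> 0 < c -> 0 < eta ->
  \forall n \near \oo, c * q ^+ n < eta.
Proof.
move=> /andP[q0 q1] c0 eta0.
have q1' : `|q| < 1 by rewrite gtr0_norm.
have := cvg_expr q1'; move=> /cvgrPdist_lt/(_ _ (divr_gt0 eta0 c0)).
apply: filterS => n /=; rewrite sub0r normrN ger0_norm ?exprn_ge0 ?ltW//.
by rewrite ltr_pdivlMr// mulrC.
Qed.

Lemma geometric_tail_le (q : R) N L : 0 < q < 1 ->
  \sum_(n < L) (N <= n)%:R * q ^+ n <= q ^+ N / (1 - q).
Proof.
move=> /andP[q0 q1]; have q1' : 0 < 1 - q by rewrite subr_gt0.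
rewrite ler_pdivlMr//.
suff : (\sum_(n < L) (N <= n)%:R * q ^+ n) * (1 - q) <= q ^+ N - q ^+ (maxn N L).
  by move/le_trans; apply; rewrite gerBl exprn_ge0// ltW.
elim: L => [|L IH]; first by rewrite big_ord0 mul0r maxn0 subrr.
rewrite big_ord_recr/= mulrDl; apply: (le_trans (lerD IH (lexx _))).
case: (leqP N L) => NL.
  have -> : maxn N L.+1 = L.+1 by lia.
  by rewrite mul1r exprS; lra.
have -> : maxn N L.+1 = N by lia.
by rewrite !mul0r addr0.
Qed.

Lemma sum_dyadic_blocks_le (a b : nat -> R) L : (forall m, 0 <= a m) ->
  a 0%N = 0 -> a 1%N = 0 ->
  (forall n, \sum_(k < 2 ^ n.+1) a (2 ^ n.+1 + k)%N <= b n) ->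
  \sum_(m < 2 ^ L.+1) a m <= \sum_(n < L) b n.
Proof.
move=> a0 a00 a10 H; elim: L => [|L IH].
  by rewrite big_ord0 expn1 !big_ord_recr big_ord0/= a00 a10 !addr0.
rewrite big_ord_recr/= expnS mul2n -addnn big_split_ord/=.
by apply: lerD => //; exact: H.
Qed.

Definition dyad_itv n k : set R := [set t | dyad n k <= t <= dyad n k.+1].

Lemma diam_dyad_itv n k : (diam (dyad_itv n k) <= (2 ^- n)%:E)%E.
Proof.
apply: diam_le => [|x y]; first by rewrite invr_ge0 exprn_ge0.
rewrite /dyad_itv/= /dyad -[k.+1]addn1 natrD mulrDl mul1r.
move=> /andP[x1 x2] /andP[y1 y2]; rewrite ler_norml; lra.
Qed.

(** The codes of level [n] are listed in the block [2^(n+1), 2^(n+2)), so that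
    a single sequence runs through the covering intervals of all levels. *)
Definition code_cover (N : nat) (G : nat -> seq nat) (m : nat) : set R :=
  let n := (trunc_log 2 m).-1 in let k := (m - 2 ^ n.+1)%N in
  if [&& (1 < m)%N, (N <= n)%N & k \in G n] then dyad_itv n k else set0.

Lemma code_cover_block N G n k : (k < 2 ^ n.+1)%N ->
  code_cover N G (2 ^ n.+1 + k) =
  if (N <= n)%N && (k \in G n) then dyad_itv n k else set0.
Proof.
move=> k2; rewrite /code_cover.
have p1 : (0 < 2 ^ n)%N by rewrite expn_gt0.
have -> : (1 < 2 ^ n.+1 + k)%N by rewrite expnS; lia.
have -> : trunc_log 2 (2 ^ n.+1 + k) = n.+1.
  by apply: trunc_log_eq => //; rewrite leq_addr/= [ltnRHS]expnS mul2n -addnn ltn_add2l.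
by rewrite /= addKn.
Qed.

(** For every [N], the intervals of levels at least [N] cover [A]; the sum of
    the [sigma]-th powers of their lengths is the tail of a geometric series. *)
Lemma hausdorff_dim_limsup_le A (G : nat -> seq nat) (C beta sigma : R) :
  A `<=` `[0%R, 1%R] -> 0 < C -> beta < sigma -> 0 < sigma ->
  (forall n, (size (G n))%:R <= C * 2 `^ (beta * n%:R)) ->
  (forall t, A t -> forall N, exists2 n, (N <= n)%N & dyad_code n t \in G n) ->
  (hausdorff_dim A <= sigma%:E)%E.
Proof.
move=> A01 C0 bs s0 HC HA; apply: ereal_inf_lbound.
exists sigma => //; split; first exact: ltW.
apply/eqP; rewrite eq_le; apply/andP; split; last first.
  apply: (@le_trans _ _ (hausdorff_premeasure sigma 1%R A)); last first.
    by apply: ereal_sup_ubound; exists 1 => //=; exact: ltr01.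
  apply: le_ereal_inf_tmp => _ [F _ <-]; apply: nneseries_ge0 => n _ _.
  exact: poweR_ge0.
apply: ge_ereal_sup => _ [delta/= delta0 <-].
apply/lee_addgt0Pr => eta eta0; rewrite add0e.
pose q : R := 2 `^ (- (sigma - beta)).
have q01 : 0 < q < 1 by apply: powR2N_lt1; rewrite subr_gt0.
have q1 : 0 < 1 - q by rewrite subr_gt0; case/andP: q01.
have h01 : 0 < (2^-1 : R) < 1 by rewrite invr_gt0 ltr0n/= invf_lt1// ltr1n.
have [N /= [N1 N2]] : exists N, 1 * 2^-1 ^+ N < delta /\ C / (1 - q) * q ^+ N < eta.
  have [N1 _ H1] := expr_lt_near h01 ltr01 delta0.
  have [N2 _ H2] := expr_lt_near q01 (divr_gt0 C0 q1) eta0.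
  by exists (maxn N1 N2); split; [apply: H1|apply: H2] => /=; lia.
have diamF m : (diam (code_cover N G m) <= delta%:E)%E.
  rewrite /code_cover; case: ifP => [/and3P[_ Nn _]|_]; last first.
    by rewrite diam_set0 lee_fin ltW.
  apply: (le_trans (diam_dyad_itv _ _)); rewrite lee_fin.
  apply: le_trans (ltW N1); rewrite mul1r -exprVn ler_wiXn2l// ?invr_ge0// invf_le1//.
  by rewrite ler1n.
apply: ge_ereal_inf.
exists (\sum_(0 <= i <oo | code_cover N G i != set0) (diam (code_cover N G i) `^ sigma))%E.
  exists (code_cover N G) => //; split => // t At.
  have t01 : 0 <= t <= 1 by have := A01 t At; rewrite /= in_itv.
  have /andP[t0 _] := t01.
  have [n Nn nG] := HA t At N; exists (2 ^ n.+1 + dyad_code n t)%N => //.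
  rewrite code_cover_block; last first.
    by rewrite (leq_ltn_trans (dyad_code_le n t01))// ltn_exp2l.
  by rewrite Nn nG/= /dyad_itv/=; have /andP[-> /ltW ->] := dyad_code_bounds n t0.
have fF m : diam (code_cover N G m) \is a fin_num.
  by rewrite ge0_fin_numE ?diam_ge0// (le_lt_trans (diamF m)) ?ltry.
pose a m : R := fine (diam (code_cover N G m)) `^ sigma.
have a0 m : 0 <= a m by exact: powR_ge0.
have aE m : a m = if code_cover N G m == set0 then 0 else a m.
  case: ifPn => // /eqP h; by rewrite /a h diam_set0/= powR0// gt_eqF.
apply: lime_le; first by apply: is_cvg_nneseries => n _ _; exact: poweR_ge0.
apply: nearW => M.
apply: (@le_trans _ _ (\sum_(m < M) a m)%:E).
  rewrite -(big_mkord xpredT a) -sumEFin big_mkcond/=; apply: lee_sum => i _.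
  case: ifPn => _; last by rewrite lee_fin.
  by rewrite -[in leLHS](fineK (fF i)) poweR_EFin.
rewrite lee_fin; apply: (@le_trans _ _ (\sum_(m < 2 ^ M.+1) a m)).
  have MM : (M <= 2 ^ M.+1)%N by rewrite ltnW// (ltn_trans (ltnSn _))// ltn_expl.
  rewrite -(big_mkord xpredT a) -(big_mkord xpredT a) (big_cat_nat (leq0n _) MM)/=.
  by rewrite lerDl sumr_ge0.
pose b n : R := C * ((N <= n)%:R * q ^+ n).
apply: (@le_trans _ _ (\sum_(n < M) b n)); last first.
  rewrite -mulr_sumr; apply: le_trans (ltW N2).
  by rewrite -mulrA ler_wpM2l ?(ltW C0)// mulrC geometric_tail_le.
apply: sum_dyadic_blocks_le => //.
- by rewrite aE /code_cover/= eqxx.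
- by rewrite aE /code_cover/= eqxx.
move=> n; rewrite /b; case: (leqP N n) => Nn; last first.
  rewrite mul0r mulr0 big1// => k _.
  by rewrite aE code_cover_block// leqNgt Nn/= eqxx.
apply: (@le_trans _ _ (\sum_(k < 2 ^ n.+1) (nat_of_ord k \in G n)%:R * 2 `^ (- sigma * n%:R))).
  apply: ler_sum => k _; rewrite aE code_cover_block// Nn/=.
  case: (boolP (nat_of_ord k \in G n)) => kG; last by rewrite eqxx mul0r.
  case: ifPn => _; first by rewrite mul1r powR_ge0.
  rewrite mul1r /a code_cover_block// Nn kG/=.
  rewrite -[leRHS]/(dyad_mass sigma n) dyad_massE.
  apply: ge0_ler_powR; rewrite ?nnegrE ?(ltW s0) ?invr_ge0 ?exprn_ge0//.
    by rewrite fine_ge0// diam_ge0.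
  rewrite -lee_fin fineK ?diam_dyad_itv//.
  by rewrite ge0_fin_numE ?diam_ge0// (le_lt_trans (diam_dyad_itv _ _)) ?ltry.
rewrite -mulr_suml mul1r.
have cnt : \sum_(k < 2 ^ n.+1) (nat_of_ord k \in G n)%:R <= (size (G n))%:R :> R.
  rewrite -natr_sum ler_nat -(big_mkord xpredT (fun k => (k \in G n) : nat)).
  rewrite -big_mkcond/= sum1_count -size_filter.
  apply: uniq_leq_size; first by rewrite filter_uniq// /index_iota iota_uniq.
  by move=> k; rewrite mem_filter => /andP[].
apply: (@le_trans _ _ (C * 2 `^ (beta * n%:R) * 2 `^ (- sigma * n%:R))).
  by rewrite ler_wpM2r ?powR_ge0// (le_trans cnt).
rewrite -mulrA ler_wpM2l ?(ltW C0)// -powRD ?pnatr_eq0 ?implybT//.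
rewrite /q -powR_mulrn ?powR_ge0// -powRrM -mulrDl.
by rewrite (_ : beta + - sigma = - (sigma - beta))//; ring.
Qed.

End limsup_dimension.

(** * Packing dimension and covers of small diameter *)

Section packing.
Context (R : realType).
Implicit Types X : set R.

Lemma covering_number_ge1 X (e : R) : X !=set0 -> (1 <= covering_number e X)%E.
Proof.
move=> [x Xx]; apply: le_ereal_inf_tmp => _ [n [F [XF _]] <-].
by rewrite lee_fin; have [i _ _] := XF x Xx; rewrite ler1n (leq_ltn_trans _ (ltn_ord i)).
Qed.

Lemma at_right0_mem (V : set R) : nbhs (0^'+ : set_system R) V ->
  exists2 r0, 0 < r0 < 1 & forall r, 0 < r < r0 -> V r.
Proof.
rewrite /nbhs/= => /nbhs_ballP[d/= d0 dV].
exists (Num.min d 2^-1).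
  by rewrite lt_min d0 invr_gt0 ltr0n/= gt_min invf_lt1// ltr1n orbT.
move=> r /andP[r0]; rewrite lt_min => /andP[rd _].
by apply: dV => //; rewrite /ball/= sub0r normrN gtr0_norm.
Qed.

Lemma upper_minkowski_dim_ge0 X : (0 <= upper_minkowski_dim X)%E.
Proof.
rewrite /upper_minkowski_dim; case: ifPn => // /set0P X0.
apply: le_ereal_inf_tmp => _ [V /at_right0_mem[r0 /andP[r00 r01] HV] <-].
have h0 : 0 < r0 / 2 by rewrite divr_gt0.
have h1 : r0 / 2 < r0 by rewrite ltr_pdivrMr// ltr_pMr// ltr1n.
apply: (@le_trans _ _
    (lne (covering_number (r0 / 2) X) * ((- ln (r0 / 2))^-1)%:E)%E).
  apply: mule_ge0; first by rewrite lne_ge0 covering_number_ge1.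
  by rewrite lee_fin invr_ge0 oppr_ge0 ln_le0// ltW// (lt_trans h1).
by apply: ereal_sup_ubound; exists (r0 / 2) => //; apply: HV; rewrite h0.
Qed.

Lemma packing_dim_ge0 X : (0 <= packing_dim X)%E.
Proof.
apply: le_ereal_inf_tmp => _ [F _ <-].
apply: (le_trans (upper_minkowski_dim_ge0 (F 0%N))).
by apply: ereal_sup_ubound; exists 0%N.
Qed.

Lemma covering_number_lt X (g : R) : (upper_minkowski_dim X < g%:E)%E -> X !=set0 ->
  exists2 r0, 0 < r0 & forall r, 0 < r < r0 ->
    (covering_number r X < (r `^ (- g))%:E)%E.
Proof.
move=> H /set0P X0; move: H; rewrite /upper_minkowski_dim ifN//.
move=> /ereal_inf_lt[_ [V /at_right0_mem[r0 /andP[r00 r01] HV] <-] Hsup].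
exists r0 => // r rr; have Vr := HV r rr; have /andP[rp rlt] := rr.
have lr : 0 < - ln r by rewrite oppr_gt0 ln_lt0// rp (lt_trans rlt).
have {Hsup} : (lne (covering_number r X) * ((- ln r)^-1)%:E < g%:E)%E.
  by apply: le_lt_trans Hsup; apply: ereal_sup_ubound; exists r.
rewrite lte_pdivrMr// => H; rewrite ltNge; apply/negP.
have gE : lne (r `^ (- g))%:E = (g%:E * (- ln r)%:E)%E.
  by rewrite lne_EFin ?powR_gt0// ln_powR -EFinM mulNr mulrN.
rewrite -lee_lne ?gE; last 2 first.
- by rewrite in_itv/= lee_fin powR_ge0 leey.
- by rewrite in_itv/= leey andbT (le_trans _ (covering_number_ge1 r ((set0P _).1 X0))).
by rewrite leNgt H.
Qed.

Lemma small_covers X (g : R) : (upper_minkowski_dim X < g%:E)%E ->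
  exists2 r0, 0 < r0 & forall r, 0 < r < r0 ->
    exists m (J : nat -> set R), [/\ m%:R <= r `^ (- g),
      X `<=` \bigcup_(j in [set j | (j < m)%N]) J j &
      forall j x y, J j x -> J j y -> `|x - y| <= r].
Proof.
move=> H; have [->|/set0P X0] := eqVneq X set0.
  exists 1 => // r _; exists 0%N, (fun=> set0).
  by split => //; rewrite powR_ge0.
have [r0 r00 Hr] := covering_number_lt H X0; exists r0 => // r rr.
have /ereal_inf_lt[_ [m [F [XF dF]] <-]] := Hr r rr; rewrite lte_fin => mr.
exists m, (fun j => if insub j is Some i then F i else set0); split.
- exact: ltW.
- move=> x /XF[i _ Fx]; exists (nat_of_ord i); first exact: ltn_ord.
  by rewrite valK.
- move=> j x y; case: insubP => // i _ _ Fx Fy.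
  by rewrite -lee_fin (le_trans (dist_le_diam Fx Fy)).
Qed.

Lemma packing_dim_lt X (g : R) : (packing_dim X < g%:E)%E ->
  exists2 F : nat -> set R, X = \bigcup_i F i &
    forall i, (upper_minkowski_dim (F i) < g%:E)%E.
Proof.
move=> /ereal_inf_lt[_ [F XF <-] H]; exists F => // i.
by apply: le_lt_trans H; apply: ereal_sup_ubound; exists i.
Qed.

Lemma count_le_sum_count (s : seq nat) (m : nat) (Q : pred nat) (Qj : nat -> pred nat) :
  (forall k, k \in s -> Q k -> exists2 j, (j < m)%N & Qj j k) ->
  (count Q s <= \sum_(j < m) count (Qj j) s)%N.
Proof.
move=> H; have cE (p : pred nat) : count p s = (\sum_(k <- s) p k)%N.
  by elim: (s) => [|k s' IH]; rewrite ?big_nil//= big_cons IH.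
rewrite cE (eq_bigr (fun j : 'I_m => \sum_(k <- s) Qj j k)%N); last by move=> j _; exact: cE.
rewrite exchange_big/= big_seq [leqRHS]big_seq; apply: leq_sum => k ks.
case: (boolP (Q k)) => // /(H k ks)[j jm Qk].
by rewrite (bigD1 (Ordinal jm))//= Qk.
Qed.

End packing.

(** * Hausdorff dimension of a preimage *)

Section preimage.
Context (R : realType).

(** A set of diameter [2 ^ (- a n)] in the image accounts for at most
    [2 ^ (b n)] codes of level [n], and the [i]-th piece of the image is covered by
    at most [2 ^ (a g n)] such sets as soon as [n] is large, depending on [i].
    Level [n] uses the pieces with [i <= n] that are ready, so that every point of
    [A] still belongs to infinitely many of the selected intervals. *)
Lemma hausdorff_dim_preimage_le (f : R -> R) (A : set R) (a K b g e : R)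
    (G : nat -> seq nat) (N1 N2 : nat) :
  A `<=` `[0%R, 1%R] -> 0 < a -> 0 < a * g + b -> 0 < e ->
  (forall n t, (N1 <= n)%N -> 0 <= t <= 1 ->
     `|f t - f (dyad n (dyad_code n t))| <= K * 2 `^ (- a * n%:R)) ->
  (forall n k0, (N2 <= n)%N -> k0 \in G n ->
     (count (fun k => `|f (dyad n k) - f (dyad n k0)| <=
        (2 * K + 1) * 2 `^ (- a * n%:R)) (G n))%:R <= 2 `^ (b * n%:R) :> R) ->
  (forall t, A t -> forall N, exists2 n, (N <= n)%N & dyad_code n t \in G n) ->
  (packing_dim (f @` A) < g%:E)%E ->
  (hausdorff_dim A <= (a * g + b + (e + e))%:E)%E.
Proof.
move=> A01 a0 gb0 e0 Hf HG HA /packing_dim_lt[F AF HF].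
have [r Hr] : exists r : nat -> R, forall i, 0 < r i /\
    forall x, 0 < x < r i -> exists m (J : nat -> set R), [/\ m%:R <= x `^ (- g),
      F i `<=` \bigcup_(j in [set j | (j < m)%N]) J j &
      forall j y z, J j y -> J j z -> `|y - z| <= x].
  have H i : exists r, 0 < r /\
    forall x, 0 < x < r -> exists m (J : nat -> set R), [/\ m%:R <= x `^ (- g),
      F i `<=` \bigcup_(j in [set j | (j < m)%N]) J j &
      forall j y z, J j y -> J j z -> `|y - z| <= x].
    by have [r0 ? ?] := small_covers (HF i); exists r0.
  by have [r Hr] := choice H; exists r.
pose q : R := 2 `^ (- a).
have q01 : 0 < q < 1 by exact: powR2N_lt1.
have qE n : 2 `^ (- a * n%:R) = q ^+ n.
  by rewrite powRrM powR_mulrn// ltW//; case/andP: q01.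
have [M HM] : exists M : nat -> nat, forall i n, (M i <= n)%N -> q ^+ n < r i.
  have H i : exists M, forall n, (M <= n)%N -> q ^+ n < r i.
    have [M _ HM] := expr_lt_near q01 ltr01 (Hr i).1.
    by exists M => n Mn; have := HM n Mn; rewrite /= mul1r.
  by have [M HM] := choice H; exists M.
(* The codes of level n met by the part of A that f maps into F i. *)
pose S i n k := `[< exists t, [/\ A t, F i (f t) & dyad_code n t = k] >].
have cS i n : (M i <= n)%N -> (N1 <= n)%N -> (N2 <= n)%N ->
    (count (S i n) (G n))%:R <= 2 `^ ((a * g + b) * n%:R) :> R.
  move=> Mn n1 n2.
  have qr : 0 < q ^+ n < r i by rewrite exprn_gt0 ?HM//; case/andP: q01.
  have [m [J [mq FJ dJ]]] := (Hr i).2 _ qr.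
  pose SJ j k := `[< exists t, [/\ A t, J j (f t) & dyad_code n t = k] >].
  apply: (@le_trans _ _ (\sum_(j < m) (count (SJ j) (G n))%:R)).
    rewrite -natr_sum ler_nat; apply: count_le_sum_count => k _.
    move=> /asboolP[t [At Ft tk]]; have [j jm Jt] := FJ _ Ft.
    by exists j => //; apply/asboolP; exists t.
  apply: (@le_trans _ _ (\sum_(j < m) 2 `^ (b * n%:R))).
    apply: ler_sum => j _.
    have [/hasP[k0 k0G /asboolP[t0 [At0 Jt0 tk0]]]|] := boolP (has (SJ j) (G n)); last first.
      by rewrite has_count lt0n negbK => /eqP ->; exact: powR_ge0.
    apply: le_trans (HG n k0 n2 k0G); rewrite ler_nat; apply: sub_count => k.
    move=> /asboolP[t [At Jt tk]].
    have t01 : 0 <= t <= 1 by have := A01 _ At; rewrite /= in_itv.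
    have t001 : 0 <= t0 <= 1 by have := A01 _ At0; rewrite /= in_itv.
    have := Hf n t n1 t01; have := Hf n t0 n1 t001; have := dJ j _ _ Jt Jt0.
    rewrite tk tk0 -qE; move: (2 `^ _) => z.
    rewrite /= !ler_norml => /andP[? ?] /andP[? ?] /andP[? ?].
    by apply/andP; split; lra.
  rewrite sumr_const card_ord -[leLHS]mulr_natl.
  have -> : (a * g + b) * n%:R = (- a * n%:R) * (- g) + b * n%:R by ring.
  rewrite powRD ?pnatr_eq0 ?implybT// ler_wpM2r ?powR_ge0//.
  by rewrite powRrM qE.
have [C C0 HC2] := sqr_le_pow2 e0.
have HC n : n.+1%:R <= C * 2 `^ (e * n%:R).
  by apply: le_trans (HC2 n); rewrite ler_eXnr// ler1n.
pose H n := if (maxn N1 N2 <= n)%N then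
  [seq k <- G n | has (fun i => (M i <= n)%N && S i n k) (iota 0 n.+1)] else [::].
apply: (@hausdorff_dim_limsup_le _ _ H C (a * g + b + e)) => //.
- by rewrite ltrD2l ltrDl.
- by rewrite addr_gt0// addr_gt0.
- move=> n; rewrite /H; case: ifPn => [|_]; last by rewrite mulr_ge0 ?powR_ge0// ltW.
  rewrite geq_max => /andP[n1 n2]; rewrite size_filter.
  apply: (@le_trans _ _ (\sum_(i < n.+1) (count (fun k => (M i <= n)%N && S i n k) (G n))%:R)).
    rewrite -natr_sum ler_nat.
    apply: (@count_le_sum_count _ _ _ (fun i k => (M i <= n)%N && S i n k)).
    by move=> k _ /hasP[i]; rewrite mem_iota add0n => /= i1 i2; exists i.
  apply: (@le_trans _ _ (\sum_(i < n.+1) 2 `^ ((a * g + b) * n%:R))).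
    apply: ler_sum => i _; case: (leqP (M i) n) => Mn; first exact: cS.
    by rewrite count_pred0 powR_ge0.
  rewrite sumr_const card_ord -[leLHS]mulr_natl [(_ + e) * _]mulrDl.
  rewrite powRD ?pnatr_eq0 ?implybT//.
  by rewrite [leRHS]mulrCA [leLHS]mulrC ler_wpM2l ?powR_ge0.
- move=> t At N.
  have [i _ Fi] : (\bigcup_i F i) (f t) by rewrite -AF; exists t.
  have [n nN nG] := HA t At (maxn (maxn N1 N2) (maxn N (maxn i (M i)))).
  exists n; first by lia.
  rewrite /H; have -> : (maxn N1 N2 <= n)%N by lia.
  rewrite mem_filter nG andbT; apply/hasP; exists i.
    by rewrite mem_iota; lia.
  apply/andP; split; first by lia.
  by apply/asboolP; exists t.
Qed.

End preimage.

(** * Packing dimension on the line *)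

Section packing_upper_bound.
Context (R : realType).
Implicit Types X : set R.

Lemma covering_number_segment_le X (M e : R) : X `<=` `[- M, M] -> 0 <= M ->
  0 < e -> (covering_number e X <= (2 * M / e + 1)%:E)%E.
Proof.
move=> XM M0 e0; pose n := (Num.truncn (2 * M / e)).+1.
have y0 : 0 <= 2 * M / e by rewrite divr_ge0 ?mulr_ge0// ltW.
apply: (@le_trans _ _ (n%:R : R)%:E); last first.
  by rewrite lee_fin /n -natr1 lerD2r truncn_le.
apply: ereal_inf_lbound; exists n => //.
exists (fun j : 'I_n => `[(- M + j%:R * e), (- M + j.+1%:R * e)]%classic); split.
- move=> x /XM; rewrite /= in_itv/= => /andP[x1 x2].
  have z0 : 0 <= (x + M) / e by rewrite divr_ge0 ?(ltW e0)//; lra.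
  have jn : (Num.truncn ((x + M) / e) < n)%N.
    rewrite ltnS le_truncn// ler_wpM2r ?invr_ge0 ?(ltW e0)//; lra.
  exists (Ordinal jn) => //=; rewrite in_itv/=.
  have h1 : (Num.truncn ((x + M) / e))%:R * e <= x + M.
    by rewrite -ler_pdivlMr// truncn_le.
  have h2 : x + M < (Num.truncn ((x + M) / e)).+1%:R * e.
    by rewrite -ltr_pdivrMr//; exact: truncnS_gt.
  by apply/andP; split; lra.
- move=> j; apply: diam_le; first exact: ltW.
  move=> x y; rewrite /= !in_itv/= -natr1 mulrDl mul1r => /andP[? ?] /andP[? ?].
  by rewrite ler_norml; apply/andP; split; lra.
Qed.

Lemma upper_minkowski_dim_segment_le1 X (M : R) : X `<=` `[- M, M] -> 0 <= M ->
  (upper_minkowski_dim X <= 1)%E.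
Proof.
move=> XM M0; rewrite /upper_minkowski_dim; case: ifPn => [_|/set0P X0].
  by rewrite lee_fin.
apply/lee_addgt0Pr => eta eta0.
(* For [e < r0], the number [(2 M + 1) / e] is at most [e ^ (- (1 + eta))]. *)
pose r0 : R := Num.min 2^-1 ((2 * M + 1) `^ (- eta^-1)).
have M1 : 0 < 2 * M + 1 by lra.
have r00 : 0 < r0 by rewrite lt_min invr_gt0 ltr0n/= powR_gt0.
have r01 : r0 < 1 by rewrite gt_min invf_lt1// ltr1n.
apply: ge_ereal_inf.
exists (ereal_sup [set lne (covering_number e X) * ((- ln e)^-1)%:E | e in [set` `]0%R, r0[]])%E.
  exists `]0, r0[%classic => //.
  apply: filterS (filterI (nbhs_right_gt (0 : R)) (nbhs_right_lt r00)) => x [x0 xr].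
  by rewrite /= in_itv/= x0 xr.
apply: ge_ereal_sup => _ [e /= + <-]; rewrite in_itv/= => /andP[e0 er].
have e1 : e < 1 by exact: lt_trans er r01.
have le : 0 < - ln e by rewrite oppr_gt0 ln_lt0// e0.
rewrite lee_pdivrMr//.
have gE : lne (e `^ (- (1 + eta)))%:E = ((1 + eta)%:E * (- ln e)%:E)%E.
  by rewrite lne_EFin ?powR_gt0// ln_powR -EFinM mulNr mulrN.
rewrite -EFinD -gE lee_lne; last 2 first.
- by rewrite in_itv/= leey andbT (le_trans _ (covering_number_ge1 e X0)).
- by rewrite in_itv/= lee_fin powR_ge0 leey.
apply: (le_trans (covering_number_segment_le XM M0 e0)); rewrite lee_fin.
rewrite opprD powRD ?(gt_eqF e0) ?implybT// powR_inv1 ?(ltW e0)//.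
apply: (@le_trans _ _ (e^-1 * (2 * M + 1))).
  rewrite mulrDr mulr1 [e^-1 * _]mulrC lerD2l -[leLHS]invr1 lef_pV2 ?posrE//.
  exact: ltW.
rewrite ler_wpM2l ?invr_ge0 ?(ltW e0)//.
have eM : e <= (2 * M + 1) `^ (- eta^-1).
  by apply: (le_trans (ltW er)); rewrite ge_min lexx orbT.
have : e `^ eta <= ((2 * M + 1) `^ (- eta^-1)) `^ eta.
  by apply: ge0_ler_powR => //; rewrite ?nnegrE ?powR_ge0 ?(ltW e0) ?(ltW eta0).
rewrite -powRrM mulNr mulVf ?gt_eqF// powR_inv1 ?(ltW M1)// powRN.
by rewrite -[X in _ -> X <= _]invrK lef_pV2 ?posrE ?invr_gt0 ?powR_gt0.
Qed.

Lemma packing_dim_le1 X : (packing_dim X <= 1)%E.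
Proof.
apply: ge_ereal_inf.
pose F i := X `&` `[- i%:R, i%:R]%classic.
exists (ereal_sup (range (fun i => upper_minkowski_dim (F i)))).
  exists F => //=; apply/seteqP; split => [x Xx|x [i _ []]//].
  exists (Num.truncn `|x|).+1 => //; split => //=.
  by rewrite in_itv/= -ler_norml ltW// truncnS_gt.
apply: ge_ereal_sup => _ [i _ <-].
by apply: (@upper_minkowski_dim_segment_le1 _ i%:R) => // x [].
Qed.

End packing_upper_bound.

(** * Uniform dimension bound *)

Section dimension_of_images.
Context (R : realType) (d : measure_display) (T : measurableType d).
Context (P : probability T R) (alpha : R) (B : R -> {RV P >-> R}).
Hypothesis alpha01 : 0 < alpha < 1.
Hypothesis hB : fractional_brownian_motion alpha `[0%R, 1%R] B.

(** The codes, and hence the exceptional event, depend on [D] and [e] but not on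
    [A]. *)
Lemma ae_hausdorff_dim_le (D : set R) (e : R) : D `<=` `[0%R, 1%R] ->
  (hausdorff_dim D <= alpha%:E)%E -> 0 < e < alpha ->
  {ae P, forall w, forall (A : set R) (g : R), A `<=` D -> 0 < g ->
    (packing_dim ((fun t => B t w) @` A) < g%:E)%E ->
    (hausdorff_dim A <= ((alpha - e) * g + 4 * e + (e + e))%:E)%E}.
Proof.
move=> D01 HD /andP[e0 ea]; have /andP[a0 a1] := alpha01.
have s0 : 0 < alpha + e by rewrite addr_gt0.
have HD' : (hausdorff_dim D < (alpha + e)%:E)%E.
  by apply: le_lt_trans HD _; rewrite lte_fin ltrDl.
have [G [uG bG rG cG]] := regular_cover s0 D01 (hausdorff_dim_codes D01 HD' s0).
have ae0 : 0 < alpha - e by rewrite subr_gt0.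
have q1 : 0 < 1 - 2 `^ (- (alpha - e)) :> R.
  by rewrite subr_gt0; case/andP: (powR2N_lt1 ae0).
pose K := (1 - 2 `^ (- (alpha - e)))^-1 : R.
have K0 : 0 < K by rewrite invr_gt0.
have K1 : 0 < 2 * K + 1 by lra.
have clusters := ae_small_clusters alpha01 hB e0 K1 (ltr0n R 3) uG bG rG.
have modulus := ae_modulus hB (introT andP (conj e0 ea)).
apply: filterS2 clusters modulus => w [N2 H2] [N1 H1] A g AD g0 pg.
apply: (hausdorff_dim_preimage_le (K := K) (G := G) (N1 := N1) (N2 := N2) _ _ _ e0 _ _ _ pg) => //.
- exact: subset_trans AD D01.
- by rewrite addr_gt0// mulr_gt0.
- by move=> n k0 N2n k0G; exact: H2.
- by move=> t At; apply: cG; exact: AD.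
Qed.

Lemma ae_packing_dim_ge (D : set R) : D `<=` `[0%R, 1%R] ->
  (hausdorff_dim D <= alpha%:E)%E ->
  {ae P, forall w, forall A : set R, A `<=` D ->
    ((alpha^-1)%:E * hausdorff_dim A <= packing_dim ((fun t => B t w) @` A))%E}.
Proof.
move=> D01 HD; have /andP[a0 a1] := alpha01.
pose e q : R := alpha / q.+2%:R.
have e0 q : 0 < e q < alpha.
  by rewrite divr_gt0//= ltr_pdivrMr// ltr_pMr// ltr1n.
have := ae_foralln (fun q => ae_hausdorff_dim_le D01 HD (e0 q)).
apply: filterS => w Hw A AD.
set pk := packing_dim _; have pk0 : (0 <= pk)%E by exact: packing_dim_ge0.
case E : pk pk0 => [p| |] // p0; last by rewrite leey.
rewrite lee_fin in p0.
rewrite lee_pdivrMl// -EFinM; apply/lee_addgt0Pr => eta eta0.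
have [q qe] : exists q, e q <= eta / 12.
  exists (Num.truncn (12 / eta)).
  rewrite /e ler_pdivrMr// -ler_pdivrMl ?divr_gt0// invf_div.
  apply: (@le_trans _ _ (12 / eta)).
    by rewrite ler_piMr ?(ltW a1)// ltW// divr_gt0.
  apply: (le_trans (ltW (truncnS_gt _))); rewrite ler_nat//.
have g0 : 0 < p + eta / 2 by rewrite ltr_wpDl// divr_gt0.
have pg : (pk < (p + eta / 2)%:E)%E by rewrite E lte_fin ltrDl divr_gt0.
apply: (le_trans (Hw q A _ AD g0 pg)); rewrite -EFinD lee_fin.
have /andP[eq0 _] := e0 q.
have h1 : 0 <= e q * (p + eta / 2) by rewrite mulr_ge0// ltW.
have h2 : alpha * (eta / 2) <= eta / 2 by rewrite ler_piMl ?(ltW a1)// ltW// divr_gt0.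
by lra.
Qed.

End dimension_of_images.
Local Open Scope ereal_scope.

Theorem theorem1p9 (R : realType) (d : measure_display) (T : measurableType d)
    (P : probability T R) (alpha : R) (B : R -> {RV P >-> R})
    (halpha : (0 < alpha < 1)%R)
    (hB : fractional_brownian_motion alpha `[0%R, 1%R] B)
    (D : set R) (hD : D `<=` `[0%R, 1%R]) :
  {ae P, forall w, forall A : set R, A `<=` D ->
     (alpha^-1)%:E * hausdorff_dim A <= packing_dim ((fun t => B t w) @` A)}
  <-> hausdorff_dim D <= alpha%:E.
Proof.
split; last exact: ae_packing_dim_ge.
move=> H; have /andP[a0 _] := halpha.
have PT : 0 < P [set: T] by rewrite probability_setT.
have [w Hw] := @filter_ex _ _ (ae_properfilter_algebraOfSetsType PT) _ H.
have := le_trans (Hw D (@subset_refl _ D)) (packing_dim_le1 _).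
by rewrite lee_pdivrMl// mule1.
Qed.
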